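(* Let $u,v,w$ be weights on $\mathbb{R}$ such that $u^{-1}$ and $vw^{2t}$ are also weights, let $t\in\mathbb{R}$, and let $\sigma=\{\sigma_I\}_{I\in\mathcal{D}}$ be a choice of signs. For the operators $T^t_{w,\sigma}$ and $T_{\sigma}T_{w,t}$, the following are equivalent. (1) $T^t_{w,\sigma}$ is a bounded operator from $L^2(u)$ into $L^2(v)$. (2) $T_{\sigma}T_{w,t}$ is a bounded operator from $L^2(u)$ into $L^2(vw^{2t})$. (3) There is a constant $C>0$ such that $\langle v^{1/2}\,T^t_{w,\sigma}(u^{-1/2}f),g\rangle \leq C\|f\|_{L^2(\mathbb{R})}\|g\|_{L^2(\mathbb{R})}$ for all $f,g\in L^2(\mathbb{R})$. (4) There is a constant $C>0$ such that $\langle v^{1/2}w^t\, (T_{\sigma}T_{w,t})(u^{-1/2}f),g\rangle \leq C\|f\|_{L^2(\mathbb{R})}\|g\|_{L^2(\mathbb{R})}$ for all $f,g\in L^2(\mathbb{R})$. (5) There is a constant $C>0$ such that for all dyadic intervals $I$ the following two inequalities hold: $$\int_{\mathbb{R}}\left|\sum_{K\in\mathcal{D}}\frac{\sigma_K}{\langle w\rangle_K^t}\langle \mathbf{1}_I u^{-1}, h_K\rangle h_K(x)\right|^2 v(x)\, w^{2t}(x)\, dx\leq C\,u^{-1}(I),$$ $$\int_{\mathbb{R}}\left|\sum_{K\in\mathcal{D}}\frac{\sigma_K}{\langle w\rangle_K^t}\langle \mathbf{1}_I vw^{2t}, h_K\rangle h_K(x)\right|^2 u^{-1}(x)\, dx\leq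 C\,(vw^{2t})(I).$$ (6) There is a constant $C>0$ such that the following two conditions hold: (a) for all dyadic intervals $I$ and $J$ satisfying $|J|=|I|$, $$\left|\left\langle \sum_{K\in\mathcal{D}}\frac{\sigma_K}{\langle w\rangle_K^t}\langle \mathbf{1}_I,h_K\rangle h_K,\ \mathbf{1}_J\right\rangle\right|\leq C \sqrt{u^{-1}(I)\, (vw^{2t})(J)};$$ (b) for all dyadic intervals $I$, $$\int_{I}\left|\sum_{K\in\mathcal{D}}\frac{\sigma_K}{\langle w\rangle_K^t}\langle \mathbf{1}_I u^{-1}, h_K\rangle h_K(x)\right|^2 v(x)\,w^{2t}(x)\, dx\leq C\,u^{-1}(I),$$ $$\int_{I}\left|\sum_{K\in\mathcal{D}}\frac{\sigma_K}{\langle w\rangle_K^t}\langle \mathbf{1}_I vw^{2t}, h_K\rangle h_K(x)\right|^2 u^{-1}(x)\, dx\leq C\,(vw^{2t})(I).$$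
   Context: A weight is an almost everywhere positive, locally integrable function on $\mathbb{R}$; for a weight $\mu$ and measurable $E$, $\mu(E)=\int_E\mu(x)\,dx$, and $L^2(\mu)$ is the space of functions $f$ with $\int_{\mathbb{R}}|f(x)|^2\mu(x)\,dx<\infty$. $\mathcal{D}$ is the set of standard dyadic intervals $[2^{-j}k,2^{-j}(k+1))$, $j,k\in\mathbb{Z}$. For $I\in\mathcal{D}$, $I_+$ and $I_-$ are its right and left halves, $|I|$ is its length, $\mathbf{1}_I$ its characteristic function, $\langle f\rangle_I=\frac{1}{|I|}\int_I f(x)\,dx$, $h_I=|I|^{-1/2}(\mathbf{1}_{I_+}-\mathbf{1}_{I_-})$ is the Haar function, and $\langle f,g\rangle$ is the $L^2(\mathbb{R})$ inner product. A choice of signs means $\sigma_I=\pm1$ for every $I\in\mathcal{D}$. The operators are defined formally, on locally integrable functions $f$, by $$T^t_{w,\sigma} f(x) = \sum_{I\in \mathcal{D}} \sigma_I\left (\frac{w(x)}{\langle w\rangle_I}\right )^t \langle f,h_I\rangle \,h_I(x),\qquad (T_{\sigma}T_{w,t})f(x)=\sum_{I\in\mathcal{D}}\frac{\sigma_I}{\langle w\rangle_I^t}\langle f, h_I\rangle h_I(x).$$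
   Formalization: In (6)(a) the indicators 1_I and 1_J are replaced by 1_I u^{-1} and 1_J v w^{2t}; as printed the claim is false (w=1, σ=1, u=1, v=exp(-|x|), I=J=[n,n+1)). T f for f in L^2(u) is read as the limit over truncations of f. *)

(* Defs.v *)
From HB Require Import structures.
From mathcomp Require Import all_boot all_order all_algebra.
From mathcomp Require Import all_classical all_reals all_analysis.

Set Implicit Arguments.
Unset Strict Implicit.
Unset Printing Implicit Defensive.

Import Order.TTheory GRing.Theory Num.Theory.
Import numFieldTopology.Exports numFieldNormedType.Exports.

Local Open Scope classical_set_scope.
Local Open Scope ring_scope.

(* All functions are real valued; "measurable" is Borel measurable. *)

Section weights.
Context {R : realType}.
Implicit Types (mu f g : R -> R).

Definition weight mu : Prop :=
  locally_integrable [set: R] mu /\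
  {ae @lebesgue_measure R, forall x, 0 < mu x}.

Definition mass mu (E : set R) : R :=
  \int[@lebesgue_measure R]_(x in E) mu x.

(* Membership in L^2(mu), for a density mu that is positive only a.e.; the
   unweighted L^2(R) is the case [mu = cst 1]. *)
Definition L2 mu f : Prop :=
  measurable_fun [set: R] f /\
  (\int[@lebesgue_measure R]_x (`|f x| ^+ 2 * mu x)%:E < +oo)%E.

Definition norm2 mu f : R :=
  Num.sqrt (\int[@lebesgue_measure R]_x (`|f x| ^+ 2 * mu x)).

Definition inner f g : R := \int[@lebesgue_measure R]_x (f x * g x).

(* The integral defining [inner f g] converges absolutely; otherwise [inner]
   is a default value. *)
Definition inner_defined f g : Prop :=
  (@lebesgue_measure R).-integrable [set: R] (fun x => (f x * g x)%:E).

End weights.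

(* The pair (j, k) stands for the interval [2^-j k, 2^-j (k+1)[; this is a
   bijection onto the standard dyadic intervals. *)
Definition dyadic := (int * int)%type.

Section dyadic_intervals.
Context {R : realType}.
Implicit Types (I K : dyadic) (f w : R -> R).

Definition len I : R := 2 ^ (- I.1).

Definition ditv I : set R :=
  `[len I * I.2%:~R, len I * (I.2 + 1)%:~R[%classic.

Definition left_half I : dyadic := (I.1 + 1, 2 * I.2).
Definition right_half I : dyadic := (I.1 + 1, 2 * I.2 + 1).

Definition average f I : R :=
  (len I)^-1 * \int[@lebesgue_measure R]_(x in ditv I) f x.

Definition haar I (x : R) : R :=
  len I `^ (- 2^-1) * (\1_(ditv (right_half I)) x - \1_(ditv (left_half I)) x).

(* A formal operator: [A f K x] is the K-th term, at x, of the series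
   over the dyadic intervals that defines A f. *)
Definition formal_op := (R -> R) -> dyadic -> R -> R.

Definition T_haar (w : R -> R) (sigma : dyadic -> R) (t : R) : formal_op :=
  fun f K x =>
    sigma K * (w x / average w K) `^ t * inner f (haar K) * haar K x.

Definition T_sigma_T_w (w : R -> R) (sigma : dyadic -> R) (t : R) : formal_op :=
  fun f K x =>
    sigma K / average w K `^ t * inner f (haar K) * haar K x.

(* The sum over the K with 2^-n <= |K| <= 2^m.  At a given x only the m+n+1
   intervals K containing x contribute, so this is a finite sum. *)
Definition partial_sum (A : formal_op) f (x : R) (mn : nat * nat) : R :=
  \sum_(K \in [set K : dyadic | - (mn.1)%:Z <= K.1 <= (mn.2)%:Z]) A f K x.

(* The series is summed pointwise, as a doubly infinite series over the scales,
   with independent limits at the small and at the large scales. *)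
Definition op_defined (A : formal_op) f : Prop :=
  {ae @lebesgue_measure R, forall x,
    cvg (partial_sum A f x @ filter_prod \oo \oo)}.

Definition op_val (A : formal_op) f (x : R) : R :=
  lim (partial_sum A f x @ filter_prod \oo \oo).

(* For a general f in L^2(u) the averages of f over large intervals, hence the
   large scales of the series, need not be controlled, even when the operator
   satisfies a bound on the functions with bounded support (which are dense).
   E.g. for w = 1, sigma = 1, u = v = (1+|x|)^-3 the series is f if f has
   bounded support, but diverges a.e. on x > 0 for f = max(x,0)^(1/2).  So f is
   reached through its truncations, i.e. the formal operator is extended by
   density. *)
Definition trunc (n : nat) f : R -> R :=
  fun x => f x * \1_(`[- n%:R, n%:R]%classic : set R) x.

(* F = A f, as an element of L^2(v) *)
Definition L2_value (A : formal_op) (v f F : R -> R) : Prop :=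
  [/\ L2 v F,
      forall n, op_defined A (trunc n f) /\ L2 v (op_val A (trunc n f)) &
      norm2 v (fun x => op_val A (trunc n f) x - F x) @[n --> \oo] --> 0].

Definition bounded_op (A : formal_op) (u v : R -> R) : Prop :=
  exists2 C : R, 0 < C & forall f, L2 u f ->
    exists2 F, L2_value A v f F & norm2 v F <= C * norm2 u f.

(* l = < b * A f, g > *)
Definition inner_value (A : formal_op) (b f g : R -> R) (l : R) : Prop :=
  let Af n x := b x * op_val A (trunc n f) x in
  (forall n, op_defined A (trunc n f) /\ inner_defined (Af n) g) /\
  inner (Af n) g @[n --> \oo] --> l.

(* The a.e. convergence on D I of the series A (1_I mu) is part of the
   condition. *)
Definition testing (A : formal_op) (mu nu : R -> R) (D : dyadic -> set R)
    (C : R) : Prop :=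
  forall I, let f := fun x => \1_(ditv I) x * mu x in
    {ae @lebesgue_measure R, forall x, D I x ->
      cvg (partial_sum A f x @ filter_prod \oo \oo)} /\
    (\int[@lebesgue_measure R]_(x in D I) (`|op_val A f x| ^+ 2 * nu x)%:E
      <= (C * mass mu (ditv I))%:E)%E.

(* The pairing is <A_mu 1_I, 1_J>_nu where A_mu f = A (f mu): the Haar
   coefficients of 1_I are taken in L^2(mu), the outer product in L^2(nu).
   With Lebesgue measure instead, boundedness of A from L^2(mu^-1) into L^2(nu)
   would not imply the inequality: take for A the identity (w = 1, sigma = 1),
   mu = 1, nu = exp(-|x|) and I = J = [n, n+1[. *)
Definition weak_testing (A : formal_op) (mu nu : R -> R) (C : R) : Prop :=
  forall I J, @len I = @len J ->
    let f := fun x => \1_(ditv I) x * mu x in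
    let g := fun x => \1_(ditv J) x * nu x in
    [/\ op_defined A f, inner_defined (op_val A f) g &
        `|inner (op_val A f) g|
          <= C * Num.sqrt (mass mu (ditv I) * mass nu (ditv J))].

End dyadic_intervals.

(* Main.v *)
Require Import Defs.
From HB Require Import structures.
From mathcomp Require Import all_boot all_order all_algebra.
From mathcomp Require Import all_classical all_reals all_analysis.
From mathcomp Require Import measurable_realfun ring lra zify.

(** Where [w] is positive, [T f] is [w `^ t] times [S f], and [S] is the Haar multiplier
    [haar_mult a] with [a K = sigma K / average w K `^ t]. With [mu = u^-1] and
    [nu = v w^(2t)], all the conditions turn around one inequality,
      [int (S f)^2 nu <= c int f^2 mu^-1],
    called [compact_bound] on the functions with bounded support. It extends to
    [L^2(u)] by density ([compact_bound_bounded]); it is equivalent to the bounds of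
    the bilinear forms by duality ([bounded_form], [form_compact_bound]); applied to the
    functions [1_I mu] and, by duality, to the adjoint, it gives the testing conditions
    on the line, and these give the local and the weak ones by restriction and by the
    Cauchy-Schwarz inequality. What remains is the two-weight theorem: the local testing
    conditions and the weak one imply [compact_bound].

    Its proof rests on the kernel of a Haar multiplier being constant on the product of
    the two halves of a dyadic interval [K]: if [f] lives on one half, the series is on
    the other half the integral of [f] times a number [cross a K] ([op_cvg_sibling]).
    For step functions [f] and [g] of given integrals, the form of [f mu] and [g nu] is
    thus computed by a recursion on the binary tree of dyadic intervals, from the
    numbers [cross] and from the values [pairing] at the pairs of indicators of one
    interval ([form], [step_form]). Its increments along the tree split into two
    paraproducts and a diagonal part. The weak testing condition bounds [cross]. Testing
    on [K] bounds [pairing] and the paraproducts: on a subinterval [J] of [K] the testing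
    functions of [J] and of [K] differ by a constant, hence have the same coefficients
    below [J], and these satisfy a Carleson condition ([carleson_testing],
    [carleson_embedding]). This bounds the form ([form_bound]), then the operator, by
    pairing [S f] with its own averages ([step_bound]).

    The coefficients are bounded only along almost every branch, and a function [f] of
    [L^2(u)] is only in [L^1] locally, so the series converges almost everywhere and in
    no function space. On a good set, of the points around which the averages of [|f|]
    and the coefficients stay below some [lam], it is an [L^2] convergent Haar series,
    up to a constant due to the large scales ([good_operator]); this is the good part of
    a Calderon-Zygmund decomposition, and the good sets exhaust almost every point.
    Convergence almost everywhere ([ae_op_cvg]), the passage from step functions to all
    functions ([op_bound_closed]) and the symmetry that duality needs ([op_symmetric])
    all follow. At the large scales, convergence is that of the series of the [a L / len L]
    over the intervals [L] above a given one; it follows from the convergence of the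
    series for one testing function ([testing_tails]). *)

Set Implicit Arguments.
Unset Strict Implicit.
Unset Printing Implicit Defensive.

Import Order.TTheory GRing.Theory Num.Theory.
Import numFieldTopology.Exports numFieldNormedType.Exports.

Local Open Scope classical_set_scope.
Local Open Scope ring_scope.

(** * Bilinear forms on a binary tree *)

Section binary_trees.
Context {R : realFieldType} {T : Type} (l r : T -> T).
Implicit Types (F G m n c : T -> R) (K : T) (d : nat).

Fixpoint nodesum d F K : R :=
  if d is d'.+1 then F K + (nodesum d' F (l K) + nodesum d' F (r K)) else 0.

Fixpoint leafsum d F K : R :=
  if d is d'.+1 then leafsum d' F (l K) + leafsum d' F (r K) else F K.

Definition tree_additive F := forall K, F K = F (l K) + F (r K).

Lemma nodesum_ge0 d F K : (forall K, 0 <= F K) -> 0 <= nodesum d F K.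
Proof. by move=> F0; elim: d K => //= d IH K; rewrite !addr_ge0. Qed.

Lemma ler_nodesum d F G K : (forall K, F K <= G K) -> nodesum d F K <= nodesum d G K.
Proof. by move=> FG; elim: d K => //= d IH K; rewrite !lerD. Qed.

Lemma nodesumD d F G K :
  nodesum d (fun J => F J + G J) K = nodesum d F K + nodesum d G K.
Proof. by elim: d K => [|d IH] K /=; rewrite ?addr0// !IH; ring. Qed.

Lemma nodesumZ d a F K : nodesum d (fun J => a * F J) K = a * nodesum d F K.
Proof. by elim: d K => [|d IH] K /=; rewrite ?mulr0// !IH; ring. Qed.

Lemma nodesum_eq_in (P : T -> Prop) d F G K :
  (forall J, P J -> P (l J) /\ P (r J)) -> (forall J, P J -> F J = G J) ->
  P K -> nodesum d F K = nodesum d G K.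
Proof.
by move=> hP FG; elim: d K => //= d IH K PK; have [? ?] := hP _ PK;
  rewrite FG// !IH.
Qed.

Lemma ler_norm_nodesum d F K : `|nodesum d F K| <= nodesum d (fun J => `|F J|) K.
Proof.
elim: d K => [|d IH] K /=; first by rewrite normr0.
by rewrite (le_trans (ler_normD _ _))// lerD2l (le_trans (ler_normD _ _))// lerD.
Qed.

Lemma leafsum_eq d F G K : (forall K, F K = G K) -> leafsum d F K = leafsum d G K.
Proof. by move=> FG; elim: d K => //= d IH K; rewrite !IH. Qed.

Lemma leafsum_eq_in (P : T -> Prop) d F G K :
  (forall J, P J -> P (l J) /\ P (r J)) -> (forall J, P J -> F J = G J) ->
  P K -> leafsum d F K = leafsum d G K.
Proof.
by move=> hP FG; elim: d K => [|d IH] K PK /=; rewrite ?FG//;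
  have [? ?] := hP _ PK; rewrite !IH.
Qed.

Lemma ler_leafsum_in (P : T -> Prop) d F G K :
  (forall J, P J -> P (l J) /\ P (r J)) -> (forall J, P J -> F J <= G J) ->
  P K -> leafsum d F K <= leafsum d G K.
Proof.
by move=> hP FG; elim: d K => [|d IH] K PK /=; rewrite ?FG//;
  have [? ?] := hP _ PK; rewrite lerD// IH.
Qed.

Lemma ler_leafsum d F G K : (forall K, F K <= G K) -> leafsum d F K <= leafsum d G K.
Proof. by move=> FG; apply: (@ler_leafsum_in (fun=> True)). Qed.

Lemma leafsumD d F G K :
  leafsum d (fun J => F J + G J) K = leafsum d F K + leafsum d G K.
Proof. by elim: d K => //= d IH K; rewrite !IH; ring. Qed.

Lemma leafsumZ d a F K : leafsum d (fun J => a * F J) K = a * leafsum d F K.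
Proof. by elim: d K => //= d IH K; rewrite !IH; ring. Qed.

Lemma leafsum_additive d F K : tree_additive F -> leafsum d F K = F K.
Proof. by move=> aF; elim: d K => //= d IH K; rewrite !IH -aF. Qed.

(** [jump m F K ^+ 2 * jump_mass m K] is the squared coefficient of the measure [F]
    along the Haar function of [K] that is adapted to the mass [m]. *)
Definition jump m F K := F (l K) / m (l K) - F (r K) / m (r K).
Definition jump_mass m K := m (l K) * m (r K) / m K.

Lemma jump_mass_ge0 m K : (forall K, 0 < m K) -> 0 <= jump_mass m K.
Proof. by move=> m0; rewrite /jump_mass !mulr_ge0 ?invr_ge0// ltW. Qed.

(** Parseval's identity for the adapted Haar functions: the sum over the leaves is
    the squared norm, in [L^2(m)], of the step function with integrals [F]. *)
Lemma haar_parseval m F d K : (forall K, 0 < m K) -> tree_additive m -> tree_additive F ->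
  nodesum d (fun J => jump m F J ^+ 2 * jump_mass m J) K + F K ^+ 2 / m K =
  leafsum d (fun J => F J ^+ 2 / m J) K.
Proof.
move=> m0 am aF; elim: d K => [|d IH] K /=; first by rewrite add0r.
rewrite -!IH /jump /jump_mass (am K) (aF K).
have := m0 (l K); have := m0 (r K).
move: (m (l K)) (m (r K)) (F (l K)) (F (r K)) => a b x y b0 a0.
have a1 : a != 0 by rewrite gt_eqF.
have b1 : b != 0 by rewrite gt_eqF.
have ab1 : a + b != 0 by rewrite gt_eqF// addr_gt0.
by field; rewrite a1 b1 ab1.
Qed.

Lemma ler_parseval m F d K : (forall K, 0 < m K) -> tree_additive m -> tree_additive F ->
  nodesum d (fun J => jump m F J ^+ 2 * jump_mass m J) K <=
    leafsum d (fun J => F J ^+ 2 / m J) K /\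
  F K ^+ 2 / m K <= leafsum d (fun J => F J ^+ 2 / m J) K.
Proof.
move=> m0 am aF; rewrite -(haar_parseval d K m0 am aF); split.
  by rewrite lerDl mulr_ge0 ?sqr_ge0 ?invr_ge0 ?ltW.
by rewrite lerDr nodesum_ge0// => J; rewrite mulr_ge0 ?sqr_ge0 ?jump_mass_ge0.
Qed.

Lemma sqr_divD (x y p q : R) : 0 < p -> 0 < q ->
  (x + y) ^+ 2 / (p + q) <= x ^+ 2 / p + y ^+ 2 / q.
Proof.
move=> p0 q0; have p1 : p != 0 by rewrite gt_eqF.
have q1 : q != 0 by rewrite gt_eqF.
have pq1 : p + q != 0 by rewrite gt_eqF// addr_gt0.
rewrite -subr_ge0 (_ : _ - _ = (x * q - y * p) ^+ 2 / (p * q * (p + q))).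
  by rewrite mulr_ge0 ?sqr_ge0// invr_ge0 !mulr_ge0 ?addr_ge0 ?ltW.
by field; rewrite p1 q1 pq1.
Qed.

(** Carleson embedding. With [S] the sum of the [c J] below [K], the Bellman
    function is [C^2 F^2 / (C m + S)]: it is convex in [(F, m, S)], and its
    decay in [S] pays for the term [c K (F K / m K)^2]. *)
Lemma carleson_embedding m F c (C : R) d K :
  (forall K, 0 < m K) -> tree_additive m -> tree_additive F -> (forall K, 0 <= c K) ->
  0 < C -> (forall d K, nodesum d c K <= C * m K) ->
  nodesum d (fun J => c J * (F J / m J) ^+ 2) K <=
  4 * C * leafsum d (fun J => F J ^+ 2 / m J) K.
Proof.
move=> m0 am aF c0 C0 cC.
suff H : nodesum d (fun J => c J * (F J / m J) ^+ 2) K +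
    4 * C ^+ 2 * (F K ^+ 2 / (C * m K + nodesum d c K)) <=
    4 * C * leafsum d (fun J => F J ^+ 2 / m J) K.
  have C1 := ltW C0; have m1 := ltW (m0 K); have S1 := nodesum_ge0 d K c0.
  apply: le_trans H; rewrite lerDl.
  by rewrite !(sqr_ge0, invr_ge0, addr_ge0, mulr_ge0).
elim: d K => [|d IH] K /=.
  have h : m K != 0 by rewrite gt_eqF.
  have h' : C != 0 by rewrite gt_eqF.
  by rewrite addr0 add0r le_eqVlt; apply/orP; left; apply/eqP; field; rewrite h h'.
have /= H := cC d.+1 K.
have IHl := IH (l K); have IHr := IH (r K).
rewrite (mulrDr (4 * C)); apply: le_trans (lerD IHl IHr).
have := sqr_divD (F (l K)) (F (r K))
  (_ : 0 < C * m (l K) + nodesum d c (l K)) (_ : 0 < C * m (r K) + nodesum d c (r K)).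
have Sl := nodesum_ge0 d (l K) c0; have Sr := nodesum_ge0 d (r K) c0.
move=> /(_ (ltr_pwDl (mulr_gt0 C0 (m0 _)) Sl) (ltr_pwDl (mulr_gt0 C0 (m0 _)) Sr)).
rewrite -(aF K).
rewrite (_ : C * m (l K) + nodesum d c (l K) + (C * m (r K) + nodesum d c (r K)) =
  C * m K + (nodesum d c (l K) + nodesum d c (r K))); last by rewrite (am K); ring.
move: H; set S := nodesum d c (l K) + _ => H.
have S0 : 0 <= S by rewrite addr_ge0.
set A := F (l K) ^+ 2 / _; set B := F (r K) ^+ 2 / _ => hAB.
set X := nodesum _ _ (l K); set Y := nodesum _ _ (r K).
suff : c K * (F K / m K) ^+ 2 + 4 * C ^+ 2 * (F K ^+ 2 / (C * m K + (c K + S))) <=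
    4 * C ^+ 2 * (F K ^+ 2 / (C * m K + S)).
  have := ler_wpM2l (_ : 0 <= 4 * C ^+ 2) hAB.
  move=> /(_ (mulr_ge0 (ler0n _ _) (sqr_ge0 _))); rewrite mulrDr.
  move: (4 * C ^+ 2 * A) (4 * C ^+ 2 * B) (4 * C ^+ 2 * (F K ^+ 2 / (C * m K + S))).
  move: (4 * C ^+ 2 * (F K ^+ 2 / _)) (c K * _) => *; lra.
have mK0 := m0 K; have cK0 := c0 K.
move: (m K) (c K) (F K) mK0 cK0 H => a e f a0 e0 H.
have a1 : a != 0 by rewrite gt_eqF.
have p0 : 0 < C * a + S by rewrite ltr_pwDl// mulr_gt0.
have q0 : 0 < C * a + (e + S) by rewrite ltr_pwDl ?mulr_gt0// addr_ge0.
have p1 : C * a + S != 0 by rewrite gt_eqF.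
have q1 : C * a + (e + S) != 0 by rewrite gt_eqF.
rewrite -subr_ge0 (_ : _ - _ = f ^+ 2 * e / (a ^+ 2 * (C * a + S) * (C * a + (e + S))) *
   (4 * C ^+ 2 * a ^+ 2 - (C * a + S) * (C * a + (e + S)))); last first.
  by field; rewrite a1 p1 q1.
apply: mulr_ge0.
  by rewrite !(sqr_ge0, invr_ge0, ltW p0, ltW q0, e0, mulr_ge0).
(* Both factors are at most [2 C m], because [c K + S <= C m]. *)
rewrite subr_ge0 (_ : 4 * _ * _ = (2 * C * a) * (2 * C * a)); last by ring.
by apply: ler_pM; nra.
Qed.

End binary_trees.

Section bilinear_form.
Context {R : realFieldType} {T : Type} (l r : T -> T).
Variables (m n beta kappa : T -> R).
Implicit Types (F G : T -> R) (K : T) (d : nat).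

(** [beta K] is the value of a bilinear form at the pair of indicators of [K],
    and [kappa K * m _ * n _] its value at the indicators of the two halves of
    [K]; [form d F G K] is then its value at the step functions, of depth [d]
    below [K], with integrals [F] and [G] against the masses [m] and [n]. *)
Fixpoint form d F G K : R :=
  if d is d'.+1 then form d' F G (l K) + form d' F G (r K) +
    kappa K * (F (l K) * G (r K) + F (r K) * G (l K))
  else F K / m K * (G K / n K) * beta K.

(** The [n]-jump at [K] of the image of the indicator of [K]: the value of the form
    at the indicators of [K] and of [l K] is [beta (l K) + kappa K * m (r K) * n (l K)]. *)
Definition form_coef m n K :=
  beta (l K) / n (l K) - beta (r K) / n (r K) + kappa K * (m (r K) - m (l K)).

(** The increment of the form when the step functions are refined from [K] to its
    two halves. *)
Definition form_step F G K :=
  F (l K) / m (l K) * (G (l K) / n (l K)) * beta (l K) +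
  F (r K) / m (r K) * (G (r K) / n (r K)) * beta (r K) +
  kappa K * (F (l K) * G (r K) + F (r K) * G (l K)) -
  F K / m K * (G K / n K) * beta K.

Lemma form_telescope d F G K : form d F G K =
  F K / m K * (G K / n K) * beta K + nodesum l r d (form_step F G) K.
Proof.
elim: d K => [|d IH] K /=; first by rewrite addr0.
by rewrite !IH /form_step; ring.
Qed.

Hypotheses (m0 : forall K, 0 < m K) (n0 : forall K, 0 < n K).
Hypotheses (am : tree_additive l r m) (an : tree_additive l r n).
Hypothesis betaD : forall K, beta K = beta (l K) + beta (r K) +
  kappa K * (m (l K) * n (r K) + m (r K) * n (l K)).

Lemma young2 (x P Q C : R) : 0 <= P -> 0 <= Q -> 0 <= C ->
  x ^+ 2 <= C ^+ 2 * (P * Q) -> `|x| <= C / 2 * (P + Q).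
Proof.
move=> P0 Q0 C0 h; have h0 : 0 <= C / 2 * (P + Q).
  by rewrite !mulr_ge0 ?addr_ge0// invr_ge0.
rewrite -(@ler_pXn2r _ 2)// ?nnegrE// real_normK ?num_real//.
apply: le_trans h _; have := sqr_ge0 (C * (P - Q)); nra.
Qed.

Variable C : R.
Hypothesis C0 : 0 < C.
Hypothesis beta_le : forall K, beta K ^+ 2 <= C ^+ 2 * (m K * n K).
Hypothesis kappa_le : forall K,
  kappa K ^+ 2 * (m (l K) * n (r K)) <= C ^+ 2.

(** The first two terms are paraproducts, with the averages of [F] and of [G] against
    the images of indicators; the rest is diagonal in the jumps. *)
Lemma form_stepE F G K : tree_additive l r F -> tree_additive l r G ->
  let p := jump l r m F K in let q := jump l r n G K in
  let wm := jump_mass l r m K in let wn := jump_mass l r n K in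
  form_step F G K =
    F K / m K * form_coef m n K * q * wn +
    G K / n K * form_coef n m K * p * wm +
    (p * (m (r K) / m K) * (q * (n (r K) / n K)) * beta (l K) +
     p * (m (l K) / m K) * (q * (n (l K) / n K)) * beta (r K) -
     2 * kappa K * (p * wm) * (q * wn)).
Proof.
move=> aF aG /=; rewrite /form_step /jump /jump_mass /form_coef.
rewrite (betaD K) (am K) (an K) (aF K) (aG K).
have := m0 (l K); have := m0 (r K); have := n0 (l K); have := n0 (r K).
move: (m (l K)) (m (r K)) (F (l K)) (F (r K)) (n (l K)) (n (r K)) (G (l K)) (G (r K)).
move=> a b x y a' b' x' y' b0' a0' b0 a0.
have a1 : a != 0 by rewrite gt_eqF.
have b1 : b != 0 by rewrite gt_eqF.
have ab1 : a + b != 0 by rewrite gt_eqF// addr_gt0.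
have a1' : a' != 0 by rewrite gt_eqF.
have b1' : b' != 0 by rewrite gt_eqF.
have ab1' : a' + b' != 0 by rewrite gt_eqF// addr_gt0.
by field; rewrite a1 b1 ab1 a1' b1' ab1'.
Qed.

Let frac_le K (h : T -> R) : (forall K, 0 < h K) -> tree_additive l r h ->
  0 <= h (l K) / h K <= 1 /\ 0 <= h (r K) / h K <= 1.
Proof.
move=> h0 ah; have hK := h0 K; have hl := h0 (l K); have hr := h0 (r K).
split; apply/andP; split; rewrite ?divr_ge0 ?ltW//.
  by rewrite ltr_pdivrMr// mul1r (ah K) ltrDl.
by rewrite ltr_pdivrMr// mul1r (ah K) ltrDr.
Qed.

Lemma form_step_le F G K : tree_additive l r F -> tree_additive l r G ->
  `|form_step F G K| <=
    2^-1 * (form_coef m n K ^+ 2 * jump_mass l r n K * (F K / m K) ^+ 2) +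
    2^-1 * (form_coef n m K ^+ 2 * jump_mass l r m K * (G K / n K) ^+ 2) +
    (2^-1 + 2 * C) * (jump l r m F K ^+ 2 * jump_mass l r m K) +
    (2^-1 + 2 * C) * (jump l r n G K ^+ 2 * jump_mass l r n K).
Proof.
move=> aF aG; rewrite form_stepE//=.
have wm0 := jump_mass_ge0 l r K m0; have wn0 := jump_mass_ge0 l r K n0.
set p := jump l r m F K; set q := jump l r n G K.
set cm := form_coef m n K; set cn := form_coef n m K.
set f := F K / m K; set g := G K / n K.
have P0 : 0 <= p ^+ 2 * jump_mass l r m K by rewrite mulr_ge0 ?sqr_ge0.
have Q0 : 0 <= q ^+ 2 * jump_mass l r n K by rewrite mulr_ge0 ?sqr_ge0.
have H1 : `|f * cm * q * jump_mass l r n K| <=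
    1 / 2 * (cm ^+ 2 * jump_mass l r n K * f ^+ 2 + q ^+ 2 * jump_mass l r n K).
  apply: young2 => //; first by rewrite !(sqr_ge0, wn0, wm0, mulr_ge0).
  by rewrite le_eqVlt; apply/orP; left; apply/eqP; ring.
have H2 : `|g * cn * p * jump_mass l r m K| <=
    1 / 2 * (cn ^+ 2 * jump_mass l r m K * g ^+ 2 + p ^+ 2 * jump_mass l r m K).
  apply: young2 => //; first by rewrite !(sqr_ge0, wn0, wm0, mulr_ge0).
  by rewrite le_eqVlt; apply/orP; left; apply/eqP; ring.
have [hml hmr] := frac_le K m0 am.
have [hnl hnr] := frac_le K n0 an.
have mn_le1 (a b : R) : 0 <= a <= 1 -> 0 <= b <= 1 -> 0 <= a * b <= 1.
  by move=> /andP[a0 a1] /andP[b0 b1]; rewrite mulr_ge0//= mulr_ile1.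
have PQ0 : 0 <= C ^+ 2 * (p ^+ 2 * jump_mass l r m K * (q ^+ 2 * jump_mass l r n K)).
  by rewrite !(sqr_ge0, wn0, wm0, mulr_ge0).
have nz (h : T -> R) : (forall K, 0 < h K) -> h K != 0 by move=> h0; rewrite gt_eqF.
have mK := nz _ m0; have nK := nz _ n0.
have H3 : `|p * (m (r K) / m K) * (q * (n (r K) / n K)) * beta (l K)| <=
    C / 2 * (p ^+ 2 * jump_mass l r m K + q ^+ 2 * jump_mass l r n K).
  apply: young2 => //; first exact: ltW.
  rewrite exprMn; apply: le_trans (ler_wpM2l (sqr_ge0 _) (beta_le _)) _.
  rewrite [leLHS](_ : _ = (m (r K) / m K * (n (r K) / n K)) *
    (C ^+ 2 * (p ^+ 2 * jump_mass l r m K * (q ^+ 2 * jump_mass l r n K)))).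
    by rewrite ler_piMl//; case/andP: (mn_le1 _ _ hmr hnr).
  by rewrite /jump_mass; field; rewrite mK nK.
have H4 : `|p * (m (l K) / m K) * (q * (n (l K) / n K)) * beta (r K)| <=
    C / 2 * (p ^+ 2 * jump_mass l r m K + q ^+ 2 * jump_mass l r n K).
  apply: young2 => //; first exact: ltW.
  rewrite exprMn; apply: le_trans (ler_wpM2l (sqr_ge0 _) (beta_le _)) _.
  rewrite [leLHS](_ : _ = (m (l K) / m K * (n (l K) / n K)) *
    (C ^+ 2 * (p ^+ 2 * jump_mass l r m K * (q ^+ 2 * jump_mass l r n K)))).
    by rewrite ler_piMl//; case/andP: (mn_le1 _ _ hml hnl).
  by rewrite /jump_mass; field; rewrite mK nK.
have H5 : `|2 * kappa K * (p * jump_mass l r m K) * (q * jump_mass l r n K)| <=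
    (2 * C) / 2 * (p ^+ 2 * jump_mass l r m K + q ^+ 2 * jump_mass l r n K).
  apply: young2 => //; first by rewrite mulr_ge0 ?ltW.
  rewrite (_ : _ ^+ 2 = 4 * ((m (r K) / m K * (n (l K) / n K)) *
    (p ^+ 2 * jump_mass l r m K * (q ^+ 2 * jump_mass l r n K)) *
    (kappa K ^+ 2 * (m (l K) * n (r K))))); last first.
    by rewrite /jump_mass; field; rewrite mK nK.
  rewrite [leRHS](_ : _ = 4 * (p ^+ 2 * jump_mass l r m K *
    (q ^+ 2 * jump_mass l r n K) * C ^+ 2)); last by ring.
  rewrite ler_wpM2l//; case/andP: (mn_le1 _ _ hmr hnl) => h0 h1.
  apply: ler_pM => //.
  - by rewrite mulr_ge0 ?(mulr_ge0 P0).
  - apply: mulr_ge0; first exact: sqr_ge0.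
    by rewrite mulr_ge0// ltW.
  - by rewrite ler_piMl ?(mulr_ge0 P0).
move: H1 H2 H3 H4 H5.
set X1 := f * cm * _ * _; set X2 := g * cn * _ * _; set X3 := _ * beta (l K).
set X4 := _ * beta (r K); set X5 := 2 * kappa K * _ * _.
move=> H1 H2 H3 H4 H5.
have := ler_normB (X3 + X4) X5; have := ler_normD X3 X4.
have := ler_normD (X1 + X2) (X3 + X4 - X5); have := ler_normD X1 X2.
move: P0 Q0 H1 H2 H3 H4 H5.
set P := p ^+ 2 * _; set Q := q ^+ 2 * _.
set Y1 := cm ^+ 2 * _ * _; set Y2 := cn ^+ 2 * _ * _ => P0 Q0.
have E : C / 2 * (P + Q) = 2^-1 * (C * P) + 2^-1 * (C * Q) by field.
have E' : 2 * C / 2 * (P + Q) = C * P + C * Q by field.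
have EP : (2^-1 + 2 * C) * P = 2^-1 * P + 2 * (C * P) by ring.
have EQ : (2^-1 + 2 * C) * Q = 2^-1 * Q + 2 * (C * Q) by ring.
rewrite E E' EP EQ.
have := mulr_ge0 (ltW C0) P0; have := mulr_ge0 (ltW C0) Q0.
move: (C * P) (C * Q) => CP CQ; lra.
Qed.

Hypothesis carleson_mn : forall d K,
  nodesum l r d (fun J => form_coef m n J ^+ 2 * jump_mass l r n J) K <= C * m K.
Hypothesis carleson_nm : forall d K,
  nodesum l r d (fun J => form_coef n m J ^+ 2 * jump_mass l r m J) K <= C * n K.

(** The increments of the telescoping sum split, along the martingale
    differences of the two functions, into two paraproducts, bounded by
    Carleson embedding, and a diagonal part, bounded term by term. *)
Lemma form_bound d F G K : tree_additive l r F -> tree_additive l r G ->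
  `|form d F G K| <= (1 + 5 * C) *
    (leafsum l r d (fun J => F J ^+ 2 / m J) K +
     leafsum l r d (fun J => G J ^+ 2 / n J) K).
Proof.
move=> aF aG; rewrite form_telescope.
have [F1 F2] := ler_parseval d K m0 am aF.
have [G1 G2] := ler_parseval d K n0 an aG.
have cF := @carleson_embedding _ _ l r m F _ C d K m0 am aF
  (fun J => mulr_ge0 (sqr_ge0 _) (jump_mass_ge0 l r J n0)) C0 carleson_mn.
have cG := @carleson_embedding _ _ l r n G _ C d K n0 an aG
  (fun J => mulr_ge0 (sqr_ge0 _) (jump_mass_ge0 l r J m0)) C0 carleson_nm.
have b0 : `|F K / m K * (G K / n K) * beta K| <=
    C / 2 * (F K ^+ 2 / m K + G K ^+ 2 / n K).
  have mK : m K != 0 by rewrite gt_eqF.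
  have nK : n K != 0 by rewrite gt_eqF.
  apply: young2; [by rewrite divr_ge0 ?sqr_ge0 ?ltW|
    by rewrite divr_ge0 ?sqr_ge0 ?ltW|exact: ltW|].
  rewrite exprMn; apply: le_trans (ler_wpM2l (sqr_ge0 _) (beta_le _)) _.
  by rewrite le_eqVlt; apply/orP; left; apply/eqP; field; rewrite mK nK.
have hs := le_trans (ler_norm_nodesum l r d (form_step F G) K)
  (ler_nodesum l r d K (fun J => form_step_le J aF aG)).
move: hs; set S := nodesum _ _ _ (form_step F G) K; rewrite !nodesumD !nodesumZ => hs.
apply: le_trans (ler_normD _ _) _.
move: F1 F2 G1 G2 cF cG b0 hs.
set E1 := leafsum _ _ _ _ _; set E2 := leafsum _ _ _ (fun J => _ / n _) _.
set N1 := nodesum _ _ _ _ _; set N2 := nodesum _ _ _ (fun J => jump l r n G J ^+ 2 * _) _.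
set N3 := nodesum _ _ _ (fun J => _ * (F J / m J) ^+ 2) _.
set N4 := nodesum _ _ _ (fun J => _ * (G J / n J) ^+ 2) _.
move: C0 => C0' F1 F2 G1 G2 cF cG b0 hs.
have E10 : 0 <= E1 by apply: le_trans F2; rewrite mulr_ge0 ?sqr_ge0 ?invr_ge0 ?ltW.
have E20 : 0 <= E2 by apply: le_trans G2; rewrite mulr_ge0 ?sqr_ge0 ?invr_ge0 ?ltW.
have h1 := ler_wpM2l (ltW C0') F2; have h2 := ler_wpM2l (ltW C0') G2.
have h3 := ler_wpM2l (ltW C0') F1; have h4 := ler_wpM2l (ltW C0') G1.
have h5 := mulr_ge0 (ltW C0') E10; have h6 := mulr_ge0 (ltW C0') E20.
rewrite -!(mulrA 4) in cF cG.
have E : C / 2 * (F K ^+ 2 / m K + G K ^+ 2 / n K) =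
  2^-1 * (C * (F K ^+ 2 / m K)) + 2^-1 * (C * (G K ^+ 2 / n K)) by field; rewrite !gt_eqF.
have EP (x : R) : (2^-1 + 2 * C) * x = 2^-1 * x + 2 * (C * x) by ring.
have E5 : (1 + 5 * C) * (E1 + E2) = E1 + E2 + 5 * (C * E1) + 5 * (C * E2) by ring.
rewrite E in b0; rewrite !EP in hs; rewrite E5.
move: (C * E1) (C * E2) (C * N1) (C * N2) (C * (F K ^+ 2 / _)) (C * (G K ^+ 2 / _))
  b0 hs h1 h2 h3 h4 h5 h6 cF cG => *.
lra.
Qed.

End bilinear_form.

(** * Integration *)

Section integration_toolkit.
Context {R : realType}.
Local Notation leb := (@lebesgue_measure R).
Implicit Types (D : set R) (P Q : R -> Prop) (f g h p q rho : R -> R).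

Lemma aeW P Q : {ae leb, forall x, P x} -> (forall x, P x -> Q x) ->
  {ae leb, forall x, Q x}.
Proof.
by move=> [N [mN N0 sub]] PQ; exists N; split => // x /= h; apply: sub => /= /PQ.
Qed.

Lemma aeI P Q : {ae leb, forall x, P x} -> {ae leb, forall x, Q x} ->
  {ae leb, forall x, P x /\ Q x}.
Proof.
have H : Filter (almost_everywhere leb) by exact: ae_filter_ringOfSetsType.
by move=> hP hQ; exact: (@filterI _ _ H _ _ hP hQ).
Qed.

Lemma ae_all P : (forall x, P x) -> {ae leb, forall x, P x}.
Proof. by move=> hP; exists set0; split => // x /= []. Qed.

Lemma ae_forall_nat (P : nat -> R -> Prop) : (forall n, {ae leb, forall x, P n x}) ->
  {ae leb, forall x, forall n, P n x}.
Proof. exact: ae_foralln. Qed.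

Lemma ae_eq_int D (f g : R -> \bar R) : measurable D -> measurable_fun D f ->
  measurable_fun D g -> {ae leb, forall x, D x -> f x = g x} ->
  (\int[leb]_(x in D) f x = \int[leb]_(x in D) g x)%E.
Proof.
move=> mD mf mg [N [mN N0 sub]]; apply: ae_eq_integral => //.
by exists N; split => // x /= h; apply: sub => /= h'; apply: h => /h'.
Qed.

Lemma ae_eq_integrable D (f g : R -> \bar R) : measurable D -> measurable_fun D g ->
  {ae leb, forall x, D x -> f x = g x} ->
  leb.-integrable D f -> leb.-integrable D g.
Proof.
move=> mD mg fg /integrableP[mf h]; apply/integrableP; split => //.
rewrite -(@ae_eq_int D (fun x => `|f x|%E)) //.
- exact: measurableT_comp.
- exact: measurableT_comp.
- by apply: aeW fg _ => x h' /h' ->.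
Qed.

Lemma measurable_sqr_mul D f rho : measurable_fun D f -> measurable_fun D rho ->
  measurable_fun D (fun x => (f x ^+ 2 * rho x)%:E).
Proof.
by move=> mf mr; apply/measurable_EFinP/measurable_funM => //; exact: measurable_funX.
Qed.

Lemma integrable_ge0 D f (c : R) : measurable_fun D f -> (forall x, D x -> 0 <= f x) ->
  (\int[leb]_(x in D) (f x)%:E <= c%:E)%E -> leb.-integrable D (EFin \o f).
Proof.
move=> mf f0 h; apply/integrableP; split; first exact/measurable_EFinP.
apply: le_lt_trans (ltry c); apply: le_trans h; rewrite le_eqVlt; apply/orP; left.
by apply/eqP/eq_integral => x; rewrite inE => Dx /=; rewrite ger0_norm ?f0.
Qed.

Lemma integral_EFinE D f : measurable D -> leb.-integrable D (EFin \o f) ->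
  (\int[leb]_(x in D) (f x)%:E)%E = (\int[leb]_(x in D) f x)%:E.
Proof. by move=> mD h; rewrite /Rintegral fineK//; exact: integrable_fin_num. Qed.

Lemma integrableRZ D f (c : R) : measurable D -> leb.-integrable D (EFin \o f) ->
  leb.-integrable D (EFin \o (fun x => c * f x)).
Proof. by move=> mD h; have := @integrableZl _ _ _ leb D mD c _ h; apply: eq_integrable. Qed.

Lemma integrableRD D f g : measurable D -> leb.-integrable D (EFin \o f) ->
  leb.-integrable D (EFin \o g) -> leb.-integrable D (EFin \o (fun x => f x + g x)).
Proof. by move=> mD hf hg; have := @integrableD _ _ _ leb D mD _ _ hf hg; apply: eq_integrable. Qed.

Lemma integrableRB D f g : measurable D -> leb.-integrable D (EFin \o f) ->
  leb.-integrable D (EFin \o g) -> leb.-integrable D (EFin \o (fun x => f x - g x)).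
Proof. by move=> mD hf hg; have := @integrableB _ _ _ leb D mD _ _ hf hg; apply: eq_integrable. Qed.

(** Integrating Young's inequality [2 |f| <= s p + q / s] and optimising in [s] avoids
    the square roots of [p] and [q]. *)
Lemma cauchy_schwarz D f p q : measurable D -> measurable_fun D f ->
  leb.-integrable D (EFin \o p) -> leb.-integrable D (EFin \o q) ->
  (forall x, D x -> [/\ 0 <= p x, 0 <= q x & f x ^+ 2 <= p x * q x]) ->
  leb.-integrable D (EFin \o f) /\
  (\int[leb]_(x in D) f x) ^+ 2 <=
    (\int[leb]_(x in D) p x) * (\int[leb]_(x in D) q x).
Proof.
move=> mD mf ip iq H.
have young s x : 0 < s -> D x -> `|f x| <= 2^-1 * (s * p x + s^-1 * q x).
  move=> s0 /H[p0 q0 h]; have s0' : 0 < s^-1 by rewrite invr_gt0.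
  have h0 : 0 <= 2^-1 * (s * p x + s^-1 * q x).
    by apply: mulr_ge0 => //; apply: addr_ge0; apply: mulr_ge0 => //; exact: ltW.
  rewrite -(@ler_pXn2r _ 2)// ?nnegrE// real_normK ?num_real//.
  apply: le_trans h _; have := sqr_ge0 (s * p x - s^-1 * q x).
  have : s * s^-1 = 1 by rewrite mulfV// gt_eqF.
  move: (s^-1) => z sz; have -> : p x * q x = (s * p x) * (z * q x).
    by rewrite mulrACA sz mul1r.
  by nra.
have ifn s : 0 < s ->
    leb.-integrable D (EFin \o (fun x => 2^-1 * (s * p x + s^-1 * q x))).
  by move=> s0; apply/integrableRZ/integrableRD => //; exact: integrableRZ.
have iff : leb.-integrable D (EFin \o f).
  apply: le_integrable (ifn 1 ltr01) => //; first exact/measurable_EFinP.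
  move=> x Dx /=; rewrite lee_fin; apply: le_trans (young 1 _ ltr01 Dx) _.
  exact: ler_norm.
split=> //; set P := \int[leb]_(x in D) p x; set Q := \int[leb]_(x in D) q x.
set F := \int[leb]_(x in D) f x.
have P0 : 0 <= P by apply: Rintegral_ge0 => x /H[].
have Q0 : 0 <= Q by apply: Rintegral_ge0 => x /H[].
have key s : 0 < s -> `|F| <= 2^-1 * (s * P + s^-1 * Q).
  move=> s0; apply: (le_trans (@le_normr_Rintegral _ _ _ leb D f mD iff)).
  have := @le_Rintegral _ _ _ leb D (Num.norm \o f) _ mD (@integrable_norm _ _ _ leb D f iff) (ifn s s0)
    (fun x => young s x s0); move/le_trans; apply.
  rewrite RintegralZl// ?RintegralD// ?RintegralZl//.
  - exact: integrableRZ.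
  - exact: integrableRZ.
  - by apply: integrableRD => //; exact: integrableRZ.
rewrite -real_normK ?num_real//; have F0 := normr_ge0 F.
move: (`|F|) F0 key => {iff F} F F0 key.
have [P1|P1] := eqVneq P 0.
  have [->|F1] := eqVneq F 0; first by rewrite P1 expr0n/= mul0r.
  have F2 : 0 < F by rewrite lt_neqAle eq_sym F1.
  have Q2 : 0 < (Q + 1) / F by rewrite divr_gt0// ltr_wpDl.
  have := key _ Q2; rewrite P1 mulr0 add0r invf_div mulrAC => h.
  have : F * (Q / (Q + 1)) <= F * 1.
    by rewrite ler_wpM2l// ler_pdivrMr ?ltr_wpDl// mul1r lerDl.
  by move: h; rewrite -mulrA; nra.
have P2 : 0 < P by rewrite lt_neqAle eq_sym P1.
have [->|F1] := eqVneq F 0; first by rewrite expr0n/= mulr_ge0.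
have F2 : 0 < F by rewrite lt_neqAle eq_sym F1.
have := key _ (divr_gt0 F2 P2); rewrite divfK// invf_div => h.
have : F ^+ 2 <= 2^-1 * (F ^+ 2 + P * Q).
  rewrite expr2 (le_trans (ler_wpM2l F0 h))// le_eqVlt; apply/orP; left.
  by apply/eqP; field; exact: F1.
by lra.
Qed.

Lemma fatou_le D (f_ : nat -> R -> R) f (c : \bar R) : measurable D ->
  (forall n, measurable_fun D (f_ n)) -> measurable_fun D f ->
  (forall n x, D x -> 0 <= f_ n x) ->
  {ae leb, forall x, D x -> f_ n x @[n --> \oo] --> f x} ->
  (forall n, (\int[leb]_(x in D) (f_ n x)%:E <= c)%E) ->
  (\int[leb]_(x in D) (f x)%:E <= c)%E.
Proof.
move=> mD mf_ mf f0 fc hc.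
have mf_' n : measurable_fun D (EFin \o f_ n) by exact/measurable_EFinP.
have := @fatou _ _ _ leb D mD (fun n x => (f_ n x)%:E) mf_' (fun n x Dx => f0 n x Dx).
rewrite (@ae_eq_int D (fun x => limn_einf (fun n => (f_ n x)%:E)) (EFin \o f)) //.
- move/le_trans; apply; rewrite limn_einf_lim; apply: lime_le.
    by apply: ereal_nondecreasing_is_cvgn; exact: nondecreasing_einfs.
  apply: nearW => n; apply: le_trans (hc n).
  by apply: ereal_inf_lbound; exists n => /=.
- have mo n : measurable_fun D (fun x => - (f_ n x)%:E)%E.
    by apply: measurableT_comp => //; exact: mf_'.
  rewrite -[X in measurable_fun _ X]/(fun x => - limn_esup (fun n => - (f_ n x)%:E))%E.
  by apply: measurableT_comp => //; exact: measurable_fun_limn_esup.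
- exact/measurable_EFinP.
- apply: aeW fc _ => x h Dx.
  have hE : (f_ n x)%:E @[n --> \oo] --> (f x)%:E.
    by apply/fine_cvgP; split; [exact: nearW|exact: h].
  by have [-> _] := @cvg_limn_einf_sup _ (fun n => (f_ n x)%:E) _ hE.
Qed.

Lemma exhaust_le D (E_ : nat -> set R) f (c : \bar R) : measurable D ->
  measurable_fun D f -> (forall x, D x -> 0 <= f x) ->
  (forall n, measurable (E_ n)) ->
  {ae leb, forall x, D x -> exists N, forall n, (N <= n)%N -> E_ n x} ->
  (forall n, (\int[leb]_(x in D `&` E_ n) (f x)%:E <= c)%E) ->
  (\int[leb]_(x in D) (f x)%:E <= c)%E.
Proof.
move=> mD mf f0 mE hE hc.
apply: (@fatou_le D (fun n x => f x * \1_(E_ n) x)) => //.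
- by move=> n; apply: measurable_funM => //; exact: measurable_indic.
- by move=> n x Dx; rewrite mulr_ge0// f0.
- apply: aeW hE _ => x h Dx; have [N HN] := h Dx.
  apply: cvg_near_cst; exists N => // n /= Nn.
  by rewrite indicE mem_set ?mulr1//; exact: HN.
- move=> n; apply: le_trans (hc n); rewrite integral_mkcondr le_eqVlt; apply/orP; left.
  by apply/eqP/eq_integral => x _; rewrite patchE indicE; case: ifPn => h;
    rewrite ?mulr1 ?mulr0.
Qed.

Lemma dominated_L1 D (f_ : nat -> R -> R) f h : measurable D ->
  (forall n, measurable_fun D (f_ n)) -> measurable_fun D f ->
  leb.-integrable D (EFin \o h) ->
  (forall n x, D x -> `|f_ n x| <= h x) ->
  {ae leb, forall x, D x -> f_ n x @[n --> \oo] --> f x} ->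
  \int[leb]_(x in D) `|f_ n x - f x| @[n --> \oo] --> 0.
Proof.
move=> mD mf_ mf ih fh fc.
have mf_' n : measurable_fun D (EFin \o f_ n) by exact/measurable_EFinP.
have mf' : measurable_fun D (EFin \o f) by exact/measurable_EFinP.
have H1 : {ae leb, forall x, D x -> (f_ n x)%:E @[n --> \oo] --> (f x)%:E}.
  apply: aeW fc _ => x hx Dx.
  by apply/fine_cvgP; split; [exact: nearW|exact: hx].
have H2 : {ae leb, forall x n, D x -> (`|(f_ n x)%:E| <= (h x)%:E)%E}.
  by apply: ae_all => x n Dx /=; rewrite lee_fin; exact: fh.
have [_ + _] := @dominated_convergence _ _ _ leb D mD (fun n => EFin \o f_ n)
  (EFin \o f) (EFin \o h) mf_' mf' H1 ih H2.
by move/fine_cvgP => [_].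
Qed.

(** Completeness of [L^2(rho)], for a density that may vanish: a rapidly converging
    subsequence converges pointwise where [rho] is positive, and its upper limit is
    measurable on the whole line. *)
Lemma L2_complete (g_ : nat -> R -> R) rho :
  (forall n, measurable_fun setT (g_ n)) -> measurable_fun setT rho ->
  (forall x, 0 <= rho x) ->
  (forall e : R, 0 < e -> exists N, forall n m, (N <= n)%N -> (N <= m)%N ->
    (\int[leb]_x ((g_ n x - g_ m x) ^+ 2 * rho x)%:E <= e%:E)%E) ->
  exists2 G : R -> R, measurable_fun setT G &
  (forall e : R, 0 < e -> exists N, forall n, (N <= n)%N ->
    (\int[leb]_x ((g_ n x - G x) ^+ 2 * rho x)%:E <= e%:E)%E).
Proof.
move=> mg mr r0 cau.
(* The squared differences along the subsequence are summable even with the weights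
   [2 ^+ i], so that by Young's inequality the differences are summable. *)
have e0 i : 0 < (2 ^+ i * (2 ^ i.+1)%:R)^-1 :> R.
  by rewrite invr_gt0 mulr_gt0 ?exprn_gt0// ltr0n expn_gt0.
pose N_ i := sval (cid (cau _ (e0 i))).
have HN i := svalP (cid (cau _ (e0 i))).
pose n_ := fix n_ i := if i is i'.+1 then maxn (n_ i').+1 (N_ i) else N_ 0%N.
have n_inc i : (n_ i < n_ i.+1)%N by rewrite /= leq_max ltnSn.
have n_ge i : (N_ i <= n_ i)%N by case: i => //= i; rewrite leq_max leqnn orbT.
have n_id i : (i <= n_ i)%N.
  by elim: i => // i IH; apply: leq_ltn_trans IH (n_inc i).
pose d_ i x := g_ (n_ i.+1) x - g_ (n_ i) x.
have md i : measurable_fun setT (d_ i) by exact: measurable_funB.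
have mW i : measurable_fun setT (fun x => (d_ i x ^+ 2 * (2 ^+ i * rho x))%:E).
  by apply: measurable_sqr_mul => //; exact: measurable_funM.
have dle i : (\int[leb]_x (d_ i x ^+ 2 * (2 ^+ i * rho x))%:E <= (1 / (2 ^ i.+1)%:R)%:E)%E.
  under eq_integral do rewrite mulrCA EFinM.
  rewrite ge0_integralZl_EFin//; last 2 first.
  - by move=> x _; rewrite lee_fin mulr_ge0 ?sqr_ge0.
  - exact: measurable_sqr_mul.
  have := HN i (n_ i.+1) (n_ i) (leq_trans (n_ge i) (ltnW (n_inc i))) (n_ge i).
  move=> h; apply: le_trans (lee_wpmul2l _ h) _; first by rewrite lee_fin exprn_ge0.
  by rewrite -EFinM lee_fin invfM mulrA mulfV ?expf_neq0.
have fin : {ae leb, forall x, (\sum_(i <oo) (d_ i x ^+ 2 * (2 ^+ i * rho x))%:E < +oo)%E}.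
  have W0 i x : (0 <= (d_ i x ^+ 2 * (2 ^+ i * rho x))%:E)%E.
    by rewrite lee_fin mulr_ge0 ?sqr_ge0// mulr_ge0// exprn_ge0.
  have : leb.-integrable setT (fun x => \sum_(i <oo) (d_ i x ^+ 2 * (2 ^+ i * rho x))%:E)%E.
    apply/integrableP; split.
      by apply: ge0_emeasurable_sum => [k x _ _|k _]; [exact: W0|exact: mW].
    under eq_integral do [rewrite gee0_abs; last by apply: nneseries_ge0].
    rewrite integral_nneseries//.
    apply: le_lt_trans (ltry (1 : R)); apply: le_trans (epsilon_trick0 xpredT ler01).
    by apply: lee_nneseries => // *; apply: integral_ge0 => *; exact: W0.
  move/(@integrable_ae _ _ _ leb _ measurableT) => H; apply: aeW H _ => x /(_ I).
  by rewrite ge0_fin_numE// nneseries_ge0.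
have conv : {ae leb, forall x, 0 < rho x -> cvgn (fun i => g_ (n_ i) x)}.
  apply: aeW fin _ => x h rx.
  have W0 i : (0 <= (d_ i x ^+ 2 * (2 ^+ i * rho x))%:E)%E.
    by rewrite lee_fin mulr_ge0 ?sqr_ge0// mulr_ge0// exprn_ge0.
  pose W := fine (\sum_(i <oo) (d_ i x ^+ 2 * (2 ^+ i * rho x))%:E)%E.
  have Wle n : \sum_(0 <= i < n) d_ i x ^+ 2 * (2 ^+ i * rho x) <= W.
    rewrite -lee_fin fineK; last by rewrite ge0_fin_numE// nneseries_ge0.
    by rewrite -sumEFin; apply: nneseries_lim_ge => i _ _.
  have : cvgn (series (fun i => d_ i x)).
    apply: normed_cvg; apply: nondecreasing_is_cvgn.
      by apply: nondecreasing_series => i _ _; exact: normr_ge0.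
    exists (1 + W / rho x) => _ [n _ <-].
    have young i : `|d_ i x| <= 2^-1 ^+ i.+1 + d_ i x ^+ 2 * (2 ^+ i * rho x) / rho x.
      rewrite mulrA mulfK ?gt_eqF// exprS.
      have : 2 ^+ i * 2^-1 ^+ i = 1 :> R by rewrite -exprMn mulfV ?expr1n ?pnatr_eq0.
      have : 0 <= 2^-1 ^+ i :> R by rewrite exprn_ge0.
      have : 0 <= 2 ^+ i :> R by rewrite exprn_ge0.
      rewrite -(real_normK (num_real (d_ i x))); have := normr_ge0 (d_ i x).
      move: (`|_|) (2 ^+ i) (2^-1 ^+ i) => y a b y0 a0 b0 ab.
      have := mulr_ge0 b0 (sqr_ge0 (a * y - 2^-1)).
      rewrite (_ : b * _ = (a * b) * (a * y ^+ 2) - (a * b) * y + b / 4); last by field.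
      by rewrite ab; lra.
    apply: le_trans (ler_sum _ (fun i _ => young i)) _.
    rewrite big_split/= lerD//; last first.
      by rewrite -mulr_suml ler_pM2r ?invr_gt0.
    have -> : \sum_(0 <= i < n) 2^-1 ^+ i.+1 = 1 - 2^-1 ^+ n :> R.
      elim: n => [|n IH]; first by rewrite big_geq// subrr.
      by rewrite big_nat_recr//= IH exprS; field.
    by rewrite gerBl exprn_ge0.
  rewrite (_ : series _ = fun n => g_ (n_ n) x - g_ (n_ 0%N) x); last first.
    by apply/funext => n; rewrite /series/= telescope_sumr.
  move=> /cvg_ex[l hl]; apply/cvg_ex; exists (l + g_ (n_ 0%N) x).
  have hc : (fun _ : nat => g_ (n_ 0%N) x) @ \oo --> g_ (n_ 0%N) x by exact: cvg_cst.
  have hs : (fun i => (g_ (n_ i) x - g_ (n_ 0%N) x) + g_ (n_ 0%N) x) @ \oo -->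
      l + g_ (n_ 0%N) x by exact: cvgD.
  by move: hs; under eq_cvg do rewrite subrK.
pose G x := fine (limn_esup (fun i => (g_ (n_ i) x)%:E)).
have mG : measurable_fun setT G.
  apply: measurableT_comp; first exact: fine_measurable.
  by apply: measurable_fun_limn_esup => i; apply/measurable_EFinP.
have GE x l : g_ (n_ i) x @[i --> \oo] --> l -> G x = l.
  move=> h; have hE : (g_ (n_ i) x)%:E @[i --> \oo] --> l%:E.
    by apply/fine_cvgP; split; [exact: nearW|exact: h].
  by rewrite /G (_ : limn_esup _ = l%:E)//; case: (cvg_limn_einf_sup hE).
exists G => // e e1; have [N hN] := cau e e1; exists N => n Nn.
apply: (@fatou_le setT (fun i x => (g_ n x - g_ (n_ (i + N)%N) x) ^+ 2 * rho x)) => //.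
- by move=> i; apply: measurable_funM => //; apply: measurable_funX; exact: measurable_funB.
- by apply: measurable_funM => //; apply: measurable_funX; exact: measurable_funB.
- by move=> i x _; rewrite mulr_ge0 ?sqr_ge0.
- apply: aeW conv _ => x h _; have [->|/eqP rx] := eqVneq (rho x) 0.
    by rewrite mulr0; under eq_cvg do rewrite mulr0; exact: cvg_cst.
  have /h/cvg_ex[l hl] : 0 < rho x by rewrite lt_neqAle r0 andbT eq_sym; apply/eqP.
  rewrite (GE _ _ hl); apply: cvgM; last exact: cvg_cst.
  apply: (@cvgM _ _ _ _ (fun i => g_ n x - g_ (n_ (i + N)%N) x)
    (fun i => g_ n x - g_ (n_ (i + N)%N) x)); apply: cvgB; try exact: cvg_cst.
    by move: hl; rewrite -(cvg_shiftn N).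
  by move: hl; rewrite -(cvg_shiftn N).
- move=> i; apply: hN => //; apply: leq_trans (n_id _); exact: leq_addl.
Qed.

End integration_toolkit.

(** * Dyadic intervals *)

Section dyadic_geometry.
Context {R : realType}.
Local Notation leb := (@lebesgue_measure R).
Implicit Types (x y : R) (K L : dyadic) (j k : int) (f g : R -> R).

Definition cell j x : dyadic := (j, Num.floor (2 ^ j * x)).
Definition parent K : dyadic := (K.1 - 1, (K.2 %/ 2)%Z).

Lemma len_gt0 K : 0 < len K :> R.
Proof. by rewrite /len exprz_gt0. Qed.

Lemma len_neq0 K : len K != 0 :> R.
Proof. by rewrite gt_eqF// len_gt0. Qed.

Lemma len_half K :
  len (left_half K) = len K / 2 :> R /\ len (right_half K) = len K / 2 :> R.
Proof. by rewrite /len /= opprD expfzDr ?pnatr_eq0// exprN1. Qed.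

Lemma ditvP K x : ditv K x <-> cell K.1 x = K.
Proof.
case: K => j k; rewrite /ditv /len /cell /= in_itv/= -invr_expz.
rewrite ler_pdivrMl ?exprz_gt0// ltr_pdivlMl ?exprz_gt0//.
split=> [h|[<-]]; last by rewrite floor_itv.
by congr pair; apply/floor_def.
Qed.

Lemma ditv_cell j x : ditv (cell j x) x.
Proof. exact/ditvP. Qed.

Lemma ditvE K x :
  ditv K x = (len K * K.2%:~R <= x < len K * (K.2 + 1)%:~R) :> Prop.
Proof. by rewrite /ditv /= in_itv. Qed.

Lemma ditv_halves K : ditv K = ditv (left_half K) `|` ditv (right_half K) :> set R.
Proof.
apply/seteqP; split=> x; rewrite /setU/= !ditvE !(len_half _).1 !(len_half _).2/=.
  move=> /andP[h1 h2]; have [h|h] := ltP x (len K / 2 * (2 * K.2 + 1)%:~R).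
    by left; rewrite andbT; move: h1; rewrite intrM; lra.
  by right; rewrite /=; move: h2; rewrite !intrD intrM; lra.
have := len_gt0 K; rewrite !intrD intrM => l0.
by case=> /andP[h1 h2]; apply/andP; split; nra.
Qed.

Lemma ditv_halves_disj K x :
  ditv (left_half K) x -> ditv (right_half K) x -> False.
Proof.
move=> /ditvP h1 /ditvP h2; move: h1; rewrite -[(left_half K).1]/(right_half K).1 h2.
by case=> /eqP; lia.
Qed.

Lemma parentP K : K = left_half (parent K) \/ K = right_half (parent K).
Proof.
case: K => j k; rewrite /left_half /right_half /parent/= subrK.
have : k = 2 * (k %/ 2)%Z \/ k = 2 * (k %/ 2)%Z + 1 by lia.
by case=> <-; [left|right].
Qed.

Lemma ditv_left K x : ditv (left_half K) x -> ditv K x.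
Proof. by rewrite (ditv_halves K); left. Qed.

Lemma ditv_right K x : ditv (right_half K) x -> ditv K x.
Proof. by rewrite (ditv_halves K); right. Qed.

Lemma ditv_parent K x : ditv K x -> ditv (parent K) x.
Proof.
by have [{1}->|{1}->] := parentP K; [exact: ditv_left|exact: ditv_right].
Qed.

Lemma cell_parent j x : parent (cell j x) = cell (j - 1) x.
Proof. by have /ditv_parent/ditvP <- := ditv_cell j x. Qed.

Lemma cellE K x : ditv K x -> K = cell K.1 x.
Proof. by move/ditvP. Qed.

Lemma cell_eq j (n : nat) x y : cell j x = cell j y ->
  cell (j - n%:Z) x = cell (j - n%:Z) y.
Proof.
elim: n => [|n IH] h; first by rewrite subr0.
rewrite -[n.+1]addn1 PoszD opprD addrA -!cell_parent; congr parent; exact: IH.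
Qed.

Lemma ditv_nested K L x : K.1 <= L.1 -> ditv K x -> ditv L x ->
  ditv L `<=` (ditv K : set R).
Proof.
move=> KL /ditvP Kx /ditvP Lx y /ditvP Ly; apply/ditvP; rewrite -[RHS]Kx.
have -> : K.1 = L.1 - `|L.1 - K.1|%N%:Z by lia.
by apply: cell_eq; rewrite Lx.
Qed.

Lemma measurable_ditv K : measurable (ditv K : set R).
Proof. exact: measurable_itv. Qed.

Lemma lebesgue_ditv K : leb (ditv K) = (len K)%:E.
Proof.
rewrite /ditv lebesgue_measure_itv/= lte_fin -EFinB.
have l0 := len_gt0 K; rewrite ltr_pM2l// ltr_int ltrDl ltr01 -mulrBr.
by rewrite -intrB addrAC subrr add0r mulr1.
Qed.

Definition haar_sign K x : R := \1_(ditv (right_half K)) x - \1_(ditv (left_half K)) x.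

Lemma haar_sign_right K x : ditv (right_half K) x -> haar_sign K x = 1.
Proof.
move=> h; rewrite /haar_sign !indicE mem_set//= memNset ?subr0// => h'.
exact: (ditv_halves_disj h' h).
Qed.

Lemma haar_sign_left K x : ditv (left_half K) x -> haar_sign K x = -1.
Proof.
move=> h; rewrite /haar_sign !indicE (mem_set h)//= memNset ?sub0r// => h'.
exact: (ditv_halves_disj h h').
Qed.

Lemma haar_sign_out K x : ~ ditv K x -> haar_sign K x = 0.
Proof.
move=> h; rewrite /haar_sign !indicE !memNset ?subrr// => h'; apply: h;
  [exact: ditv_left|exact: ditv_right].
Qed.

Lemma measurable_haar_sign K : measurable_fun setT (haar_sign K).
Proof. by apply: measurable_funB; exact: measurable_indic (measurable_ditv _). Qed.

Lemma sqr_len_powR K : (len K `^ (- 2^-1)) ^+ 2 = (len K)^-1 :> R.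
Proof.
rewrite -powR_mulrn ?powR_ge0// -powRrM mulNr mulVf ?pnatr_eq0//.
by rewrite powR_inv1// ltW// len_gt0.
Qed.

(** Local integrability is only ever needed on dyadic intervals. *)
Definition dintegrable f := forall K, leb.-integrable (ditv K) (EFin \o f).

Lemma mass_split f K : dintegrable f ->
  mass f (ditv K) = mass f (ditv (left_half K)) + mass f (ditv (right_half K)).
Proof.
move=> lf; rewrite /mass ditv_halves Rintegral_setU//.
- exact: measurable_ditv.
- exact: measurable_ditv.
- by rewrite -ditv_halves; exact: lf.
- apply/disj_setPS => x [h1 h2]; exact: (ditv_halves_disj h1 h2).
Qed.

Lemma mass_eq f g K : (forall x, ditv K x -> f x = g x) ->
  mass f (ditv K) = mass g (ditv K).
Proof. by move=> fg; apply: eq_Rintegral => x; rewrite inE; exact: fg. Qed.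

Lemma mass_ae_eq f g D : measurable D -> measurable_fun D f -> measurable_fun D g ->
  {ae leb, forall x, f x = g x} -> mass f D = mass g D.
Proof.
move=> mD mf mg fg; congr fine; apply: ae_eq_int => //; try exact/measurable_EFinP.
by apply: aeW fg _ => x ->.
Qed.

Definition mass_jump f K := mass f (ditv (right_half K)) - mass f (ditv (left_half K)).

Lemma inner_haar f K : dintegrable f ->
  inner f (haar K) = len K `^ (- 2^-1) * mass_jump f K.
Proof.
move=> lf; rewrite /inner.
have -> : \int[leb]_x (f x * haar K x) = \int[leb]_(x in ditv K) (f x * haar K x).
  rewrite [RHS]Rintegral_mkcond; apply: eq_Rintegral => x _.
  rewrite patchE; case: ifPn => // /negP; rewrite inE => h.
  by rewrite /haar -/(haar_sign K x) haar_sign_out// !mulr0.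
set c := _ `^ _; have il := lf (left_half K); have ir := lf (right_half K).
have ml := measurable_ditv (left_half K); have mr := measurable_ditv (right_half K).
have hl x : ditv (left_half K) x -> f x * haar K x = (- c) * f x.
  by move=> h; rewrite /haar -/(haar_sign K x) -/c haar_sign_left//; ring.
have hr x : ditv (right_half K) x -> f x * haar K x = c * f x.
  by move=> h; rewrite /haar -/(haar_sign K x) -/c haar_sign_right//; ring.
have i : leb.-integrable (ditv K) (EFin \o (fun x => f x * haar K x)).
  have := integrableRZ c (measurable_ditv K) (lf K).
  apply: (@le_integrable _ _ _ leb _ (measurable_ditv K)).
    apply/measurable_EFinP/measurable_funM.
      by have := measurable_int leb (lf K); move/measurable_EFinP.
    apply: measurable_funM => //; apply: measurable_funTS; exact: measurable_haar_sign.
  move=> x; rewrite ditv_halves /= lee_fin => -[h|h].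
    by rewrite hl// mulNr normrN.
  by rewrite hr.
rewrite ditv_halves Rintegral_setU//; last 2 first.
- by rewrite -ditv_halves.
- apply/disj_setPS => x [h1 h2]; exact: (ditv_halves_disj h1 h2).
under eq_Rintegral do [rewrite hl; last by rewrite -inE].
under [X in _ + X]eq_Rintegral do [rewrite hr; last by rewrite -inE].
by rewrite !RintegralZl// /mass_jump /mass; ring.
Qed.

Lemma measurable_at_cell (A : dyadic -> R -> R) j : (forall K, measurable_fun setT (A K)) ->
  measurable_fun setT (fun x => A (cell j x) x).
Proof.
move=> mA _ B mB; rewrite setTI.
have -> : (fun x => A (cell j x) x) @^-1` B =
    \bigcup_(k : int) (ditv (j, k) `&` (A (j, k)) @^-1` B).
  apply/seteqP; split=> x /=.
    by move=> h; exists (Num.floor (2 ^ j * x)) => //; split => //; exact: ditv_cell.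
  by move=> [k _ [/ditvP <-]].
apply: countable_bigcupT_measurable => // k.
apply: measurableI; first exact: measurable_ditv.
by rewrite -[X in measurable X]setTI; exact: mA.
Qed.

End dyadic_geometry.

(** * Doubly infinite sums over the scales *)

Section formal_operators.
Context {R : realType}.
Implicit Types (A : @formal_op R) (x y p q : R) (K L : dyadic) (j : int) (f g : R -> R).

(** At a given point only the intervals that contain it contribute, one for each
    scale: the partial sums are finite, and indexed by the scales. *)
Definition local_op A f x := forall K, ~ ditv K x -> A f K x = 0.

Definition op_cvg A f x y := partial_sum A f x @ filter_prod \oo \oo --> y.

Lemma op_valE A f x y : op_cvg A f x y -> op_val A f x = y.
Proof. exact: cvg_lim. Qed.

Lemma op_cvgP A f x : cvg (partial_sum A f x @ filter_prod \oo \oo) <->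
  exists y, op_cvg A f x y.
Proof. by split=> [/cvg_ex|h]; [|apply/cvg_ex]. Qed.

Lemma partial_sumE A f x m n : local_op A f x ->
  partial_sum A f x (m, n) =
  \sum_(0 <= i < m + n + 1) A f (cell (i%:Z - m%:Z) x) x.
Proof.
move=> loc; rewrite /partial_sum /=.
pose r := [seq cell (i%:Z - m%:Z) x | i <- index_iota 0 (m + n + 1)].
rewrite (@fsbigE _ _ _ _ _ r); last first.
- move=> K /=/andP[h1 h2] /negP Kr; apply: loc => /ditvP Kx; apply: Kr.
  move: K.1 h1 h2 Kx => k h1 h2 Kx.
  apply/mapP; exists (absz (k + m%:Z)%R); first by rewrite mem_index_iota/=; lia.
  by rewrite -[LHS]Kx; congr cell; lia.
- by move=> K /= /mapP[i]; rewrite mem_index_iota => hi ->/=; apply/andP; split; lia.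
- rewrite map_inj_in_uniq ?iota_uniq// => i i' _ _ [].
  by lia.
rewrite big_map big_seq_cond [RHS]big_seq_cond; apply: eq_bigl => i.
case: (boolP (i \in _)) => //=; rewrite mem_index_iota => hi.
by apply/asboolP; apply/andP; split => /=; lia.
Qed.

Lemma sum_levels_split (tau : int -> R) (j0 : int) (m n : nat) :
  - m%:Z <= j0 -> j0 <= n%:Z + 1 ->
  \sum_(0 <= i < m + n + 1) tau (i%:Z - m%:Z) =
  series (fun i => tau (j0 - 1 - i%:Z)) (absz (j0 + m%:Z)%R) +
  series (fun i => tau (j0 + i%:Z)) (absz (n%:Z + 1 - j0)%R).
Proof.
move=> h1 h2; set a := (absz (j0 + m%:Z)%R); set b := (absz (n%:Z + 1 - j0)%R).
have -> : (m + n + 1)%N = (a + b)%N by rewrite /a /b; lia.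
rewrite (@big_cat_nat _ _ _ a) ?leq_addr//=; congr (_ + _).
  rewrite /series/= big_nat_rev/= big_nat_cond [RHS]big_nat_cond.
  apply: eq_bigr => i; rewrite andbT add0n => /andP[_ hi]; congr tau.
  by move: hi; rewrite /a; lia.
rewrite -[X in index_iota X]add0n big_addn addKn /series/=.
by apply: eq_bigr => i _; congr tau; rewrite /a; lia.
Qed.

Lemma cvg_absz_shift (g : nat -> int) (c : int) : (forall n, g n = n%:Z + c) ->
  (fun n => (absz (g n)%R)) @ \oo --> \oo.
Proof.
move=> hg P [M _ hP]; exists (M + absz c)%N => // n /= hn.
by apply: hP => /=; rewrite hg; lia.
Qed.

Section split_at.
Variables (A : @formal_op R) (f : R -> R) (x : R) (j0 : int).
Hypothesis loc : local_op A f x.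
Let tau j := A f (cell j x) x.
Let small := series (fun i => tau (j0 + i%:Z)).
Let large := series (fun i => tau (j0 - 1 - i%:Z)).

Lemma near_partial_sum :
  \forall mn \near filter_prod \oo \oo, partial_sum A f x mn =
    large (absz (j0 + mn.1%:Z)%R) + small (absz (mn.2%:Z + 1 - j0)%R).
Proof.
exists ([set m | (absz j0 <= m)%N], [set m | (absz j0 <= m)%N]) => /=.
  by split; exists (absz (j0)%R).
move=> [m n] /= [hm hn]; rewrite partial_sumE//; apply: (sum_levels_split tau); lia.
Qed.

Lemma op_cvg_split p q : large @ \oo --> p -> small @ \oo --> q ->
  op_cvg A f x (p + q).
Proof.
move=> hp hq; apply: (@cvg_trans _ ((fun mn => large (absz (j0 + mn.1%:Z)%R) +
    small (absz (mn.2%:Z + 1 - j0)%R)) @ filter_prod \oo \oo)).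
  by apply: near_eq_cvg; move: near_partial_sum; apply: filterS => mn ->.
apply: cvgD.
  apply: (cvg_comp (fun mn : nat * nat => (absz (j0 + mn.1%:Z)%R)) large) hp.
  apply: (cvg_comp fst (fun m : nat => (absz (j0 + m%:Z)%R))); first exact: cvg_fst.
  by apply: (@cvg_absz_shift _ j0) => n; rewrite addrC.
apply: (cvg_comp (fun mn : nat * nat => (absz (mn.2%:Z + 1 - j0)%R)) small) hq.
apply: (cvg_comp snd (fun m : nat => (absz (m%:Z + 1 - j0)%R))); first exact: cvg_snd.
by apply: (@cvg_absz_shift _ (1 - j0)) => n; rewrite addrA.
Qed.

(** Freezing one of the two bounds of a convergent doubly infinite sum leaves a Cauchy
    sequence in the other one. *)
Lemma op_cvg_inv : cvg (partial_sum A f x @ filter_prod \oo \oo) ->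
  cvgn large /\ cvgn small.
Proof.
move=> /cvg_ex[l hl].
have {hl} : (fun mn => large (absz (j0 + mn.1%:Z)%R) + small (absz (mn.2%:Z + 1 - j0)%R))
    @ filter_prod \oo \oo --> l.
  apply: cvg_trans hl; apply: near_eq_cvg.
  by move: near_partial_sum; apply: filterS => mn ->.
move=> /cvgrPdist_lt H; split; apply/cauchy_cvgP/cauchy_exP => e e0.
  have [[Q1 Q2]/= [[M1 _ h1] [M2 _ h2]] hQ] := H _ e0.
  set c := small (absz (M2%:Z + 1 - j0)%R).
  exists (l - c); exists (M1 + absz j0)%N => // k /= hk.
  have hk1 : (M1 <= absz (k%:Z - j0)%R)%N by lia.
  have := hQ ((absz (k%:Z - j0)%R), M2) (conj (h1 _ hk1) (h2 _ (leqnn _))) => /=.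
  have -> : (absz (j0 + (absz (k%:Z - j0)%R)%:Z)%R) = k by lia.
  by rewrite /ball/= -/c (addrC (large k)) opprD addrA.
have [[Q1 Q2]/= [[M1 _ h1] [M2 _ h2]] hQ] := H _ e0.
set c := large (absz (j0 + M1%:Z)%R).
exists (l - c); exists (M2 + absz j0 + 1)%N => // k /= hk.
have hk2 : (M2 <= absz (k%:Z - 1 + j0)%R)%N by lia.
have := hQ (M1, (absz (k%:Z - 1 + j0)%R)) (conj (h1 _ (leqnn _)) (h2 _ hk2)) => /=.
have -> : (absz ((absz (k%:Z - 1 + j0)%R)%:Z + 1 - j0)%R) = k by lia.
by rewrite /ball/= -/c opprD addrA.
Qed.

End split_at.
End formal_operators.

(** * Haar multipliers *)

Section measurability.
Context {R : realType}.
Implicit Types (u : nat -> R -> R).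

Lemma cvgn_cauchyP (u : nat -> R) : cvgn u <->
  forall k, exists N, forall n, `|u (N + n)%N - u N| <= k.+1%:R^-1.
Proof.
split=> [/cvg_ex[l /cvgrPdist_le hl] k|h].
  have k0 : 0 < (k.+1%:R^-1 / 2 : R) by rewrite divr_gt0// invr_gt0.
  have [N _ HN] := hl _ k0; exists N => n.
  have h1 := HN (N + n)%N (leq_addr n N); have h2 := HN N (leqnn N).
  rewrite -(subrKA l) (le_trans (ler_normD _ _))// distrC.
  by apply: le_trans (lerD h1 h2) _; rewrite -splitr.
apply/cauchy_cvgP/cauchy_exP => e e0.
have [k _ hk] := near_infty_natSinv_lt (PosNum e0).
have [N HN] := h k; exists (u N); exists N => // n /= Nn.
rewrite /ball/= distrC -(subnKC Nn); apply: le_lt_trans (HN _) _.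
exact: hk k (leqnn k).
Qed.

Lemma measurable_cvgn u : (forall n, measurable_fun setT (u n)) ->
  measurable [set x | cvgn (u ^~ x)].
Proof.
move=> mu.
have -> : [set x | cvgn (u ^~ x)] = \bigcap_k \bigcup_N \bigcap_n
    [set x | `|u (N + n)%N x - u N x| <= k.+1%:R^-1].
  apply/seteqP; split=> x /=.
    by move/cvgn_cauchyP => h k _; have [N HN] := h k; exists N => // n _; exact: HN.
  by move=> h; apply/cvgn_cauchyP => k; have [N _ HN] := h k I; exists N => n; exact: HN.
apply: bigcapT_measurable => k; apply: bigcupT_measurable => N.
apply: bigcapT_measurable => n; rewrite -[X in measurable X]setTI.
apply: (@measurable_fun_le _ _ _ setT (fun x => `|u (N + n)%N x - u N x|) (cst _)) => //.
by apply: measurableT_comp => //; exact: measurable_funB.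
Qed.

Lemma measurable_limn u (E : set R) : (forall n, measurable_fun setT (u n)) ->
  measurable E -> (forall x, E x -> cvgn (u ^~ x)) ->
  measurable_fun setT (fun x => if x \in E then limn (u ^~ x) else 0).
Proof.
move=> mu mE hE.
apply: (@measurable_fun_cvg _ _ _ setT (fun n x => u n x * \1_E x)).
  by move=> n; apply: measurable_funM => //; exact: measurable_indic.
move=> x _; rewrite indicE; case: ifPn => xE /=.
  by under eq_cvg do rewrite mulr1; apply: hE; rewrite inE in xE.
by under eq_cvg do rewrite mulr0; exact: cvg_cst.
Qed.

(** Where the series diverges [op_val] is a default value, so that the set of
    convergence has to be measurable too. Splitting at the scale [0] reduces both
    questions to ordinary series. *)
Lemma measurable_op_val (A : @formal_op R) f : (forall x, local_op A f x) ->
  (forall K, measurable_fun setT (A f K)) -> measurable_fun setT (op_val A f).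
Proof.
move=> loc mA.
have mcell j : measurable_fun setT (fun x => A f (cell j x) x).
  exact: measurable_at_cell.
pose small x := series (fun i => A f (cell (0 + i%:Z) x) x).
pose large x := series (fun i => A f (cell (0 - 1 - i%:Z) x) x).
have ms n : measurable_fun setT (small ^~ n).
  by apply: measurable_sum => i; exact: mcell.
have ml n : measurable_fun setT (large ^~ n).
  by apply: measurable_sum => i; exact: mcell.
pose E := [set x | cvgn (large x)] `&` [set x | cvgn (small x)].
have mE : measurable E.
  by apply: measurableI; [exact: (measurable_cvgn ml)|exact: (measurable_cvgn ms)].
have -> : op_val A f = fun x => (if x \in E then limn (large x) else 0) +
    (if x \in E then limn (small x) else 0).
  apply/funext => x; case: ifPn => [|/negP] xE.
    move: xE; rewrite inE => -[hl hs].
    by apply: op_valE; exact: (@op_cvg_split R A f x 0 (loc x) _ _ hl hs).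
  rewrite addr0; have := xE; rewrite inE => /not_andP h.
  rewrite /op_val (@dvgP _ (partial_sum A f x @ filter_prod \oo \oo))// => h'.
  by have [? ?] := op_cvg_inv 0 (loc x) h'; case: h.
by apply: measurable_funD; [apply: (measurable_limn ml mE)|
  apply: (measurable_limn ms mE)] => x [].
Qed.

End measurability.

Section haar_multiplier.
Context {R : realType}.
Local Notation leb := (@lebesgue_measure R).
Implicit Types (a : dyadic -> R) (x y p q : R) (K L : dyadic) (j : int) (f g : R -> R).

Definition haar_mult a : @formal_op R :=
  fun f K x => a K * inner f (haar K) * haar K x.

Lemma haar_multE a f K x : dintegrable f ->
  haar_mult a f K x = a K * (mass_jump f K / len K) * haar_sign K x.
Proof.
move=> hf; rewrite /haar_mult inner_haar// /haar -/(haar_sign K x).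
by rewrite -sqr_len_powR; ring.
Qed.

Lemma haar_mult_local a f x : local_op (haar_mult a) f x.
Proof.
move=> K Kx; suff h : haar K x = 0 by rewrite /haar_mult h mulr0.
by rewrite /haar -/(haar_sign K x) haar_sign_out// mulr0.
Qed.

Lemma measurable_haar K : measurable_fun setT (@haar R K).
Proof. by apply: measurable_funM => //; exact: measurable_haar_sign. Qed.

Lemma measurable_haar_mult a f : measurable_fun setT (op_val (haar_mult a) f).
Proof.
apply: measurable_op_val => [x|K]; first exact: haar_mult_local.
by apply: measurable_funM => //; exact: measurable_haar.
Qed.

Lemma dintegrableD f g : dintegrable f -> dintegrable g ->
  dintegrable (fun x => f x + g x).
Proof. by move=> hf hg K; apply: integrableRD => //; exact: measurable_ditv. Qed.

Lemma dintegrableZ c f : dintegrable f -> dintegrable (fun x => c * f x).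
Proof. by move=> hf K; apply: integrableRZ => //; exact: measurable_ditv. Qed.

Lemma massD f g K : dintegrable f -> dintegrable g ->
  mass (fun x => f x + g x) (ditv K) = mass f (ditv K) + mass g (ditv K).
Proof. by move=> hf hg; rewrite /mass RintegralD//; exact: measurable_ditv. Qed.

Lemma massZ c f K : dintegrable f ->
  mass (fun x => c * f x) (ditv K) = c * mass f (ditv K).
Proof. by move=> hf; rewrite /mass RintegralZl//; exact: measurable_ditv. Qed.

Lemma op_cvgD a f g x p q : dintegrable f -> dintegrable g ->
  op_cvg (haar_mult a) f x p -> op_cvg (haar_mult a) g x q ->
  op_cvg (haar_mult a) (fun x => f x + g x) x (p + q).
Proof.
move=> hf hg hp hq; rewrite /op_cvg.
have -> : partial_sum (haar_mult a) (fun x => f x + g x) x =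
    fun mn => partial_sum (haar_mult a) f x mn + partial_sum (haar_mult a) g x mn.
  apply/funext => -[m n]; rewrite !partial_sumE; try exact: haar_mult_local.
  rewrite -big_split/=; apply: eq_bigr => i _.
  rewrite !haar_multE//; last exact: dintegrableD.
  by rewrite /mass_jump !massD//; ring.
exact: cvgD.
Qed.

Lemma op_cvgZ a c f x p : dintegrable f -> op_cvg (haar_mult a) f x p ->
  op_cvg (haar_mult a) (fun x => c * f x) x (c * p).
Proof.
move=> hf hp; rewrite /op_cvg.
have -> : partial_sum (haar_mult a) (fun x => c * f x) x =
    fun mn => c * partial_sum (haar_mult a) f x mn.
  apply/funext => -[m n]; rewrite !partial_sumE; try exact: haar_mult_local.
  rewrite big_distrr/=; apply: eq_bigr => i _.
  rewrite !haar_multE//; last exact: dintegrableZ.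
  by rewrite /mass_jump !massZ//; ring.
by apply: cvgM => //; exact: cvg_cst.
Qed.

Lemma haar_mult_ae a f g : measurable_fun setT f -> measurable_fun setT g ->
  {ae leb, forall x, f x = g x} -> haar_mult a f = haar_mult a g.
Proof.
move=> mf mg fg; apply/funext => K; apply/funext => x; rewrite /haar_mult.
congr (_ * _ * _); rewrite /inner; congr fine; apply: ae_eq_int => //.
- by apply/measurable_EFinP; apply: measurable_funM => //; exact: measurable_haar.
- by apply/measurable_EFinP; apply: measurable_funM => //; exact: measurable_haar.
- by apply: aeW fg _ => y ->.
Qed.

Definition ancestor i K := iter i.+1 parent K.

(** The part of the kernel of a Haar multiplier that is constant on [K * K]:
    the sum over the dyadic intervals that strictly contain [K]. *)
Definition tail_series a K := series (fun i => a (ancestor i K) / len (ancestor i K)).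
Definition tail a K : R := limn (tail_series a K).
(** The value of the kernel on the products of the two halves of [K], where the Haar
    function of [K] contributes [- a K / len K]. *)
Definition cross a K : R := tail a K - a K / len K.
Definition summable_tails a := forall K, cvgn (tail_series a K).

Lemma cell_ancestor i j x : ancestor i (cell j x) = cell (j - 1 - i%:Z) x.
Proof.
elim: i => [|i IH]; first by rewrite /ancestor/= cell_parent subr0.
by rewrite /ancestor iterS -/(ancestor i _) IH cell_parent; congr cell; lia.
Qed.

Definition supported f (D : set R) := forall x, ~ D x -> f x = 0.

Lemma mass0 f (E : set R) : (forall x, E x -> f x = 0) -> mass f E = 0.
Proof.
move=> h; rewrite /mass (@eq_Rintegral _ _ _ _ _ (cst 0)).
  by rewrite /Rintegral integral0.
by move=> x; rewrite inE; exact: h.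
Qed.

Lemma mass_disjoint f (D E : set R) : supported f D -> (forall x, D x -> E x -> False) ->
  mass f E = 0.
Proof. by move=> sf DE; apply: mass0 => x Ex; apply: sf => /DE; exact. Qed.

Lemma mass_supported f (D E : set R) : supported f D -> D `<=` E -> mass f E = mass f D.
Proof.
move=> sf DE; rewrite /mass Rintegral_mkcond [RHS]Rintegral_mkcond.
apply: eq_Rintegral => x _; rewrite !patchE.
case: ifPn => [|/negP] xE; case: ifPn => [|/negP] xD //.
- by apply: sf => h; apply: xD; rewrite inE.
- by exfalso; apply: xE; move: xD; rewrite !inE; exact: DE.
Qed.

Lemma jump_ancestor f K i x : supported f (ditv K) -> ditv K x ->
  mass_jump f (ancestor i K) * haar_sign (ancestor i K) x = mass f (ditv K).
Proof.
move=> sf Kx; pose L := iter i parent K.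
have Lx : ditv L x.
  by rewrite /L; elim: (i) => //= k; exact: ditv_parent.
have KL : ditv K `<=` (ditv L : set R).
  rewrite /L; elim: (i) => [//|k IH] y /=; rewrite -/(ditv _ y) => /IH; exact: ditv_parent.
have -> : ancestor i K = parent L by [].
have hL : mass f (ditv L) = mass f (ditv K) by apply: mass_supported.
have [e|e] := parentP L; set P := parent L in e *.
- have xl : ditv (left_half P) x by rewrite -e.
  have h0 : mass f (ditv (right_half P)) = 0.
    by apply: (mass_disjoint sf) => y /KL; rewrite e; exact: ditv_halves_disj.
  by rewrite haar_sign_left// /mass_jump h0 -e hL; ring.
- have xr : ditv (right_half P) x by rewrite -e.
  have h0 : mass f (ditv (left_half P)) = 0.
    apply: (mass_disjoint sf) => y /KL; rewrite e => h1 h2.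
    exact: (ditv_halves_disj h2 h1).
  by rewrite haar_sign_right// /mass_jump h0 -e hL; ring.
Qed.

Definition small_series a f K x := series (fun i =>
  let L := cell (K.1 + i%:Z) x in a L * (mass_jump f L / len L) * haar_sign L x).

Section at_cell.
Variables (a : dyadic -> R) (f : R -> R) (K : dyadic) (x : R).
Hypotheses (hf : dintegrable f) (sf : supported f (ditv K)) (Kx : ditv K x).

Lemma large_seriesE : series (fun i => haar_mult a f (cell (K.1 - 1 - i%:Z) x) x) =
  fun n => tail_series a K n * mass f (ditv K).
Proof.
apply/funext => n; rewrite /tail_series /series/= big_distrl/=; apply: eq_bigr => i _.
rewrite -cell_ancestor -(cellE Kx) haar_multE//.
by rewrite -(jump_ancestor i sf Kx); ring.
Qed.

Lemma small_seriesE :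
  series (fun i => haar_mult a f (cell (K.1 + i%:Z) x) x) = small_series a f K x.
Proof.
by apply/funext => n; apply: eq_bigr => i _; rewrite haar_multE.
Qed.

(** The large scales only see the integral of [f]; the small scales are a Haar series. *)
Lemma op_cvg_in q : summable_tails a -> small_series a f K x @ \oo --> q ->
  op_cvg (haar_mult a) f x (tail a K * mass f (ditv K) + q).
Proof.
move=> ha hq; apply: (@op_cvg_split _ _ f x K.1 (@haar_mult_local a f x)).
- by rewrite large_seriesE; apply: cvgM; [exact: ha|exact: cvg_cst].
- by rewrite small_seriesE.
Qed.

(** The terms of the large scales are those of the tail, times the integral of [f]. *)
Lemma op_cvg_tail : cvg (partial_sum (haar_mult a) f x @ filter_prod \oo \oo) ->
  mass f (ditv K) != 0 -> cvgn (tail_series a K).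
Proof.
move=> h m0; have [+ _] := op_cvg_inv K.1 (@haar_mult_local a f x) h.
rewrite large_seriesE => /cvg_ex[l hl]; apply/cvg_ex; exists (l / mass f (ditv K)).
have : (fun n => tail_series a K n * mass f (ditv K) * (mass f (ditv K))^-1) @ \oo -->
    l / mass f (ditv K) by apply: cvgM => //; exact: cvg_cst.
by under eq_cvg do rewrite mulfK//.
Qed.

End at_cell.

(** Only [P] and its ancestors meet both the support of [f] and the point [x], and
    their Haar functions are constant on the support. *)
Lemma op_cvg_sibling a f P x : summable_tails a -> dintegrable f ->
  (supported f (ditv (left_half P)) /\ ditv (right_half P) x) \/
  (supported f (ditv (right_half P)) /\ ditv (left_half P) x) ->
  op_cvg (haar_mult a) f x (cross a P * mass f (ditv P)).
Proof.
move=> ha hf H.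
have sP : supported f (ditv P).
  by case: H => -[sf _] y Py; apply: sf => h; apply: Py; [exact: ditv_left|exact: ditv_right].
have Px : ditv P x by case: H => -[_]; [exact: ditv_right|exact: ditv_left].
rewrite /cross mulrBl; apply: op_cvg_in => //.
rewrite -(cvg_shiftn 1); apply: cvg_near_cst; exists 0%N => // n _.
rewrite -[LHS]/(small_series a f P x (n + 1)%N) addn1 /small_series /series/= big_nat_recl//= addr0 -(cellE Px).
rewrite big1 ?addr0; last first.
  move=> i _; set L := cell _ x; rewrite /mass_jump.
  have Lx : ditv L x by exact: ditv_cell.
  have PL : ((left_half P).1 <= L.1) /\ ((right_half P).1 <= L.1) by rewrite /L/=; lia.
  suff h y : ditv L y -> f y = 0.
    have -> : mass f (ditv (left_half L)) = 0 by apply: mass0 => y /ditv_left; exact: h.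
    have -> : mass f (ditv (right_half L)) = 0 by apply: mass0 => y /ditv_right; exact: h.
    by rewrite subrr mul0r mulr0 mul0r.
  case: H => -[sf hx] Ly; apply: sf => hy.
    by apply: ditv_halves_disj hy _; exact: (ditv_nested PL.2 hx Lx).
  by apply: (ditv_halves_disj _ hy); exact: (ditv_nested PL.1 hx Lx).
case: H => -[sf hx].
- rewrite haar_sign_right// /mass_jump.
  rewrite (mass_disjoint sf (@ditv_halves_disj _ P)) (mass_supported sf (@ditv_left _ P)).
  by ring.
- rewrite haar_sign_left// /mass_jump (mass_supported sf (@ditv_right _ P)).
  have -> : mass f (ditv (left_half P)) = 0; last by ring.
  by apply: (mass_disjoint sf) => y h1 h2; exact: ditv_halves_disj h2 h1.
Qed.

Lemma op_cvg0 a f x : dintegrable f -> (forall j y, ditv (cell j x) y -> f y = 0) ->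
  op_cvg (haar_mult a) f x 0.
Proof.
move=> hf h; rewrite /op_cvg.
have -> : partial_sum (haar_mult a) f x = fun=> 0; last exact: cvg_cst.
apply/funext => -[m n]; rewrite partial_sumE; last exact: haar_mult_local.
apply: big1 => i _; rewrite haar_multE// /mass_jump; set L := cell _ x.
have -> : mass f (ditv (left_half L)) = 0 by apply: mass0 => y /ditv_left; exact: h.
have -> : mass f (ditv (right_half L)) = 0 by apply: mass0 => y /ditv_right; exact: h.
by rewrite subrr mul0r mulr0 mul0r.
Qed.

End haar_multiplier.

(** * Haar series *)

Section dyadic_differentiation.
Context {R : realType}.
Local Notation leb := (@lebesgue_measure R).
Implicit Types (x y : R) (K L : dyadic) (f g G : R -> R).

Lemma bounded_in_cells (M : R) : exists m : nat, forall n, (m <= n)%N -> forall x, `|x| <= M ->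
  ditv (- n%:Z, 0) x \/ ditv (- n%:Z, -1) x.
Proof.
have [m hm] : exists m : nat, M < (2 ^ m)%N%:R.
  exists (Num.truncn M).+1; apply: lt_le_trans (_ : (Num.truncn M).+1%:R <= _).
    by rewrite truncnS_gt.
  by rewrite ler_nat ltnW// ltn_expl.
exists m => n mn x hx; rewrite !ditvE /len /= opprK add0r addNr mulr0z mulr1z.
rewrite mulrN1z mulr0 mulr1 mulrN1 -exprnP; have : M < 2 ^+ n.
  by apply: lt_le_trans hm _; rewrite natrX ler_weXn2l// ler1n.
by move: hx; rewrite ler_norml => /andP[h1 h2] h3; case: (leP 0 x) => h;
  [left|right]; lra.
Qed.

Lemma cells_disj (n : nat) x : ditv (- n%:Z, 0) x -> ditv (- n%:Z, -1) x -> False.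
Proof. by move=> /ditvP h /ditvP; rewrite h. Qed.

Lemma dintegrable_local f : measurable_fun setT f -> dintegrable f ->
  locally_integrable [set: R] f.
Proof.
move=> mf hf; split => //; first exact: openT.
move=> K _ cK; have [M [_ hM]] := compact_bounded cK.
have [m /(_ m (leqnn m)) hm] := bounded_in_cells (M + 1).
pose D : set R := ditv (- m%:Z, 0) `|` ditv (- m%:Z, -1).
have mD : measurable D by apply: measurableU; exact: measurable_ditv.
have KD : K `<=` D by move=> x Kx; apply: hm; apply: hM => //; rewrite ltrDl.
have mfa E : measurable_fun E (fun x => `|f x|%:E).
  by apply/measurable_EFinP; apply: measurable_funTS; apply: measurableT_comp.
apply: (@le_lt_trans _ _ (\int[leb]_(x in D) `|f x|%:E)%E).
  have mK : measurable K by exact: compact_measurable.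
  apply: (@ge0_subset_integral _ _ _ leb K D mK mD _ (mfa D) _ KD).
  by move=> x _; rewrite lee_fin.
rewrite ge0_integral_setU//; try exact: measurable_ditv; last first.
- by apply/disj_setPS => x [h1 h2]; exact: cells_disj h1 h2.
- exact: mfa.
- have /integrableP[_ h1] := hf (- m%:Z, 0).
  have /integrableP[_ h2] := hf (- m%:Z, -1).
  exact: lte_add_pinfty.
Qed.

Lemma local_dintegrable f : locally_integrable [set: R] f -> dintegrable f.
Proof.
move=> [mf _ hf] K; apply/integrableP; split.
  by apply/measurable_EFinP; exact: measurable_funTS.
pose C : set R := `[len K * K.2%:~R, len K * (K.2 + 1)%:~R]%classic.
have mC : measurable C by exact: measurable_itv.
apply: le_lt_trans (hf C _ (@segment_compact _ _ _)) => //.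
apply: (@ge0_subset_integral _ _ _ leb (ditv K) C (measurable_ditv K) mC).
- by apply/measurable_EFinP; apply: measurable_funTS; apply: measurableT_comp.
- by move=> x _; rewrite lee_fin.
by move=> x; rewrite ditvE /C /= in_itv/= => /andP[-> /ltW ->].
Qed.

Lemma len_cell j x : len (cell j x) = 2 ^ (- j) :> R.
Proof. by []. Qed.

Lemma ditv_dist K x y : ditv K x -> ditv K y -> `|x - y| < len K.
Proof.
rewrite !ditvE intrD => /andP[h1 h2] /andP[h3 h4].
by rewrite ltr_norml; apply/andP; split; lra.
Qed.

(** The dyadic intervals that contain a point shrink nicely to it. *)
Lemma dyadic_lebesgue f : measurable_fun setT f -> dintegrable f ->
  {ae leb, forall x, mass f (ditv (cell n%:Z x)) / len (cell n%:Z x) @[n --> \oo] --> f x}.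
Proof.
move=> mf hf; have locf := dintegrable_local mf hf.
have r0 n x : 0 < 2 * len (cell n%:Z x) :> R by rewrite mulr_gt0// len_gt0.
have hE x : nicely_shrinking x (fun n => ditv (cell n%:Z x)).
  split; first by move=> n; exact: measurable_ditv.
  exists (4, fun n => PosNum (r0 n x)); split => /=; first by [].
  - have -> : (fun n => 2 * len (cell n%:Z x) : R) = geometric 2 (2^-1).
      by rewrite funeqE => n; rewrite len_cell /geometric/= -exprz_inv.
    by apply: cvg_geometric; rewrite ger0_norm ?invr_ge0// invf_lt1// ltr1n.
  - move=> n y hy; rewrite /ball/=; apply: lt_trans (ditv_dist (ditv_cell _ x) hy) _.
    by have := len_gt0 (cell n%:Z x) : 0 < _ :> R; lra.
  - move=> n; rewrite lebesgue_measure_ball ?lebesgue_ditv -?EFinM ?lee_fin//=; last exact: ltW.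
    by rewrite -[_ *+ 2]mulr_natl mulrA -natrM.
apply: aeW (lebesgue_differentiation locf) _ => x hx.
have := nice_lebesgue_differentiation hE locf hx.
have -> : (fun n => ((leb (ditv (cell n%:Z x)))^-1 *
    \int[leb]_(y in ditv (cell n%:Z x)) (f y)%:E)%E) =
    (fun n => (mass f (ditv (cell n%:Z x)) / len (cell n%:Z x))%:E).
  apply/funext => n; rewrite lebesgue_ditv integral_EFinE//; last exact: measurable_ditv.
  by rewrite inver gt_eqF ?len_gt0// -EFinM mulrC.
by move/fine_cvgP => [_].
Qed.

End dyadic_differentiation.

Section haar_series.
Context {R : realType}.
Local Notation leb := (@lebesgue_measure R).
Implicit Types (x y : R) (K L : dyadic) (f g G : R -> R) (c : dyadic -> R).

Definition haar_sum c K n x := \sum_(0 <= i < n)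
  c (cell (K.1 + i%:Z) x) * haar_sign (cell (K.1 + i%:Z) x) x.

Local Notation nodesum := (nodesum left_half right_half).

Lemma haar_sum_left c K n x : ditv (left_half K) x ->
  haar_sum c K n.+1 x = - c K + haar_sum c (left_half K) n x.
Proof.
move=> h; rewrite /haar_sum big_nat_recl//= addr0 -(cellE (ditv_left h)).
rewrite haar_sign_left// mulrN1; congr (_ + _); apply: eq_bigr => i _.
by rewrite (_ : K.1 + 1 + i%:Z = K.1 + i.+1%:Z)//; lia.
Qed.

Lemma haar_sum_right c K n x : ditv (right_half K) x ->
  haar_sum c K n.+1 x = c K + haar_sum c (right_half K) n x.
Proof.
move=> h; rewrite /haar_sum big_nat_recl//= addr0 -(cellE (ditv_right h)).
rewrite haar_sign_right// mulr1; congr (_ + _); apply: eq_bigr => i _.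
by rewrite (_ : K.1 + 1 + i%:Z = K.1 + i.+1%:Z)//; lia.
Qed.

Lemma measurable_haar_sum c K n : measurable_fun setT (haar_sum c K n).
Proof.
apply: measurable_sum => i; apply: (@measurable_at_cell R (fun K x => c K * haar_sign K x)).
by move=> L; apply: measurable_funM => //; exact: measurable_haar_sign.
Qed.

Lemma haar_sum_bounded c n K : exists B, forall x, ditv K x -> `|haar_sum c K n x| <= B.
Proof.
elim: n K => [|n IH] K.
  by exists 0 => x _; rewrite /haar_sum big_geq// normr0.
have [B1 h1] := IH (left_half K); have [B2 h2] := IH (right_half K).
exists (`|c K| + (`|B1| + `|B2|)) => x; rewrite ditv_halves => -[h|h].
- rewrite haar_sum_left// (le_trans (ler_normD _ _))// normrN lerD2l.
  by rewrite (le_trans (h1 _ h))// (le_trans (ler_norm _))// lerDl.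
- rewrite haar_sum_right// (le_trans (ler_normD _ _))// lerD2l.
  by rewrite (le_trans (h2 _ h))// (le_trans (ler_norm _))// lerDr.
Qed.

Lemma bounded_integrable K f (B : R) : measurable_fun setT f ->
  (forall x, ditv K x -> `|f x| <= B) -> leb.-integrable (ditv K) (EFin \o f).
Proof.
move=> mf fB; apply: (@le_integrable _ _ _ leb _ (measurable_ditv K) _ (EFin \o cst B)).
- by apply/measurable_EFinP; exact: measurable_funTS.
- by move=> x Kx /=; rewrite lee_fin (le_trans (fB _ Kx))// ler_norm.
- apply/integrableP; split; first exact/measurable_EFinP.
  have -> : (fun x => `|(EFin \o cst B) x|%E) = cst `|B|%:E :> (R -> \bar R) by [].
  rewrite integral_cst; last exact: measurable_ditv.
  by rewrite [X in (_ * X)%E](lebesgue_ditv K) -EFinM ltry.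
Qed.

Lemma mass_halves f fl fr K : leb.-integrable (ditv K) (EFin \o f) ->
  (forall x, ditv (left_half K) x -> f x = fl x) ->
  (forall x, ditv (right_half K) x -> f x = fr x) ->
  mass f (ditv K) = mass fl (ditv (left_half K)) + mass fr (ditv (right_half K)).
Proof.
move=> hf hl hr; rewrite -(mass_eq hl) -(mass_eq hr) /mass [in LHS]ditv_halves Rintegral_setU//.
- exact: measurable_ditv.
- exact: measurable_ditv.
- by rewrite -ditv_halves; exact: hf.
- apply/disj_setPS => x [h1 h2]; exact: (ditv_halves_disj h1 h2).
Qed.

Lemma integrable_half f K : leb.-integrable (ditv K) (EFin \o f) ->
  leb.-integrable (ditv (left_half K)) (EFin \o f) /\
  leb.-integrable (ditv (right_half K)) (EFin \o f).
Proof.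
by move=> hf; split; apply: (@integrableS _ _ _ leb (ditv K)) hf;
  try exact: measurable_ditv; [exact: ditv_left|exact: ditv_right].
Qed.

Lemma mass_haar_sumM c n K g : measurable_fun setT g ->
  leb.-integrable (ditv K) (EFin \o g) ->
  leb.-integrable (ditv K) (EFin \o (fun x => haar_sum c K n x * g x)) /\
  mass (fun x => haar_sum c K n x * g x) (ditv K) = nodesum n (fun J => c J * mass_jump g J) K.
Proof.
move=> mg; elim: n K => [|n IH] K ig.
  have h x : haar_sum c K 0 x * g x = 0 by rewrite /haar_sum big_geq ?mul0r.
  split; last by rewrite mass0.
  rewrite (_ : (fun x => haar_sum c K 0 x * g x) = cst 0); last exact/funext.
  by apply: (@bounded_integrable _ _ 0) => [|x _]; rewrite ?normr0.
have [B hB] := haar_sum_bounded c n.+1 K.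
have i1 : leb.-integrable (ditv K) (EFin \o (fun x => haar_sum c K n.+1 x * g x)).
  have := integrableRZ B (measurable_ditv K) (integrable_norm ig).
  apply: (@le_integrable _ _ _ leb _ (measurable_ditv K)).
    apply/measurable_EFinP/measurable_funTS/measurable_funM => //.
    exact: measurable_haar_sum.
  move=> x Kx /=; rewrite lee_fin !normrM normr_id ler_wpM2r//.
  by apply: le_trans (hB _ Kx) _; exact: ler_norm.
split=> //; have [il ir] := integrable_half ig.
have [jl hl] := IH _ il; have [jr hr] := IH _ ir.
rewrite (mass_halves i1 (fl := fun x => - c K * g x + haar_sum c (left_half K) n x * g x)
   (fr := fun x => c K * g x + haar_sum c (right_half K) n x * g x)); last 2 first.
- by move=> x h; rewrite haar_sum_left// mulrDl.
- by move=> x h; rewrite haar_sum_right// mulrDl.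
rewrite /mass !RintegralD//; try exact: measurable_ditv; try apply: integrableRZ => //;
  try exact: measurable_ditv.
rewrite !RintegralZl//; try exact: measurable_ditv.
by rewrite -/(mass _ _) in hl hr; rewrite [nodesum _ _ _]/= -hl -hr /mass_jump /mass; ring.
Qed.

End haar_series.

Section cutting.
Context {R : realType}.
Local Notation leb := (@lebesgue_measure R).
Implicit Types (x y : R) (K L : dyadic) (D E : set R) (f g : R -> R).

Definition cut D f x : R := \1_D x * f x.

Lemma cut_in D f x : D x -> cut D f x = f x.
Proof. by move=> Dx; rewrite /cut indicE mem_set// mul1r. Qed.

Lemma cut_out D f x : ~ D x -> cut D f x = 0.
Proof. by move=> Dx; rewrite /cut indicE memNset// mul0r. Qed.

Lemma measurable_cut D f : measurable D -> measurable_fun setT f ->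
  measurable_fun setT (cut D f).
Proof. by move=> mD mf; apply: measurable_funM => //; exact: measurable_indic. Qed.

Lemma int_cut D f :
  (\int[leb]_x (cut D f x)%:E = \int[leb]_(x in D) (f x)%:E)%E.
Proof.
rewrite [RHS]integral_mkcond; apply: eq_integral => x _; rewrite patchE.
by case: ifPn => [|/negP]; rewrite inE => h; [rewrite cut_in|rewrite cut_out].
Qed.

Lemma mass_cut D f : mass (cut D f) setT = mass f D.
Proof. by rewrite /mass /Rintegral int_cut. Qed.

Lemma integrable_cut D f : measurable D -> measurable_fun setT f ->
  leb.-integrable D (EFin \o f) -> leb.-integrable setT (EFin \o cut D f).
Proof.
move=> mD mf /integrableP[_ h]; apply/integrableP; split.
  by apply/measurable_EFinP; exact: measurable_cut.
have -> : (fun x => `|(EFin \o cut D f) x|)%E = (fun x => (cut D (fun x => `|f x|) x)%:E).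
  apply/funext => x /=; have [Dx|Dx] := pselect (D x); first by rewrite !cut_in.
  by rewrite !cut_out// normr0.
by rewrite int_cut.
Qed.

Lemma integrableT_dintegrable f : leb.-integrable setT (EFin \o f) -> dintegrable f.
Proof.
by move=> h K; apply: (@integrableS _ _ _ leb setT) h => //; exact: measurable_ditv.
Qed.

Lemma dintegrable_cut D f : measurable D -> measurable_fun setT f ->
  leb.-integrable D (EFin \o f) -> dintegrable (cut D f).
Proof. by move=> mD mf h; apply: integrableT_dintegrable; exact: integrable_cut. Qed.

Lemma supported_cut D f : supported (cut D f) D.
Proof. by move=> x; exact: cut_out. Qed.

End cutting.

Section haar_series_L2.
Context {R : realType}.
Local Notation leb := (@lebesgue_measure R).
Implicit Types (x y : R) (K L : dyadic) (f g G : R -> R) (c : dyadic -> R).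
Local Notation nodesum := (nodesum left_half right_half).

Lemma integrable_sqr_haar_sum c n K (G : R -> R) : measurable_fun setT G ->
  (exists B, forall x, ditv K x -> `|G x| <= B) ->
  leb.-integrable (ditv K) (EFin \o (fun x => (haar_sum c K n x + G x) ^+ 2)).
Proof.
move=> mG [B hB]; have [B' hB'] := haar_sum_bounded c n K.
apply: (@bounded_integrable _ _ _ ((B' + B) ^+ 2)).
  by apply: measurable_funX; apply: measurable_funD => //; exact: measurable_haar_sum.
move=> x Kx; rewrite normrX lerXn2r ?nnegrE//.
  by rewrite (le_trans _ (lerD (hB' _ Kx) (hB _ Kx)))// addr_ge0.
by rewrite (le_trans (ler_normD _ _))// lerD ?hB' ?hB.
Qed.

Lemma mass_cst (y : R) K : mass (cst y) (ditv K) = y * len K.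
Proof.
rewrite /mass Rintegral_cst; last exact: measurable_ditv.
by rewrite [X in fine X](lebesgue_ditv K).
Qed.

Lemma mass_addc f (y : R) K : leb.-integrable (ditv K) (EFin \o f) ->
  mass (fun x => f x + y) (ditv K) = mass f (ditv K) + y * len K.
Proof.
move=> hf; rewrite /mass RintegralD//; last 2 first.
- exact: measurable_ditv.
- by apply: (@bounded_integrable _ _ _ `|y|).
by congr (_ + _); exact: mass_cst.
Qed.

Lemma integrable_haar_sum c n K L : K.1 <= L.1 -> (exists2 x : R, ditv K x & ditv L x) ->
  leb.-integrable (ditv L) (EFin \o haar_sum c K n).
Proof.
move=> KL [x Kx Lx]; have [B hB] := haar_sum_bounded c n K.
apply: (@bounded_integrable _ _ _ B); first exact: measurable_haar_sum.
by move=> y /(ditv_nested KL Kx Lx); exact: hB.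
Qed.

Lemma mass_sqr_haar_sum c n K y :
  mass (fun x => (haar_sum c K n x + y) ^+ 2) (ditv K) =
  y ^+ 2 * len K + nodesum n (fun J => c J ^+ 2 * len J) K.
Proof.
elim: n K y => [|n IH] K y.
  rewrite addr0 -mass_cst; congr mass; apply/funext => x.
  by rewrite /haar_sum big_geq// add0r.
rewrite (mass_halves (fl := fun x => (haar_sum c (left_half K) n x + (y - c K)) ^+ 2)
  (fr := fun x => (haar_sum c (right_half K) n x + (y + c K)) ^+ 2)).
- by rewrite !IH /= (len_half K).1 (len_half K).2; field.
- apply: (@integrable_sqr_haar_sum _ _ _ (cst y)) => //; by exists `|y|.
- by move=> x h; rewrite haar_sum_left//; congr (_ ^+ 2); ring.
- by move=> x h; rewrite haar_sum_right//; congr (_ ^+ 2); ring.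
Qed.

Lemma mass_sqr_haar_sumB c m n K : (n <= m)%N ->
  mass (fun x => (haar_sum c K m x - haar_sum c K n x) ^+ 2) (ditv K) =
  nodesum m (fun J => c J ^+ 2 * len J) K - nodesum n (fun J => c J ^+ 2 * len J) K.
Proof.
elim: n m K => [|n IH] m K.
  have -> : (fun x => (haar_sum c K m x - haar_sum c K 0 x) ^+ 2) =
      (fun x => (haar_sum c K m x + 0) ^+ 2).
    by apply/funext => x; rewrite /haar_sum (big_geq (leqnn 0%N)) subr0 addr0.
  by move=> _; rewrite mass_sqr_haar_sum expr0n/= mul0r add0r subr0.
case: m => // m nm; rewrite (mass_halves
  (fl := fun x => (haar_sum c (left_half K) m x - haar_sum c (left_half K) n x) ^+ 2)
  (fr := fun x => (haar_sum c (right_half K) m x - haar_sum c (right_half K) n x) ^+ 2)).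
- by rewrite !IH//=; ring.
- apply: (@integrable_sqr_haar_sum _ _ _ (fun x => - haar_sum c K n.+1 x)).
    by apply: measurable_funN; exact: measurable_haar_sum.
  by have [B hB] := haar_sum_bounded c n.+1 K; exists B => x Kx; rewrite normrN; exact: hB.
- by move=> x h; rewrite !haar_sum_left//; congr (_ ^+ 2); ring.
- by move=> x h; rewrite !haar_sum_right//; congr (_ ^+ 2); ring.
Qed.

Lemma nodesum_mono (F : dyadic -> R) m n K : (forall J, 0 <= F J) -> (n <= m)%N ->
  nodesum n F K <= nodesum m F K.
Proof.
move=> F0; elim: n m K => [|n IH] [|m] K nm //=.
  by rewrite addr_ge0// addr_ge0// nodesum_ge0.
by rewrite lerD2l lerD// IH.
Qed.

Lemma mass_haar_sum_cell c m n K x : (n <= m)%N -> ditv K x ->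
  mass (haar_sum c K m) (ditv (cell (K.1 + n%:Z) x)) =
  haar_sum c K n x * len (cell (K.1 + n%:Z) x).
Proof.
elim: n m K => [|n IH] m K.
  move=> _ Kx; rewrite addr0 -(cellE Kx) {2}/haar_sum big_geq// mul0r.
  have h1 : leb.-integrable (ditv K) (EFin \o (cst 1 : R -> R)).
    by apply: (@bounded_integrable _ _ _ 1) => // y _; rewrite normr1.
  have [_] := @mass_haar_sumM _ c m K (cst 1) (measurable_cst _) h1.
  rewrite (_ : (fun x => _) = haar_sum c K m); last by apply/funext => y; rewrite mulr1.
  move=> ->; elim: m K {Kx h1} => //= k IHk J; rewrite !IHk !addr0 /mass_jump !mass_cst.
  by rewrite (len_half J).1 (len_half J).2 subrr mulr0.
case: m => // m nm Kx.
have e : K.1 + n.+1%:Z = K.1 + 1 + n%:Z by lia.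
move: Kx; rewrite {1}ditv_halves => -[h|h].
- have sub : ditv (cell (K.1 + n.+1%:Z) x) `<=` (ditv (left_half K) : set R).
    by apply: (ditv_nested _ h (ditv_cell _ x)) => /=; lia.
  rewrite (mass_eq (g := fun y => haar_sum c (left_half K) m y + - c K)); last first.
    by move=> y /sub hy; rewrite haar_sum_left// addrC.
  rewrite haar_sum_left// e mass_addc; last first.
    by apply: integrable_haar_sum => /=; [lia|exists x; last exact: ditv_cell].
  by rewrite -[K.1 + 1]/((left_half K).1) IH//; ring.
- have sub : ditv (cell (K.1 + n.+1%:Z) x) `<=` (ditv (right_half K) : set R).
    by apply: (ditv_nested _ h (ditv_cell _ x)) => /=; lia.
  rewrite (mass_eq (g := fun y => haar_sum c (right_half K) m y + c K)); last first.
    by move=> y /sub hy; rewrite haar_sum_right// addrC.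
  rewrite haar_sum_right// e mass_addc; last first.
    by apply: integrable_haar_sum => /=; [lia|exists x; last exact: ditv_cell].
  by rewrite -[K.1 + 1]/((right_half K).1) IH//; ring.
Qed.

End haar_series_L2.

Section haar_series_limit.
Context {R : realType}.
Local Notation leb := (@lebesgue_measure R).
Implicit Types (x y : R) (K L : dyadic) (f g G : R -> R) (c : dyadic -> R).
Local Notation nodesum := (nodesum left_half right_half).

Lemma int_mul_indic (f : R -> R) (D : set R) :
  (\int[leb]_x (f x * \1_D x)%:E = \int[leb]_(x in D) (f x)%:E)%E.
Proof. by rewrite -int_cut; apply: eq_integral => x _; rewrite /cut mulrC. Qed.

Lemma haar_sum0 c K x : haar_sum c K 0 x = 0.
Proof. by rewrite /haar_sum big_geq. Qed.

(** A Haar series with square summable coefficients converges almost everywhere: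
    its sum exists in [L^2], the partial sums are the dyadic averages of this
    sum, and Lebesgue's differentiation theorem applies. *)
Lemma haar_series c K (Q : R) :
  (forall n, nodesum n (fun J => c J ^+ 2 * len J) K <= Q) ->
  exists G, [/\ measurable_fun setT G,
    leb.-integrable (ditv K) (EFin \o (fun x => G x ^+ 2)),
    {ae leb, forall x, ditv K x -> haar_sum c K n x @[n --> \oo] --> G x},
    (forall n, leb.-integrable (ditv K) (EFin \o (fun x => (haar_sum c K n x - G x) ^+ 2))) /\
      mass (fun x => (haar_sum c K n x - G x) ^+ 2) (ditv K) @[n --> \oo] --> 0 &
    mass (fun x => G x ^+ 2) (ditv K) <= Q].
Proof.
move=> hQ; pose F J : R := c J ^+ 2 * len J.
have F0 J : 0 <= F J by rewrite mulr_ge0 ?sqr_ge0// ltW// len_gt0.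
have mK := measurable_ditv K : measurable (ditv K : set R).
have mS n := measurable_haar_sum c K n : measurable_fun setT (haar_sum c K n : R -> R).
have ndN : nondecreasing_seq (fun n => nodesum n F K).
  by move=> m n mn; exact: nodesum_mono.
have cvN : cvgn (fun n => nodesum n F K).
  by apply: nondecreasing_is_cvgn => //; exists Q => _ [n _ <-]; exact: hQ.
have iB m n : leb.-integrable (ditv K)
    (EFin \o (fun x => (haar_sum c K m x - haar_sum c K n x) ^+ 2)).
  apply: (@integrable_sqr_haar_sum _ _ _ _ (fun x => - haar_sum c K n x)).
    exact: measurable_funN.
  by have [B hB] := haar_sum_bounded c n K; exists B => x Kx; rewrite normrN; exact: hB.
have cau (e : R) : 0 < e -> exists N, forall n m, (N <= n)%N -> (N <= m)%N ->
    (\int[leb]_x ((haar_sum c K n x - haar_sum c K m x) ^+ 2 * \1_(ditv K) x)%:E <= e%:E)%E.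
  move=> e0; have /cvg_ex[l hl] := cvN.
  have lN n : nodesum n F K <= l by have := nondecreasing_cvgn_le ndN cvN n; rewrite (cvg_lim _ hl).
  move/cvgrPdist_le : hl => /(_ _ e0)[N _ HN]; exists N.
  suff H n m : (N <= n)%N -> (n <= m)%N ->
      (\int[leb]_x ((haar_sum c K m x - haar_sum c K n x) ^+ 2 * \1_(ditv K) x)%:E <= e%:E)%E.
    move=> n m Nn Nm; have [nm|/ltnW mn] := leqP n m; last exact: H.
    by under eq_integral do rewrite -sqrrN opprB; exact: H.
  move=> Nn nm; rewrite int_mul_indic integral_EFinE// lee_fin.
  rewrite -/(mass _ _) mass_sqr_haar_sumB// -/F.
  have := HN n Nn; rewrite ler_norml => /andP[_]; have := lN m.
  by rewrite -/F; lra.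
have i0 x : 0 <= \1_(ditv K) x :> R by rewrite indicE.
have [G mG hG] := @L2_complete _ (fun n => haar_sum c K n) (\1_(ditv K)) mS
  (measurable_indic mK) i0 cau.
have mSG n : measurable_fun setT (fun x => (haar_sum c K n x - G x) ^+ 2).
  by apply: measurable_funX; exact: measurable_funB.
have iSG0 : exists N, leb.-integrable (ditv K) (EFin \o (fun x => (haar_sum c K N x - G x) ^+ 2)).
  have [N HN] := hG 1 ltr01; exists N; apply: (@integrable_ge0 _ _ _ 1).
  - exact: measurable_funTS.
  - by move=> x _; exact: sqr_ge0.
  - by rewrite -int_mul_indic; exact: HN.
have iG : leb.-integrable (ditv K) (EFin \o (fun x => G x ^+ 2)).
  have [N HN] := iSG0.
  have h := integrableRZ 2 mK HN; have h' := integrableRZ 2 mK (iB N 0%N).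
  have := integrableRD mK h h'; apply: (@le_integrable _ _ _ leb _ mK).
    by apply/measurable_EFinP; apply: measurable_funTS; exact: measurable_funX.
  move=> x Kx /=; rewrite lee_fin haar_sum0 subr0.
  rewrite (ger0_norm (sqr_ge0 _)); apply: le_trans (ler_norm _).
  have := sqr_ge0 (2 * haar_sum c K N x - G x); nra.
have iSG n : leb.-integrable (ditv K) (EFin \o (fun x => (haar_sum c K n x - G x) ^+ 2)).
  have h := integrableRZ 2 mK iG; have h' := integrableRZ 2 mK (iB n 0%N).
  have := integrableRD mK h h'; apply: (@le_integrable _ _ _ leb _ mK).
    by apply/measurable_EFinP; apply: measurable_funTS; exact: mSG.
  move=> x Kx /=; rewrite lee_fin haar_sum0 subr0.
  rewrite (ger0_norm (sqr_ge0 _)); apply: le_trans (ler_norm _).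
  have := sqr_ge0 (haar_sum c K n x + G x); nra.
have cv0 : mass (fun x => (haar_sum c K n x - G x) ^+ 2) (ditv K) @[n --> \oo] --> 0.
  apply/cvgrPdist_le => e e0; have [N HN] := hG e e0; exists N => // n /= Nn.
  have := HN n Nn; rewrite int_mul_indic integral_EFinE// lee_fin -/(mass _ _) => h.
  rewrite sub0r normrN ger0_norm//; apply: Rintegral_ge0 => x _; exact: sqr_ge0.
have ae : {ae leb, forall x, ditv K x -> haar_sum c K n x @[n --> \oo] --> G x}.
  have iG1 : leb.-integrable (ditv K) (EFin \o G).
    have i1 : leb.-integrable (ditv K) (EFin \o (cst 1 : R -> R)).
      by apply: (@bounded_integrable _ _ _ 1) => // y _; rewrite normr1.
    have [] := @cauchy_schwarz _ (ditv K) G (fun x => G x ^+ 2) (cst 1) mK (measurable_funTS mG) iG i1 => // x _.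
    by rewrite mulr1 sqr_ge0 ler01.
  have dG : dintegrable (cut (ditv K) G) by apply: dintegrable_cut.
  apply: aeW (dyadic_lebesgue (measurable_cut mK mG) dG) _ => x hx Kx.
  rewrite cut_in// in hx.
  pose h n : int := K.1 + n%:Z.
  have {hx} : mass (cut (ditv K) G) (ditv (cell (absz (h n)) x)) / len (cell (absz (h n)) x)
      @[n --> \oo] --> G x.
    apply: (cvg_comp (fun n => absz (h n)) (fun n : nat =>
      mass (cut (ditv K) G) (ditv (cell n%:Z x)) / len (cell n%:Z x))) hx.
    by apply: (@cvg_absz_shift _ K.1) => n; rewrite addrC.
  apply: cvg_trans; apply: near_eq_cvg; exists (absz K.1) => // n /= hn.
  have -> : (absz (h n))%:Z = h n by rewrite /h; lia.
  set L := cell (h n) x; have Lx : ditv L x by exact: ditv_cell.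
  have mL := measurable_ditv L : measurable (ditv L : set R).
  have LK : ditv L `<=` (ditv K : set R).
    by apply: (ditv_nested _ Kx Lx); rewrite /L/= /h; lia.
  suff e : mass (cut (ditv K) G) (ditv L) = haar_sum c K n x * len L.
    by rewrite e mulfK// len_neq0.
  rewrite (mass_eq (g := G)) => [|y /LK]; last exact: cut_in.
  apply/eqP; rewrite -subr_eq0 -sqrf_eq0 eq_le sqr_ge0 andbT.
  have lim0 : mass (fun x => (haar_sum c K m x - G x) ^+ 2) (ditv K) * len L @[m --> \oo] --> 0.
    by rewrite -[X in _ --> X](mul0r (len L)); apply: cvgM => //; exact: cvg_cst.
  rewrite -(cvg_lim _ lim0)//; apply: limr_ge; first exact: cvgP lim0.
  exists n => // m /= nm.
  rewrite -(mass_haar_sum_cell c nm Kx) -/(h n) -/L.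
  have iGL : leb.-integrable (ditv L) (EFin \o G).
    exact: (@integrableS _ _ _ leb (ditv K)) iG1.
  have iSL : leb.-integrable (ditv L) (EFin \o haar_sum c K m).
    by apply: integrable_haar_sum; [rewrite /L/= /h; lia|exists x].
  have i1 : leb.-integrable (ditv L) (EFin \o (cst 1 : R -> R)).
    by apply: (@bounded_integrable _ _ _ 1) => // y _; rewrite normr1.
  have i2 : leb.-integrable (ditv L) (EFin \o (fun x => (haar_sum c K m x - G x) ^+ 2)).
    exact: (@integrableS _ _ _ leb (ditv K)) (iSG m).
  have mSL : measurable_fun (ditv L) (fun x => haar_sum c K m x - G x).
    by apply: measurable_funTS; exact: measurable_funB.
  have [|_] := @cauchy_schwarz _ (ditv L) _ _ _ mL mSL i2 i1.
    by move=> y _; rewrite mulr1 sqr_ge0 ler01.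
  rewrite RintegralB// -/(mass _ _) -/(mass _ _) -sqrrN opprB => hh.
  apply: le_trans hh _.
  rewrite -/(mass _ _) -/(mass (cst 1) _) mass_cst mul1r ler_wpM2r//.
    by rewrite ltW// len_gt0.
  rewrite -lee_fin /mass -!integral_EFinE//.
  apply: (@ge0_subset_integral _ _ _ leb _ _ mL mK) => //.
  - by apply/measurable_EFinP; apply: measurable_funTS; exact: mSG.
  - by move=> y _; rewrite lee_fin sqr_ge0.
exists G; split => //.
have : (\int[leb]_(x in ditv K) (G x ^+ 2)%:E <= Q%:E)%E.
  apply: (@fatou_le _ _ (fun n x => haar_sum c K n x ^+ 2)) => //.
  - by move=> n; apply: measurable_funX; exact: measurable_funTS.
  - by apply: measurable_funX; exact: measurable_funTS.
  - by move=> n x _; exact: sqr_ge0.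
  - by apply: aeW ae _ => x h Kx; apply: cvgM; exact: h.
  - move=> n; rewrite integral_EFinE//.
      have := mass_sqr_haar_sum c n K 0; under [X in mass X]eq_fun do rewrite addr0.
      by rewrite /mass => ->; rewrite expr0n mul0r add0r lee_fin.
    have := iB n 0%N; congr (is_true (integrable _ _ _)); apply/funext => x /=.
    by rewrite haar_sum0 subr0.
by rewrite integral_EFinE.
Qed.

End haar_series_limit.

(** * Almost everywhere convergence, on good sets *)

Section good_sets.
Context {R : realType}.
Local Notation leb := (@lebesgue_measure R).
Implicit Types (x y lam : R) (J K L : dyadic) (f g h G : R -> R).
Local Notation nodesum := (nodesum left_half right_half).

Lemma dyadic_lebesgue_from j f : measurable_fun setT f -> dintegrable f ->
  {ae leb, forall x, mass f (ditv (cell (j + n%:Z) x)) / len (cell (j + n%:Z) x)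
    @[n --> \oo] --> f x}.
Proof.
move=> mf hf; apply: aeW (dyadic_lebesgue mf hf) _ => x hx.
have {hx} : mass f (ditv (cell (absz (j + n%:Z)) x)) / len (cell (absz (j + n%:Z)) x)
    @[n --> \oo] --> f x.
  apply: (cvg_comp (fun n : nat => absz (j + n%:Z)) (fun n : nat =>
    mass f (ditv (cell n%:Z x)) / len (cell n%:Z x))) hx.
  by apply: (@cvg_absz_shift _ j) => n; rewrite addrC.
apply: cvg_trans; apply: near_eq_cvg; exists (absz j) => // n /= hn.
by have -> : (absz (j + n%:Z))%:Z = j + n%:Z by lia.
Qed.

Lemma cvgn_bounded (u : nat -> R) (l : R) : u @ \oo --> l -> exists B, forall n, `|u n| <= B.
Proof.
move=> ul; have /cvg_seq_bounded[M [_ hM]] : cvgn u by apply/cvg_ex; exists l.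
by exists (M + 1) => n; apply: hM => //; rewrite ltrDl.
Qed.

Lemma mass_ge0 h K : (forall x, 0 <= h x) -> 0 <= mass h (ditv K).
Proof. by move=> h0; apply: Rintegral_ge0. Qed.

Lemma le_mass f g K : leb.-integrable (ditv K) (EFin \o f) ->
  leb.-integrable (ditv K) (EFin \o g) -> (forall x, ditv K x -> f x <= g x) ->
  mass f (ditv K) <= mass g (ditv K).
Proof. by move=> hf hg fg; apply: le_Rintegral => //; exact: measurable_ditv. Qed.

Lemma le_norm_mass f K : leb.-integrable (ditv K) (EFin \o f) ->
  `|mass f (ditv K)| <= mass (fun x => `|f x|) (ditv K).
Proof. by move=> hf; apply: le_normr_Rintegral => //; exact: measurable_ditv. Qed.

Variables (a : dyadic -> R) (h : R -> R) (K0 : dyadic).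
Hypotheses (mh : measurable_fun setT h) (ih : dintegrable h) (h0 : forall x, 0 <= h x).

Definition good lam K := mass h (ditv K) <= lam * len K /\ `|a K| <= lam.

(** The points of [K0] around which everything is under control: the set where
    the stopping time of the Calderon-Zygmund decomposition of [h] at height
    [lam], which also stops at large coefficients, does not stop. *)
Definition good_set lam : set R := [set x | [/\ ditv K0 x, h x <= lam &
  forall n : nat, good lam (cell (K0.1 + n%:Z) x)]].

Definition alive lam K := exists x, ditv K x /\ good_set lam x.

Lemma measurable_good_set lam : measurable (good_set lam).
Proof.
have -> : good_set lam = ditv K0 `&` [set x | h x <= cst lam x] `&`
    \bigcap_(n : nat) ((fun x => (`[< good lam (cell (K0.1 + n%:Z) x) >]%:R : R)) @^-1` [set 1]).
  apply/seteqP; split=> x /=.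
    by move=> [h1 h2 h3]; split => // n _ /=; rewrite asboolT.
  move=> [[h1 h2] h3]; split => // n; have := h3 n I => /=.
  by case: asboolP => // _ /eqP; rewrite eq_sym oner_eq0.
apply: measurableI; first apply: measurableI.
- exact: measurable_ditv.
- by rewrite -[X in measurable X]setTI; exact: (measurable_fun_le measurableT mh (measurable_cst _)).
- apply: bigcapT_measurable => n; rewrite -[X in measurable X]setTI.
  have mc K : measurable_fun setT (cst (`[< good lam K >]%:R : R) : R -> R) by [].
  exact: (@measurable_at_cell _ _ (K0.1 + n%:Z) mc measurableT _ (measurable_set1 _)).
Qed.

Lemma good_set_sub lam : good_set lam `<=` (ditv K0 : set R).
Proof. by move=> x []. Qed.

Lemma alive_left lam K : alive lam (left_half K) -> alive lam K.
Proof. by move=> [x [/ditv_left ? ?]]; exists x. Qed.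

Lemma alive_right lam K : alive lam (right_half K) -> alive lam K.
Proof. by move=> [x [/ditv_right ? ?]]; exists x. Qed.

Lemma alive_good lam K : K0.1 <= K.1 -> alive lam K -> good lam K.
Proof.
move=> K0K [x [/ditvP Kx [_ _ hx]]]; have := hx (absz (K.1 - K0.1)).
by rewrite gez0_abs ?subr_ge0// subrKC Kx.
Qed.

Lemma good_set_alive lam x j : good_set lam x -> alive lam (cell j x).
Proof. by move=> h1; exists x; split => //; exact: ditv_cell. Qed.

(** A bound along almost every branch, not a uniform one: this is what convergence of
    the averages of a weight to a positive limit gives. *)
Definition locally_bounded := {ae leb, forall x, forall j : int,
  exists B, forall n : nat, `|a (cell (j + n%:Z) x)| <= B}.

Lemma good_set_exhaust : locally_bounded -> {ae leb, forall x, ditv K0 x ->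
  exists N, forall n, (N <= n)%N -> good_set n%:R x}.
Proof.
move=> hb; apply: aeW (aeI hb (dyadic_lebesgue_from K0.1 mh ih)) _ => x [+ hx] Kx.
move=> /(_ K0.1)[B hB]; have [B' hB'] := cvgn_bounded hx.
exists (Num.truncn (`|B| + `|B'| + h x)).+1 => n Nn.
have : `|B| + `|B'| + h x <= n%:R.
  by apply: le_trans (ltW (truncnS_gt _)) _; rewrite ler_nat.
have := normr_ge0 B; have := normr_ge0 B'; have := ler_norm B; have := ler_norm B'.
have := h0 x => h1 h2 h3 h4 h5 h6.
split => //; first by lra.
move=> m; split.
  rewrite -ler_pdivrMr ?len_gt0//; have := hB' m; rewrite ler_norml => /andP[_]; lra.
by have := hB m; lra.
Qed.

Lemma nodesum_dead lam n K (F : dyadic -> R) : (forall J, ~ alive lam J -> F J = 0) ->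
  ~ alive lam K -> nodesum n F K = 0.
Proof.
move=> hF; elim: n K => //= n IH K hK; rewrite hF// !IH ?addr0//.
- by move/alive_right.
- by move/alive_left.
Qed.

Definition jump_energy f J : R := (mass_jump f J / len J) ^+ 2 * len J.

(** The [L^2] bound of the good part of a Calderon-Zygmund decomposition. It is Bessel's
    inequality, where the energy left in a dead branch is at most [B] times the [L^1]
    norm there: its top is half of a live interval, so the average is at most [B]. *)
Lemma alive_bessel lam f B n K : dintegrable f -> K0.1 <= K.1 -> alive lam K -> 0 <= B ->
  (forall J, K0.1 <= J.1 -> alive lam J -> [/\ `|mass f (ditv J)| <= B * len J,
    `|mass f (ditv (left_half J))| <= B * len (left_half J) &
    `|mass f (ditv (right_half J))| <= B * len (right_half J)]) ->
  nodesum n (fun J => if `[< alive lam J >] then jump_energy f J else 0) K +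
    mass f (ditv K) ^+ 2 / len K <= B * mass (fun x => `|f x|) (ditv K).
Proof.
move=> hf K0K aK B0 HB; set F := fun J => _.
have dead J : ~ alive lam J -> F J = 0 by move=> hJ; rewrite /F; case: asboolP.
have base J : `|mass f (ditv J)| <= B * len J ->
    mass f (ditv J) ^+ 2 / len J <= B * mass (fun x => `|f x|) (ditv J).
  move=> hJ; rewrite ler_pdivrMr ?len_gt0// -real_normK ?num_real// expr2.
  rewrite mulrAC ler_pM//; exact: le_norm_mass.
have hfa : dintegrable (fun x => `|f x|) by move=> J; exact: integrable_norm.
elim: n K K0K aK => [|n IH] K K0K aK.
  by rewrite /= add0r; apply: base; have [] := HB _ K0K aK.
have [_ hl hr] := HB _ K0K aK.
have step J : K0.1 <= J.1 -> `|mass f (ditv J)| <= B * len J ->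
    nodesum n F J + mass f (ditv J) ^+ 2 / len J <= B * mass (fun x => `|f x|) (ditv J).
  move=> K0J hJ; have [aJ|aJ] := pselect (alive lam J); first exact: IH.
  by rewrite (nodesum_dead _ dead aJ) add0r; exact: base.
have KlK : K0.1 <= (left_half K).1 by rewrite /=; lia.
have sl := step (left_half K) KlK hl; have sr := step (right_half K) KlK hr.
rewrite (mass_split K hfa) mulrDr; apply: le_trans (lerD sl sr).
rewrite [nodesum _ _ _]/= {1}/F asboolT// /jump_energy /mass_jump (mass_split K hf).
rewrite (len_half K).1 (len_half K).2 le_eqVlt; apply/orP; left; apply/eqP.
by have := len_neq0 K : _ != 0 :> R; move=> ?; field.
Qed.

Definition good_coef lam f J : R :=
  if `[< alive lam J >] then a J * (mass_jump f J / len J) else 0.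

Lemma dominated_alive lam f C J : dintegrable f -> 0 <= C ->
  (forall x, `|f x| <= C * h x) -> K0.1 <= J.1 -> alive lam J ->
  [/\ `|mass f (ditv J)| <= (2 * C * lam) * len J,
    `|mass f (ditv (left_half J))| <= (2 * C * lam) * len (left_half J) &
    `|mass f (ditv (right_half J))| <= (2 * C * lam) * len (right_half J)].
Proof.
move=> hf C0 fh K0J aJ; have [gJ _] := alive_good K0J aJ.
have hfa K : `|mass f (ditv K)| <= C * mass h (ditv K).
  rewrite -massZ//; apply: le_trans (le_norm_mass (hf K)) _.
  by apply: le_mass => //; [exact: integrable_norm|exact: dintegrableZ].
have l0 := len_gt0 J : 0 < len J :> R.
have hl := mass_ge0 (left_half J) h0; have hr := mass_ge0 (right_half J) h0.
have hJ := mass_split J ih; rewrite hJ in gJ.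
have key M : 0 <= M -> M <= lam * len J -> C * M <= C * (lam * len J).
  by move=> M0 hM; rewrite ler_wpM2l.
rewrite (len_half J).1 (len_half J).2; split.
- apply: le_trans (hfa _) _; rewrite hJ.
  have := key _ (addr_ge0 hl hr) gJ; have := mulr_ge0 C0 (le_trans (addr_ge0 hl hr) gJ); lra.
- apply: le_trans (hfa _) _; have := key _ hl; nra.
- apply: le_trans (hfa _) _; have := key _ hr; nra.
Qed.

End good_sets.

Section good_operator.
Context {R : realType}.
Local Notation leb := (@lebesgue_measure R).
Implicit Types (x y lam : R) (J K L : dyadic) (f g h G rho : R -> R).
Local Notation nodesum := (nodesum left_half right_half).
Variables (a : dyadic -> R) (K0 : dyadic).
Hypotheses (sa : summable_tails a) (ba : locally_bounded a).
Local Notation A := (haar_mult a).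

Lemma cvg_sqr_dist (u v : nat -> R) (l : R) :
  (forall n, (u n - l) ^+ 2 <= v n) -> v @ \oo --> 0 -> u @ \oo --> l.
Proof.
move=> uv v0; apply/cvgrPdist_le => e e0.
have e2 : 0 < e ^+ 2 by rewrite exprn_gt0.
move/cvgrPdist_le : v0 => /(_ _ e2)[N _ HN]; exists N => // n /HN /=.
rewrite sub0r normrN => h; rewrite -(@ler_pXn2r _ 2)// ?nnegrE ?(ltW e0)//.
rewrite real_normK ?num_real// (_ : (l - u n) ^+ 2 = (u n - l) ^+ 2); last by ring.
by apply: le_trans (uv n) _; apply: le_trans (ler_norm _) _.
Qed.

Lemma massZ_on (c : R) f K : leb.-integrable (ditv K) (EFin \o f) ->
  c * mass f (ditv K) = mass (fun x => c * f x) (ditv K).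
Proof. by move=> hf; rewrite /mass RintegralZl//; exact: measurable_ditv. Qed.

Lemma good_coef_sum h lam f C n : measurable_fun setT h -> dintegrable h ->
  (forall x, 0 <= h x) -> dintegrable f -> 0 <= C -> 0 <= lam ->
  (forall x, `|f x| <= C * h x) ->
  nodesum n (fun J => good_coef a h K0 lam f J ^+ 2 * len J) K0 <=
    2 * C * lam ^+ 3 * mass (fun x => `|f x|) (ditv K0).
Proof.
move=> mh ih h0 hf C0 lam0 fh.
have m0 : 0 <= mass (fun x => `|f x|) (ditv K0) by exact: mass_ge0.
have [aK|aK] := pselect (alive a h K0 lam K0); last first.
  rewrite (nodesum_dead (a := a) (h := h) (K0 := K0) (lam := lam)) //.
    by rewrite !(mulr_ge0, exprn_ge0).
  by move=> J hJ; rewrite /good_coef asboolF// expr0n mul0r.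
have B0 : 0 <= 2 * C * lam by rewrite !mulr_ge0.
have := alive_bessel n hf (lexx _) aK B0
  (fun J => @dominated_alive _ _ _ _ ih h0 _ _ _ J hf C0 fh).
set F := fun J => if _ then _ else _ => hB.
have q0 : 0 <= mass f (ditv K0) ^+ 2 / len K0.
  by apply: divr_ge0; [exact: sqr_ge0|exact: ltW (len_gt0 _)].
have {q0}hB : nodesum n F K0 <= 2 * C * lam * mass (fun x => `|f x|) (ditv K0).
  by apply: le_trans hB; rewrite lerDl.
have {}hB := ler_wpM2l (exprn_ge0 2 lam0) hB.
rewrite [leRHS](_ : _ = lam ^+ 2 * (2 * C * lam * mass (fun x => `|f x|) (ditv K0)));
  last by ring.
apply: le_trans hB; rewrite -nodesumZ.
pose P J : Prop := K0.1 <= J.1.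
have PK : P K0 by rewrite /P.
have e : forall J, P J -> P (left_half J) /\ P (right_half J) by move=> J; rewrite /P/=; lia.
pose T J := if `[< P J >] then good_coef a h K0 lam f J ^+ 2 * len J else 0.
rewrite (nodesum_eq_in (G := T) _ e)//; last by move=> J hJ; rewrite /T asboolT.
rewrite [leRHS](nodesum_eq_in (G := fun J => if `[< P J >] then lam ^+ 2 * F J else 0) _ e)//;
  last by move=> J hJ; rewrite asboolT.
apply: ler_nodesum => J; rewrite /T; case: asboolP => // PJ.
rewrite /F /good_coef; case: asboolP => [aJ|_]; last by rewrite expr0n mul0r mulr0.
rewrite /jump_energy exprMn mulrA ler_wpM2r ?(ltW (len_gt0 _))//.
apply: ler_wpM2r; first exact: sqr_ge0.
have [_ hJ] := alive_good PJ aJ.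
by rewrite -real_normK ?num_real//; apply: lerXn2r; rewrite ?nnegrE.
Qed.

Lemma jump_in_good h lam f J x n : good_set a h K0 lam x -> J = cell (K0.1 + n%:Z) x ->
  a J * (mass_jump f J / len J) = good_coef a h K0 lam f J.
Proof.
by move=> gx ->; rewrite /good_coef asboolT//; exact: good_set_alive.
Qed.

(** On the good set the operator acts as a Haar series with square summable
    coefficients; on functions supported in the good set it does so everywhere. *)
Lemma good_operator h lam f C : measurable_fun setT h -> dintegrable h ->
  (forall x, 0 <= h x) -> dintegrable f -> supported f (ditv K0) -> 0 <= C -> 0 <= lam ->
  (forall x, `|f x| <= C * h x) ->
  exists G, [/\ measurable_fun setT G,
    leb.-integrable (ditv K0) (EFin \o (fun x => G x ^+ 2)),
    {ae leb, forall x, ditv K0 x -> good_set a h K0 lam x \/ supported f (good_set a h K0 lam) ->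
       op_cvg A f x (tail a K0 * mass f (ditv K0) + G x)},
    (let S n := haar_sum (good_coef a h K0 lam f) K0 n in
     (forall n, leb.-integrable (ditv K0) (EFin \o (fun x => (S n x - G x) ^+ 2))) /\
      mass (fun x => (S n x - G x) ^+ 2) (ditv K0) @[n --> \oo] --> 0) &
    mass (fun x => G x ^+ 2) (ditv K0) <=
      2 * C * lam ^+ 3 * mass (fun x => `|f x|) (ditv K0)].
Proof.
move=> mh ih h0 hf sf C0 lam0 fh.
have [G [mG iG aeG SG GQ]] := haar_series (fun n => good_coef_sum n mh ih h0 hf C0 lam0 fh).
exists G; split => //; apply: aeW aeG _ => x hx Kx H.
apply: op_cvg_in => //.
have -> : small_series a f K0 x =
    fun n => haar_sum (good_coef a h K0 lam f) K0 n x; last exact: hx.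
apply/funext => n; rewrite /small_series /haar_sum /series/=; apply: eq_bigr => i _.
congr (_ * _); case: H => [gx|sf']; first exact: (jump_in_good f gx).
rewrite /good_coef; set J := cell _ x; case: asboolP => // dJ.
have f0 y : ditv J y -> f y = 0 by move=> hy; apply: sf' => gy; apply: dJ; exists y.
rewrite /mass_jump.
have -> : mass f (ditv (left_half J)) = 0 by apply: mass0 => y /ditv_left; exact: f0.
have -> : mass f (ditv (right_half J)) = 0 by apply: mass0 => y /ditv_right; exact: f0.
by rewrite subrr mul0r mulr0.
Qed.

(** Almost every point belongs to a good set of [`|f|]. *)
Lemma ae_op_cvg f : measurable_fun setT f -> dintegrable f -> supported f (ditv K0) ->
  {ae leb, forall x, ditv K0 x -> exists y, op_cvg A f x y}.
Proof.
move=> mf hf sf; pose h x := `|f x|.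
have mh : measurable_fun setT h by exact: measurableT_comp.
have ih : dintegrable h by move=> J; exact: integrable_norm.
have h0 x : 0 <= h x by exact: normr_ge0.
have H (n : nat) : {ae leb, forall x, ditv K0 x -> good_set a h K0 n%:R x ->
    exists y, op_cvg A f x y}.
  have fh x : `|f x| <= 1 * h x by rewrite mul1r.
  have [G [_ _ aeG _ _]] := good_operator mh ih h0 hf sf ler01 (ler0n _ n) fh.
  by apply: aeW aeG _ => x hx Kx gx; eexists; apply: hx => //; left.
have ex := good_set_exhaust K0 mh ih h0 ba.
apply: aeW (aeI ex (ae_forall_nat H)) _ => x [h1 h2] Kx.
have [N HN] := h1 Kx; exact: h2 Kx (HN N (leqnn N)).
Qed.

Lemma ae_op_valB f g : measurable_fun setT f -> dintegrable f -> supported f (ditv K0) ->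
  measurable_fun setT g -> dintegrable g -> supported g (ditv K0) ->
  {ae leb, forall x, ditv K0 x ->
    op_val A (fun y => f y - g y) x = op_val A f x - op_val A g x}.
Proof.
move=> mf hf sf mg hg sg.
apply: aeW (aeI (ae_op_cvg mf hf sf) (ae_op_cvg mg hg sg)) _ => x [h1 h2] Kx.
have [p hp] := h1 Kx; have [q hq] := h2 Kx.
rewrite (op_valE hp) (op_valE hq); apply: op_valE.
have -> : (fun y => f y - g y) = (fun y => f y + -1 * g y).
  by apply/funext => y; rewrite mulN1r.
rewrite -(mulN1r q).
exact: (op_cvgD hf (dintegrableZ (-1) hg) hp (@op_cvgZ _ a (-1) g x q hg hq)).
Qed.

(** The class of functions on which a bound for the operator is known is closed
    under dominated [L^1] limits: on a good set, where moreover [rho] is bounded,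
    the operator is continuous from [L^1] to [L^2(rho)]. *)
Lemma op_bound_closed (f_ : nat -> R -> R) f h rho (c : R) :
  measurable_fun setT h -> dintegrable h -> (forall x, 0 <= h x) ->
  (forall k, measurable_fun setT (f_ k)) -> measurable_fun setT f ->
  (forall k, supported (f_ k) (ditv K0)) -> supported f (ditv K0) ->
  (forall k x, `|f_ k x| <= h x) -> (forall x, `|f x| <= h x) ->
  mass (fun x => `|f_ k x - f x|) (ditv K0) @[k --> \oo] --> 0 ->
  measurable_fun setT rho -> (forall x, 0 <= rho x) ->
  (forall k, (\int[leb]_(x in ditv K0) (op_val A (f_ k) x ^+ 2 * rho x)%:E <= c%:E)%E) ->
  (\int[leb]_(x in ditv K0) (op_val A f x ^+ 2 * rho x)%:E <= c%:E)%E.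
Proof.
move=> mh ih h0 mf_ mf sf_ sf fh_ fh lim0 mr r0 hc.
have mK := measurable_ditv K0 : measurable (ditv K0 : set R).
have c0 : 0 <= c.
  rewrite -lee_fin; apply: le_trans (hc 0%N); apply: integral_ge0 => x _.
  by rewrite lee_fin mulr_ge0 ?sqr_ge0.
have dom g : measurable_fun setT g -> (forall x, `|g x| <= h x) -> dintegrable g.
  move=> mg gh J; apply: (@le_integrable _ _ _ leb _ (measurable_ditv J)) (ih J).
    by apply/measurable_EFinP; exact: measurable_funTS.
  by move=> x _ /=; rewrite lee_fin (ger0_norm (h0 x)).
have hf := dom _ mf fh; have hf_ k := dom _ (mf_ k) (fh_ k).
have mA g : measurable_fun setT (op_val A g) by exact: measurable_haar_mult.
have mAr g : measurable_fun setT (fun x => (op_val A g x ^+ 2 * rho x)%:E).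
  exact: measurable_sqr_mul.
pose E n := good_set a h K0 n%:R `&` [set x | rho x <= n%:R].
have mE n : measurable (E n).
  apply: measurableI; first exact: measurable_good_set.
  rewrite -[X in measurable X]setTI.
  exact: (measurable_fun_le measurableT mr (measurable_cst _)).
apply: (@exhaust_le _ (ditv K0) E _ c%:E mK _ _ mE).
- by have /measurable_EFinP := mAr f; exact: measurable_funTS.
- by move=> x _; rewrite mulr_ge0 ?sqr_ge0.
- apply: aeW (good_set_exhaust K0 mh ih h0 ba) _ => x hx Kx; have [N HN] := hx Kx.
  exists (maxn N (Num.truncn (rho x)).+1) => n; rewrite geq_max => /andP[h1 h2].
  split; first exact: HN.
  by rewrite /= (le_trans (ltW (truncnS_gt _)))// ler_nat.
move=> n; apply/lee_addgt0Pr => e e0.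
(* Young's inequality [p^2 <= (1 + eta) q^2 + (1 + eta^-1) (p - q)^2], with [eta]
   so small that the constant [c] is kept up to [e]. *)
pose d k := mass (fun x => `|f_ k x - f x|) (ditv K0).
pose eta := e / (2 * (c + 1)).
have eta0 : 0 < eta by rewrite divr_gt0// mulr_gt0// ltr_wpDl.
pose M : R := (1 + eta^-1) * n%:R.
have M0 : 0 <= M by rewrite mulr_ge0// addr_ge0// invr_ge0 ltW.
pose w k := 2 * (tail a K0) ^+ 2 * d k ^+ 2 * len K0 + 2 * (2 * 2 * n%:R ^+ 3 * d k).
have w0 : w k @[k --> \oo] --> 0.
  rewrite /w -[X in _ --> X](_ : 2 * (tail a K0) ^+ 2 * 0 ^+ 2 * len K0 + 2 * (2 * 2 * n%:R ^+ 3 * 0) = 0);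
    last by ring.
  apply: cvgD; apply: cvgM; try exact: cvg_cst.
    by apply: cvgM; [exact: cvg_cst|apply: cvgM].
  by apply: cvgM => //; exact: cvg_cst.
have Mw0 : M * w k @[k --> \oo] --> 0.
  by rewrite -[X in _ --> X](mulr0 M); apply: cvgM => //; exact: cvg_cst.
have e2 : 0 < e / 2 by rewrite divr_gt0.
have [k /= hk] : exists k, M * w k <= e / 2.
  move/cvgrPdist_le : Mw0 => /(_ _ e2)[k _ /(_ k (leqnn k))] /=.
  by rewrite sub0r normrN => hk; exists k; exact: le_trans (ler_norm _) hk.
pose g x := f x - f_ k x.
have mg : measurable_fun setT g by exact: measurable_funB.
have sg : supported g (ditv K0) by move=> x Kx; rewrite /g sf// sf_// subr0.
have hg : dintegrable g by move=> J; exact: (integrableRB (measurable_ditv J) (hf J) (hf_ k J)).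
have gh x : `|g x| <= 2 * h x.
  rewrite /g (le_trans (ler_normB _ _))//; have := fh x; have := fh_ k x; lra.
have [G [mG iG aeG _ GQ]] := good_operator mh ih h0 hg sg (ler0n _ 2) (ler0n _ n) gh.
have dg : mass (fun x => `|g x|) (ditv K0) = d k.
  by apply: mass_eq => x _; rewrite /g distrC.
have mgd : `|mass g (ditv K0)| <= d k by rewrite -dg; exact: le_norm_mass.
pose T := 2 * (tail a K0 * mass g (ditv K0)) ^+ 2.
pose W x := 2 * G x ^+ 2 + T.
have T0 : 0 <= T by rewrite /T mulr_ge0// sqr_ge0.
have W0 x : 0 <= W x by rewrite addr_ge0// mulr_ge0// sqr_ge0.
have mW : measurable_fun setT W.
  by apply: measurable_funD => //; apply: measurable_funM => //; exact: measurable_funX.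
have iW : leb.-integrable (ditv K0) (EFin \o W).
  apply: integrableRD => //; first exact: integrableRZ.
  by apply: (@bounded_integrable _ _ _ `|T|).
have IW : mass W (ditv K0) <= w k.
  rewrite /W mass_addc; last exact: integrableRZ.
  rewrite -massZ_on// /w addrC lerD//; last by rewrite ler_pM2l//; move: GQ; rewrite dg.
  have d2 : mass g (ditv K0) ^+ 2 <= d k ^+ 2.
    by rewrite -real_normK ?num_real//; apply: lerXn2r; rewrite ?nnegrE// (le_trans _ mgd).
  apply: ler_wpM2r; first exact: ltW (len_gt0 _).
  rewrite /T exprMn mulrA; apply: ler_wpM2l => //.
  by apply: mulr_ge0 => //; exact: sqr_ge0.
have key : {ae leb, forall x, (ditv K0 `&` E n) x ->
    ((op_val A f x ^+ 2 * rho x)%:E <=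
     (1 + eta)%:E * (op_val A (f_ k) x ^+ 2 * rho x)%:E + M%:E * (W x)%:E)%E}.
  apply: aeW (aeI aeG (ae_op_valB mf hf sf (mf_ k) (hf_ k) (sf_ k))) _ => x [h1 h2] [Kx [gx rx]].
  have := op_valE (h1 Kx (or_introl gx)); rewrite /g h2// => hpq.
  rewrite -!EFinM -EFinD lee_fin /M.
  have dW : (op_val A f x - op_val A (f_ k) x) ^+ 2 <= W x.
    by rewrite hpq /W /T; have := sqr_ge0 (tail a K0 * mass g (ditv K0) - G x); nra.
  move: dW; set V := W x => dW; move: (r0 x) rx => /=.
  move: dW; move: (op_val A f x) (op_val A (f_ k) x) (rho x) {hpq} => p q r dW r1 rx.
  have etai : eta * eta^-1 = 1 by rewrite mulfV// gt_eqF.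
  have etai0 : 0 <= eta^-1 by rewrite invr_ge0 ltW.
  have h3 : p ^+ 2 <= (1 + eta) * q ^+ 2 + (1 + eta^-1) * (p - q) ^+ 2.
    rewrite -subr_ge0 (_ : _ - _ = eta^-1 * (eta * q - (p - q)) ^+ 2); last first.
      rewrite (_ : eta^-1 * _ = (eta * eta^-1) * (eta * q ^+ 2) -
        2 * (eta * eta^-1) * q * (p - q) + eta^-1 * (p - q) ^+ 2); last by ring.
      by rewrite etai; ring.
    by rewrite mulr_ge0// sqr_ge0.
  apply: le_trans (ler_wpM2r r1 h3) _.
  have hm : (p - q) ^+ 2 * r <= n%:R * V.
    by rewrite mulrC; apply: ler_pM; [exact: r1|exact: sqr_ge0|exact: rx|exact: dW].
  rewrite [leLHS](_ : _ = (1 + eta) * (q ^+ 2 * r) + (1 + eta^-1) * ((p - q) ^+ 2 * r));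
    last by ring.
  by rewrite lerD2l -(mulrA _ n%:R) ler_wpM2l// addr_ge0.
have mSum : measurable_fun setT (fun x =>
    ((1 + eta)%:E * (op_val A (f_ k) x ^+ 2 * rho x)%:E + M%:E * (W x)%:E)%E).
  by apply: emeasurable_funD; apply: emeasurable_funM;
    [exact: measurable_cst|exact: mAr|exact: measurable_cst|exact/measurable_EFinP].
have eta1 : 0 <= 1 + eta by rewrite addr_ge0// ltW.
have Sum0 x : (0 <= (1 + eta)%:E * (op_val A (f_ k) x ^+ 2 * rho x)%:E + M%:E * (W x)%:E)%E.
  apply: adde_ge0; apply: mule_ge0; rewrite lee_fin//.
  by rewrite mulr_ge0 ?sqr_ge0.
have mKE : measurable (ditv K0 `&` E n) by exact: measurableI.
apply: (@le_trans _ _ (\int[leb]_(x in ditv K0 `&` E n)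
    ((1 + eta)%:E * (op_val A (f_ k) x ^+ 2 * rho x)%:E + M%:E * (W x)%:E))%E).
  apply: (@ae_ge0_le_integral _ _ _ leb _ mKE).
  - by move=> x _; rewrite lee_fin mulr_ge0 ?sqr_ge0.
  - by apply: measurable_funTS; exact: mAr.
  - by move=> x _; exact: Sum0.
  - exact: measurable_funTS.
  - exact: key.
apply: (@le_trans _ _ (\int[leb]_(x in ditv K0)
    ((1 + eta)%:E * (op_val A (f_ k) x ^+ 2 * rho x)%:E + M%:E * (W x)%:E))%E).
  apply: (@ge0_subset_integral _ _ _ leb _ _ mKE mK).
  - exact: measurable_funTS.
  - by move=> x _; exact: Sum0.
  - by move=> x [].
have mAk : measurable_fun (ditv K0) (fun x => (op_val A (f_ k) x ^+ 2 * rho x)%:E).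
  by apply: measurable_funTS; exact: mAr.
have mWk : measurable_fun (ditv K0) (fun x => (W x)%:E).
  by apply/measurable_EFinP; exact: measurable_funTS.
have Ak0 x : (0 <= (op_val A (f_ k) x ^+ 2 * rho x)%:E)%E.
  by rewrite lee_fin mulr_ge0 ?sqr_ge0.
rewrite ge0_integralD//; last 4 first.
- by move=> x _; apply: mule_ge0 => //; rewrite lee_fin.
- by apply: emeasurable_funM.
- by move=> x _; apply: mule_ge0; rewrite lee_fin.
- by apply: emeasurable_funM.
rewrite !ge0_integralZl_EFin//; last by move=> x _; rewrite lee_fin.
rewrite (integral_EFinE mK iW) -/(mass _ _).
apply: (@le_trans _ _ ((1 + eta)%:E * c%:E + M%:E * (w k)%:E)%E).
  by apply: leeD; apply: lee_wpmul2l; rewrite ?lee_fin.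
rewrite -!EFinM -!EFinD lee_fin.
have : eta * c <= e / 2.
  have -> : eta * c = e / 2 * (c / (c + 1)).
    by rewrite /eta; field; rewrite gt_eqF// ltr_wpDl.
  by rewrite ler_piMr ?ltW// ltr_pdivrMr ?mul1r ?ltrDl// ltr_wpDl.
by rewrite mulrDl mul1r; move: hk; lra.
Qed.

(** Symmetry. The [a.e.] convergent series is not a convergent series in any
    function space, so this is restricted to functions that live on a good set,
    where the operator is an [L^2] convergent Haar series. *)
Lemma op_symmetric h lam f g C : measurable_fun setT h -> dintegrable h ->
  (forall x, 0 <= h x) -> 0 <= C -> 0 <= lam ->
  measurable_fun setT f -> measurable_fun setT g ->
  supported f (good_set a h K0 lam) -> supported g (good_set a h K0 lam) ->
  (forall x, `|f x| <= C * h x) -> (forall x, `|g x| <= C * h x) ->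
  leb.-integrable (ditv K0) (EFin \o (fun x => op_val A f x * g x)) /\
  mass (fun x => op_val A f x * g x) (ditv K0) = mass (fun x => op_val A g x * f x) (ditv K0).
Proof.
move=> mh ih h0 C0 lam0.
have mK := measurable_ditv K0 : measurable (ditv K0 : set R).
pose S f n := haar_sum (good_coef a h K0 lam f) K0 n : R -> R.
suff H : forall f g : R -> R, measurable_fun setT f -> measurable_fun setT g ->
  supported f (good_set a h K0 lam) -> supported g (good_set a h K0 lam) ->
  (forall x, `|f x| <= C * h x) -> (forall x, `|g x| <= C * h x) ->
  [/\ leb.-integrable (ditv K0) (EFin \o (fun x => op_val A f x * g x)),
    forall n, mass (fun x => S f n x * g x) (ditv K0) =
      nodesum n (fun J => good_coef a h K0 lam f J * mass_jump g J) K0 &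
    mass (fun x => S f n x * g x) (ditv K0) @[n --> \oo] -->
      mass (fun x => op_val A f x * g x) (ditv K0) -
      tail a K0 * mass f (ditv K0) * mass g (ditv K0)].
  move=> mf mg sf sg fh gh.
  have [i1 s1 l1] := H f g mf mg sf sg fh gh; have [i2 s2 l2] := H g f mg mf sg sf gh fh.
  split=> //.
  have e : (fun n => mass (fun x => S f n x * g x) (ditv K0)) =
      (fun n => mass (fun x => S g n x * f x) (ditv K0)).
    apply/funext => n; rewrite s1 s2; congr nodesum; apply/funext => J.
    by rewrite /good_coef; case: asboolP; rewrite ?mul0r// => _; ring.
  rewrite e in l1; have E1 := cvg_lim (@Rhausdorff R) l1.
  have E2 := cvg_lim (@Rhausdorff R) l2; have := etrans (esym (E1 eventually_filter)) (E2 eventually_filter).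
  by rewrite (mulrAC (tail a K0)) => /eqP; rewrite (inj_eq (addIr _)) => /eqP ->.
clear f g; move=> f g mf mg sf sg fh gh.
have dom (k : R -> R) : measurable_fun setT k -> (forall x, `|k x| <= C * h x) -> dintegrable k.
  move=> mk kh J; have mJ := measurable_ditv J : measurable (ditv J : set R).
  apply: (@le_integrable _ _ _ leb _ mJ) (integrableRZ C mJ (ih J)).
    by apply/measurable_EFinP; exact: measurable_funTS.
  by move=> x _ /=; rewrite lee_fin (le_trans (kh x))// ler_norm.
have hf := dom _ mf fh; have hg := dom _ mg gh.
have sfK : supported f (ditv K0) by move=> x Kx; apply: sf => /good_set_sub.
have [G [mG iG aeG [iSG SG] _]] := good_operator mh ih h0 hf sfK C0 lam0 fh.
have mS n : measurable_fun setT (S f n) by exact: measurable_haar_sum.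
have ig2 : leb.-integrable (ditv K0) (EFin \o (fun x => g x ^+ 2)).
  apply: (@bounded_integrable _ _ _ ((C * lam) ^+ 2)); first exact: measurable_funX.
  move=> x _; rewrite normrX; apply: lerXn2r; rewrite ?nnegrE ?mulr_ge0//.
  have [gx|gx] := pselect (good_set a h K0 lam x); last by rewrite sg// normr0 mulr_ge0.
  by apply: le_trans (gh x) _; rewrite ler_wpM2l//; case: gx.
have CS (k : R -> R) : measurable_fun setT k ->
    leb.-integrable (ditv K0) (EFin \o (fun x => k x ^+ 2)) ->
    leb.-integrable (ditv K0) (EFin \o (fun x => k x * g x)) /\
    mass (fun x => k x * g x) (ditv K0) ^+ 2 <=
      mass (fun x => k x ^+ 2) (ditv K0) * mass (fun x => g x ^+ 2) (ditv K0).
  move=> mk ik; apply: cauchy_schwarz => //.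
    by apply: measurable_funTS; exact: measurable_funM.
  by move=> x _; rewrite exprMn !sqr_ge0 lexx.
have [iGg _] := CS G mG iG.
have mT : measurable_fun setT (fun x => op_val A f x * g x).
  by apply: measurable_funM => //; exact: measurable_haar_mult.
pose T := tail a K0 * mass f (ditv K0).
have iT : leb.-integrable (ditv K0) (EFin \o (fun x => T * g x + G x * g x)).
  by apply: integrableRD => //; exact: integrableRZ.
have aeT : {ae leb, forall x, ditv K0 x -> T * g x + G x * g x = op_val A f x * g x}.
  by apply: aeW aeG _ => x hx Kx; rewrite (op_valE (hx Kx (or_intror sf))) mulrDl.
split.
- apply: (@ae_eq_integrable _ _ (EFin \o (fun x => T * g x + G x * g x))) => //.
    by apply/measurable_EFinP; exact: measurable_funTS.
  by apply: aeW aeT _ => x h1 /h1 /= ->.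
- by move=> n; have [_] := mass_haar_sumM (good_coef a h K0 lam f) n mg (hg K0).
have -> : mass (fun x => op_val A f x * g x) (ditv K0) =
    T * mass g (ditv K0) + mass (fun x => G x * g x) (ditv K0).
  rewrite (massZ_on T (hg K0)) /mass -RintegralD//; last exact: integrableRZ.
  congr fine; apply: ae_eq_int => //.
  - by apply/measurable_EFinP; exact: measurable_funTS.
  - by have := measurable_int leb iT.
  - by apply: aeW aeT _ => x h1 /h1 ->.
rewrite addrAC subrr add0r; apply: (@cvg_sqr_dist _ (fun n =>
  mass (fun x => (S f n x - G x) ^+ 2) (ditv K0) * mass (fun x => g x ^+ 2) (ditv K0))).
- move=> n; have mSG : measurable_fun setT (fun x => S f n x - G x) by exact: measurable_funB.
  have [_] := CS _ mSG (iSG n).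
  have [iS _] := mass_haar_sumM (good_coef a h K0 lam f) n mg (hg K0).
  by rewrite {1}/mass; under eq_Rintegral do rewrite mulrBl; rewrite RintegralB.
- by rewrite -[X in _ --> X](mul0r (mass (fun x => g x ^+ 2) (ditv K0)));
    apply: cvgM => //; exact: cvg_cst.
Qed.

End good_operator.

(** * From the testing conditions to the two-weight inequality on an interval *)

Section testing_to_form.
Context {R : realType}.
Local Notation leb := (@lebesgue_measure R).
Implicit Types (x y : R) (J K L : dyadic) (f g G mu nu : R -> R).
Local Notation nodesum := (nodesum left_half right_half).
Local Notation leafsum := (leafsum left_half right_half).
Local Notation tree_additive := (tree_additive left_half right_half).
Local Notation jump := (jump left_half right_half).
Local Notation jump_mass := (jump_mass left_half right_half).
Local Notation form_coef := (form_coef left_half right_half).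

Lemma ae_not_empty (P : R -> Prop) K : {ae leb, forall x, ditv K x -> P x} ->
  exists2 x, ditv K x & P x.
Proof.
move=> [N [mN N0 sub]]; apply: contrapT => H.
have KN : ditv K `<=` N.
  by move=> x Kx; apply: sub => /= h; apply: H; exists x => //; exact: h.
have : (\int[leb]_(x in ditv K) (cst 1%E : R -> \bar R) x <=
    \int[leb]_(x in N) (cst 1%E : R -> \bar R) x)%E.
  apply: (@ge0_subset_integral _ _ _ leb _ _ (measurable_ditv K) mN _ _ _ KN).
  - exact: measurable_cst.
  - by move=> x _; exact: lee01.
rewrite !(@integral_cst _ _ _ leb) //; last exact: measurable_ditv.
rewrite !mul1e [X in (_ <= X)%E -> _]N0 [X in (X <= _)%E -> _](lebesgue_ditv K) lee_fin.
by rewrite leNgt len_gt0.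
Qed.

(** Positive everywhere, and not only almost everywhere as weights are: this avoids
    divisions by zero. Every weight has such a version, see [positive_version]. *)
Definition pos_weight mu :=
  [/\ measurable_fun setT mu, dintegrable mu & forall x, 0 < mu x].

Lemma mass_gt0 mu K : pos_weight mu -> 0 < mass mu (ditv K).
Proof.
move=> [mm im mp]; have mK := measurable_ditv K : measurable (ditv K : set R).
have ge0 := mass_ge0 K (fun x => ltW (mp x)).
rewrite lt_neqAle ge0 andbT; apply/eqP => m0.
have mmK : measurable_fun (ditv K) (EFin \o mu).
  by apply/measurable_EFinP; exact: measurable_funTS.
have : (\int[leb]_(x in ditv K) `|(EFin \o mu) x| = 0)%E.
  have -> : (\int[leb]_(x in ditv K) `|(EFin \o mu) x| = \int[leb]_(x in ditv K) (mu x)%:E)%E.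
    by apply: eq_integral => x _; rewrite gee0_abs// lee_fin ltW.
  by rewrite (integral_EFinE mK (im K)) -/(mass _ _) -m0.
move=> /(ae_eq_integral_abs leb mK mmK) => -[N [mN N0 sub]].
suff H : {ae leb, forall x, ditv K x -> False} by have [] := ae_not_empty H.
exists N; split => // x /= h; apply: sub => /= h'; apply: h => Kx.
by have := h' Kx => -[] /eqP; rewrite gt_eqF.
Qed.

Lemma additive_mass f : dintegrable f -> tree_additive (fun K => mass f (ditv K)).
Proof. by move=> hf K; exact: mass_split. Qed.

Section operator.
Variable a : dyadic -> R.
Hypotheses (sa : summable_tails a) (ba : locally_bounded (R := R) a).
Local Notation A := (haar_mult (R := R) a).

Lemma cut_halves f K :
  cut (ditv K) f = (fun x => cut (ditv (left_half K)) f x + cut (ditv (right_half K)) f x).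
Proof.
apply/funext => x; have [Kx|Kx] := pselect (ditv K x).
  rewrite cut_in//; move: Kx; rewrite {1}ditv_halves => -[h|h].
  - by rewrite cut_in// cut_out ?addr0// => h'; exact: ditv_halves_disj h h'.
  - by rewrite (cut_out (D := ditv (left_half K))) ?add0r ?cut_in// => h'; exact: ditv_halves_disj h' h.
by rewrite !cut_out ?addr0// => h; apply: Kx; first [exact: (ditv_left h)|exact: (ditv_right h)].
Qed.

Section cut_facts.
Variables (f : R -> R).
Hypotheses (mf : measurable_fun setT f) (hf : dintegrable f).

Lemma dcut K : dintegrable (cut (ditv K) f).
Proof. by apply: dintegrable_cut => //; exact: measurable_ditv. Qed.

Lemma mcut K : measurable_fun setT (cut (ditv K) f).
Proof. by apply: measurable_cut => //; exact: measurable_ditv. Qed.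

Lemma mass_cut_in K D : ditv K `<=` D -> mass (cut D f) (ditv K) = mass f (ditv K).
Proof. by move=> KD; apply: mass_eq => x /KD; exact: cut_in. Qed.

(** On one half of [K], the mass of the other half only contributes a constant. *)
Lemma op_left K : {ae leb, forall x, ditv (left_half K) x ->
  op_val A (cut (ditv K) f) x = op_val A (cut (ditv (left_half K)) f) x +
    cross a K * mass f (ditv (right_half K))}.
Proof.
have := ae_op_cvg sa ba (mcut (left_half K)) (dcut (left_half K)) (@supported_cut _ _ _).
move=> H; apply: aeW H _ => x hx Kx; have [p hp] := hx Kx.
rewrite (op_valE hp) cut_halves; apply: op_valE.
apply: op_cvgD; [exact: dcut|exact: dcut|exact: hp|].
rewrite -(@mass_cut_in (right_half K) (ditv (right_half K)))//.
rewrite -(mass_supported (@supported_cut _ _ f) (@ditv_right _ K)).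
by apply: op_cvg_sibling => //; [exact: dcut|right; split; [exact: supported_cut|]].
Qed.

Lemma op_right K : {ae leb, forall x, ditv (right_half K) x ->
  op_val A (cut (ditv K) f) x = op_val A (cut (ditv (right_half K)) f) x +
    cross a K * mass f (ditv (left_half K))}.
Proof.
have := ae_op_cvg sa ba (mcut (right_half K)) (dcut (right_half K)) (@supported_cut _ _ _).
move=> H; apply: aeW H _ => x hx Kx; have [p hp] := hx Kx.
rewrite (op_valE hp) cut_halves addrC; apply: op_valE.
apply: op_cvgD; [exact: dcut|exact: dcut| |exact: hp].
rewrite -(@mass_cut_in (left_half K) (ditv (left_half K)))//.
rewrite -(mass_supported (@supported_cut _ _ f) (@ditv_left _ K)).
by apply: op_cvg_sibling => //; [exact: dcut|left; split; [exact: supported_cut|]].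
Qed.

End cut_facts.

Lemma mass_shift G G' nu (c : R) K : measurable_fun setT G -> measurable_fun setT G' ->
  pos_weight nu -> leb.-integrable (ditv K) (EFin \o (fun x => G' x * nu x)) ->
  {ae leb, forall x, ditv K x -> G x = G' x + c} ->
  leb.-integrable (ditv K) (EFin \o (fun x => G x * nu x)) /\
  mass (fun x => G x * nu x) (ditv K) =
    mass (fun x => G' x * nu x) (ditv K) + c * mass nu (ditv K).
Proof.
move=> mG mG' [mn inu _] iG' hG.
have mK := measurable_ditv K : measurable (ditv K : set R).
have i1 : leb.-integrable (ditv K) (EFin \o (fun x => G' x * nu x + c * nu x)).
  by apply: integrableRD => //; exact: integrableRZ.
have ae : {ae leb, forall x, ditv K x -> (G' x * nu x + c * nu x)%:E = (G x * nu x)%:E}.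
  by apply: aeW hG _ => x h /h ->; rewrite mulrDl.
have mGn : measurable_fun (ditv K) (fun x => (G x * nu x)%:E).
  by apply/measurable_EFinP; apply: measurable_funTS; exact: measurable_funM.
split; first by apply: ae_eq_integrable ae i1.
rewrite (massZ_on c (inu K)) /mass -RintegralD//; last exact: integrableRZ.
by congr fine; apply/esym; apply: ae_eq_int => //; have := measurable_int leb i1.
Qed.

Lemma sqr_shift_integrable G G' nu (c : R) K : measurable_fun setT G ->
  measurable_fun setT G' -> pos_weight nu ->
  leb.-integrable (ditv K) (EFin \o (fun x => G' x ^+ 2 * nu x)) ->
  {ae leb, forall x, ditv K x -> G x = G' x + c} ->
  leb.-integrable (ditv K) (EFin \o (fun x => G x ^+ 2 * nu x)).
Proof.
move=> mG mG' [mn inu np] iG' hG.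
have mK := measurable_ditv K : measurable (ditv K : set R).
have mX (F : R -> R) : measurable_fun setT F -> measurable_fun (ditv K) (fun x => (F x ^+ 2 * nu x)%:E).
  move=> mF; apply/measurable_EFinP; apply: measurable_funTS.
  by apply: measurable_funM => //; exact: measurable_funX.
have mGc : measurable_fun setT (fun x => G' x + c) by exact: measurable_funD.
apply: (@ae_eq_integrable _ _ (EFin \o (fun x => (G' x + c) ^+ 2 * nu x))) => //.
- exact: mX.
- by apply: aeW hG _ => x h /h /= ->.
have i1 := integrableRD mK (integrableRZ 2 mK iG') (integrableRZ (2 * c ^+ 2) mK (inu K)).
apply: (@le_integrable _ _ _ leb _ mK) i1; first exact: mX.
move=> x _ /=; rewrite lee_fin ger0_norm; last by rewrite mulr_ge0 ?sqr_ge0 ?ltW.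
apply: le_trans (ler_norm _); rewrite mulrA -mulrDl; apply: ler_wpM2r; first exact: ltW.
have := sqr_ge0 (G' x - c); nra.
Qed.

Definition tested mu nu (C : R) := forall K,
  (\int[leb]_(x in ditv K) (op_val A (cut (ditv K) mu) x ^+ 2 * nu x)%:E <=
   (C * mass mu (ditv K))%:E)%E.

(** The value of the bilinear form at the pair of indicators of [K]: the [beta] of
    [form]. *)
Definition pairing mu nu K := mass (fun x => op_val A (cut (ditv K) mu) x * nu x) (ditv K).

Section one_sided.
Variables (mu nu : R -> R) (C : R).
Hypotheses (wmu : pos_weight mu) (wnu : pos_weight nu) (C0 : 0 < C) (test : tested mu nu C).
Local Notation m K := (mass mu (ditv K)).
Local Notation mfun := (fun K => mass mu (ditv K)).
Local Notation n K := (mass nu (ditv K)).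
Local Notation nfun := (fun K => mass nu (ditv K)).
Local Notation T K := (op_val A (cut (ditv K) mu)).

Let mmu : measurable_fun setT mu. Proof. by case: wmu. Qed.
Let imu : dintegrable mu. Proof. by case: wmu. Qed.
Let mnu : measurable_fun setT nu. Proof. by case: wnu. Qed.
Let inu : dintegrable nu. Proof. by case: wnu. Qed.
Let nu0 x : 0 < nu x. Proof. by case: wnu. Qed.
Let mT f : measurable_fun setT (op_val A f). Proof. exact: measurable_haar_mult. Qed.

Lemma tested_integrable K : leb.-integrable (ditv K) (EFin \o (fun x => T K x ^+ 2 * nu x)).
Proof.
apply: (integrable_ge0 _ _ (test K)).
- apply: measurable_funTS; apply: measurable_funM => //; exact: measurable_funX.
- by move=> x _; rewrite mulr_ge0 ?sqr_ge0 ?ltW.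
Qed.

Lemma tested_mass K : mass (fun x => T K x ^+ 2 * nu x) (ditv K) <= C * m K.
Proof.
rewrite -lee_fin /mass -integral_EFinE//; first exact: measurable_ditv.
exact: tested_integrable.
Qed.

Lemma weighted_cs G K : measurable_fun setT G ->
  leb.-integrable (ditv K) (EFin \o (fun x => G x ^+ 2 * nu x)) ->
  leb.-integrable (ditv K) (EFin \o (fun x => G x * nu x)) /\
  mass (fun x => G x * nu x) (ditv K) ^+ 2 <=
    mass (fun x => G x ^+ 2 * nu x) (ditv K) * n K.
Proof.
move=> mG iG; apply: cauchy_schwarz => //; first exact: measurable_ditv.
  by apply: measurable_funTS; exact: measurable_funM.
move=> x _; split; [by rewrite mulr_ge0 ?sqr_ge0 ?ltW|exact: ltW|].
by rewrite exprMn [nu x ^+ 2]expr2 mulrA.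
Qed.

Lemma pairing_integrable K : leb.-integrable (ditv K) (EFin \o (fun x => T K x * nu x)).
Proof. exact: (weighted_cs (mT _) (tested_integrable K)).1. Qed.

Lemma pairing_le K : pairing mu nu K ^+ 2 <= C * (m K * n K).
Proof.
have [_ h] := weighted_cs (mT _) (tested_integrable K); apply: le_trans h _.
by rewrite mulrA ler_wpM2r ?tested_mass// ltW// mass_gt0.
Qed.

Lemma pairing_left K : leb.-integrable (ditv (left_half K)) (EFin \o (fun x => T K x * nu x)) /\
  mass (fun x => T K x * nu x) (ditv (left_half K)) =
  pairing mu nu (left_half K) + cross a K * m (right_half K) * n (left_half K).
Proof. exact: (mass_shift (mT _) (mT _) wnu (pairing_integrable _) (op_left mmu imu K)). Qed.

Lemma pairing_right K : leb.-integrable (ditv (right_half K)) (EFin \o (fun x => T K x * nu x)) /\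
  mass (fun x => T K x * nu x) (ditv (right_half K)) =
  pairing mu nu (right_half K) + cross a K * m (left_half K) * n (right_half K).
Proof. exact: (mass_shift (mT _) (mT _) wnu (pairing_integrable _) (op_right mmu imu K)). Qed.

Lemma pairing_split K : pairing mu nu K = pairing mu nu (left_half K) + pairing mu nu (right_half K) +
  cross a K * (m (left_half K) * n (right_half K) + m (right_half K) * n (left_half K)).
Proof.
rewrite {1}/pairing (mass_halves (fl := fun x => T K x * nu x) (fr := fun x => T K x * nu x))//.
  rewrite (pairing_left K).2 (pairing_right K).2.
  move: (pairing mu nu (left_half K)) (pairing mu nu (right_half K)) (cross a K).
  move: (m (left_half K)) (m (right_half K)) (n (left_half K)) (n (right_half K)) => *.
  by ring.
exact: pairing_integrable.
Qed.

(** On a subinterval [J] of [K], [T K] and [T J] differ by a constant, so that they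
    have the same coefficients along the [nu]-adapted Haar functions below [J]. *)
Definition shifted K J := ditv J `<=` (ditv K : set R) /\
  exists c, {ae leb, forall x, ditv J x -> T K x = T J x + c}.

Lemma shifted_halves K J : shifted K J -> shifted K (left_half J) /\ shifted K (right_half J).
Proof.
move=> [JK [c hc]]; split; split.
- by move=> x /ditv_left /JK.
- exists (cross a J * m (right_half J) + c).
  apply: aeW (aeI hc (op_left mmu imu J)) _ => x [h1 h2] Jx.
  by rewrite h1 ?h2// ?addrA//; exact: ditv_left.
- by move=> x /ditv_right /JK.
- exists (cross a J * m (left_half J) + c).
  apply: aeW (aeI hc (op_right mmu imu J)) _ => x [h1 h2] Jx.
  by rewrite h1 ?h2// ?addrA//; exact: ditv_right.
Qed.

(** The coefficient at [J] is defined with [T J], but it is also the jump of the fixed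
    function [T K], which differs from [T J] by a constant. So the sum is bounded, by
    Bessel's inequality, by the norm of [T K]. *)
Lemma carleson_testing d K :
  nodesum d (fun J => form_coef (pairing mu nu) (cross a) mfun nfun J ^+ 2 * jump_mass nfun J) K <= C * m K.
Proof.
have mK := measurable_ditv K : measurable (ditv K : set R).
pose Gn := cut (ditv K) (fun x => T K x * nu x).
have mTn : measurable_fun setT (fun x => T K x * nu x) by exact: measurable_funM.
have iG : dintegrable Gn by apply: dintegrable_cut => //; exact: pairing_integrable.
pose Gam J := mass Gn (ditv J).
have GamE J : shifted K J -> Gam J = mass (fun x => T K x * nu x) (ditv J).
  by move=> [JK _]; apply: mass_eq => x /JK h; rewrite /Gn cut_in.
have shK : shifted K K.
  by split => //; exists 0; apply: ae_all => x _; rewrite addr0.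
have n0 J : 0 < n J by exact: mass_gt0.
have jE J : shifted K J -> form_coef (pairing mu nu) (cross a) mfun nfun J = jump nfun Gam J.
  move=> sJ; have [sl sr] := shifted_halves sJ; rewrite /jump.
  case: sJ => [_ [c hc]].
  have hcl : {ae leb, forall x, ditv (left_half J) x -> T K x = T J x + c}.
    by apply: aeW hc _ => x h /ditv_left.
  have hcr : {ae leb, forall x, ditv (right_half J) x -> T K x = T J x + c}.
    by apply: aeW hc _ => x h /ditv_right.
  have eL := etrans (GamE _ sl) (mass_shift (mT _) (mT _) wnu (pairing_left J).1 hcl).2.
  have eR := etrans (GamE _ sr) (mass_shift (mT _) (mT _) wnu (pairing_right J).1 hcr).2.
  rewrite eL eR (pairing_left J).2 (pairing_right J).2 /form_coef.
  have nl := n0 (left_half J); have nr := n0 (right_half J); move: nl nr.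
  move: (pairing mu nu (left_half J)) (pairing mu nu (right_half J)) (cross a J).
  move: (m (left_half J)) (m (right_half J)) (n (left_half J)) (n (right_half J)).
  by move=> *; field; rewrite !gt_eqF.
rewrite (nodesum_eq_in (G := fun J => jump nfun Gam J ^+ 2 * jump_mass nfun J) _ (@shifted_halves K))//;
  last by move=> J sJ; rewrite jE.
have [h _] := ler_parseval d K n0 (additive_mass inu) (additive_mass iG).
apply: le_trans h _; apply: le_trans (tested_mass K).
pose G2 := cut (ditv K) (fun x => T K x ^+ 2 * nu x).
have mT2 : measurable_fun setT (fun x => T K x ^+ 2 * nu x).
  by apply: measurable_funM => //; exact: measurable_funX.
have iG2 : dintegrable G2 by apply: dintegrable_cut => //; exact: tested_integrable.
have e2 J : shifted K J -> mass G2 (ditv J) = mass (fun x => T K x ^+ 2 * nu x) (ditv J).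
  by move=> [JK _]; apply: mass_eq => x /JK h; rewrite /G2 cut_in.
rewrite -(e2 K shK) -(leafsum_additive d K (additive_mass iG2)).
apply: (@ler_leafsum_in _ _ _ _ (shifted K) d _ _ K (@shifted_halves K) _ shK) => J sJ.
rewrite ler_pdivrMr// -[mass Gn _]/(Gam J) GamE// e2//; apply: (weighted_cs (mT _) _).2.
case: sJ => JK _; apply: (@integrableS _ _ _ leb (ditv K)) (tested_integrable K) => //.
exact: measurable_ditv.
Qed.

End one_sided.

End operator.

End testing_to_form.

Section form_to_bound.
Context {R : realType}.
Local Notation leb := (@lebesgue_measure R).
Implicit Types (x y : R) (J K L : dyadic) (f g G : R -> R).
Local Notation nodesum := (nodesum left_half right_half).
Local Notation leafsum := (leafsum left_half right_half).
Local Notation tree_additive := (tree_additive left_half right_half).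
Local Notation jump := (jump left_half right_half).
Local Notation jump_mass := (jump_mass left_half right_half).
Local Notation form_coef := (form_coef left_half right_half).
Local Notation form := (form left_half right_half).

Lemma integrable_from_halves f K : measurable_fun setT f ->
  leb.-integrable (ditv (left_half K)) (EFin \o f) ->
  leb.-integrable (ditv (right_half K)) (EFin \o f) -> leb.-integrable (ditv K) (EFin \o f).
Proof.
move=> mf /integrableP[_ h1] /integrableP[_ h2].
have mfa E : measurable_fun E (fun x => `|f x|%:E).
  by apply/measurable_EFinP; apply: measurable_funTS; apply: measurableT_comp.
apply/integrableP; split; first by apply/measurable_EFinP; exact: measurable_funTS.
have -> : ditv K = ditv (left_half K) `|` ditv (right_half K) :> set R by exact: ditv_halves.
rewrite ge0_integral_setU//; try exact: measurable_ditv; last first.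
- by apply/disj_setPS => x [h h']; exact: ditv_halves_disj h h'.
- exact: mfa.
exact: lte_add_pinfty.
Qed.

Section weight_steps.
Variable w : R -> R.
Hypothesis ww : pos_weight w.

Definition weight_step (c : dyadic -> R) K N x : R := c (cell (K.1 + N%:Z) x) * w x.

Lemma measurable_weight_step c K N : measurable_fun setT (weight_step c K N).
Proof.
case: ww => mw _ _; apply: measurable_funM => //.
by apply: (@measurable_at_cell _ (fun L => cst (c L))) => L; exact: measurable_cst.
Qed.

Lemma mass_weight_step c K N :
  leb.-integrable (ditv K) (EFin \o weight_step c K N) /\
  mass (weight_step c K N) (ditv K) = leafsum N (fun L => c L * mass w (ditv L)) K.
Proof.
have [mw iw _] := ww.
elim: N K => [|N IH] K.
  have e x : ditv K x -> weight_step c K 0 x = c K * w x.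
    by move=> Kx; rewrite /weight_step addr0 -(cellE Kx).
  have i1 := integrableRZ (c K) (measurable_ditv K) (iw K).
  split; last by rewrite (mass_eq e) -massZ_on.
  apply: (@ae_eq_integrable _ _ (EFin \o (fun x => c K * w x))) i1.
  - exact: measurable_ditv.
  - by apply/measurable_EFinP; apply: measurable_funTS; exact: measurable_weight_step.
  - by apply: ae_all => x /e /= ->.
have el x : ditv (left_half K) x -> weight_step c K N.+1 x = weight_step c (left_half K) N x.
  by move=> _; rewrite /weight_step (_ : K.1 + N.+1%:Z = (left_half K).1 + N%:Z)//=; lia.
have er x : ditv (right_half K) x -> weight_step c K N.+1 x = weight_step c (right_half K) N x.
  by move=> _; rewrite /weight_step (_ : K.1 + N.+1%:Z = (right_half K).1 + N%:Z)//=; lia.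
have [il hl] := IH (left_half K); have [ir hr] := IH (right_half K).
have iK : leb.-integrable (ditv K) (EFin \o weight_step c K N.+1).
  apply: integrable_from_halves; first exact: measurable_weight_step.
  - apply: (@ae_eq_integrable _ _ (EFin \o weight_step c (left_half K) N)) il.
    + exact: measurable_ditv.
    + by apply/measurable_EFinP; apply: measurable_funTS; exact: measurable_weight_step.
    + by apply: ae_all => x /el /= ->.
  - apply: (@ae_eq_integrable _ _ (EFin \o weight_step c (right_half K) N)) ir.
    + exact: measurable_ditv.
    + by apply/measurable_EFinP; apply: measurable_funTS; exact: measurable_weight_step.
    + by apply: ae_all => x /er /= ->.
by split => //; rewrite (mass_halves iK el er) hl hr.
Qed.

End weight_steps.

Section two_sided.
Variables (a : dyadic -> R) (mu nu : R -> R) (C : R).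
Hypotheses (sa : summable_tails a) (ba : locally_bounded (R := R) a).
Hypotheses (wmu : pos_weight mu) (wnu : pos_weight nu) (C1 : 1 <= C).
Hypotheses (test : tested a mu nu C) (test' : tested a nu mu C).
Local Notation A := (haar_mult (R := R) a).
Local Notation m K := (mass mu (ditv K)).
Local Notation n K := (mass nu (ditv K)).
Local Notation mfun := (fun K => mass mu (ditv K)).
Local Notation nfun := (fun K => mass nu (ditv K)).
Local Notation beta := (pairing a mu nu).
Hypothesis kap : forall K, cross a K ^+ 2 * (m (left_half K) * n (right_half K)) <= C ^+ 2.

Let C0 : 0 < C. Proof. exact: lt_le_trans C1. Qed.
Let mmu : measurable_fun setT mu. Proof. by case: wmu. Qed.
Let imu : dintegrable mu. Proof. by case: wmu. Qed.
Let mnu : measurable_fun setT nu. Proof. by case: wnu. Qed.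
Let inu : dintegrable nu. Proof. by case: wnu. Qed.
Let mT f : measurable_fun setT (op_val A f). Proof. exact: measurable_haar_mult. Qed.
Let m0 K : 0 < m K. Proof. exact: mass_gt0. Qed.
Let n0 K : 0 < n K. Proof. exact: mass_gt0. Qed.

(** The pairings [beta] and [beta'] of the two testing conditions are formally
    adjoint, but the series only converges almost everywhere. Their difference
    is additive and at most [2 (C m n)^(1/2)]: this is enough to carry the Carleson
    condition over from [beta'] to [beta]. *)
Lemma carleson_dual d K :
  nodesum d (fun J => form_coef beta (cross a) nfun mfun J ^+ 2 * jump_mass mfun J) K <= 10 * C * n K.
Proof.
pose P J := beta J - pairing a nu mu J.
have aP : tree_additive P.
  move=> J; rewrite /P (pairing_split sa ba wmu wnu test) (pairing_split sa ba wnu wmu test').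
  move: (pairing _ _ _ (left_half J)) (pairing _ _ _ (right_half J)) (cross a J).
  move: (pairing _ _ _ (left_half J)) (pairing _ _ _ (right_half J)).
  move: (m (left_half J)) (m (right_half J)) (n (left_half J)) (n (right_half J)) => *.
  by ring.
have P2 J : P J ^+ 2 <= 4 * C * (m J * n J).
  have h1 := pairing_le wnu test J; have h2 := pairing_le wmu test' J.
  rewrite (mulrC (n J)) in h2.
  rewrite /P; move: (beta J) (pairing a nu mu J) (m J * n J) h1 h2 => b b' X h1 h2.
  have := sqr_ge0 (b + b'); rewrite -(mulrA 4); move: (C * X) h1 h2 => Y; nra.
have e J : form_coef beta (cross a) nfun mfun J =
    form_coef (pairing a nu mu) (cross a) nfun mfun J + jump mfun P J.
  have alg (b1 b2 p1 p2 q1 q2 k z : R) : b1 / q1 - b2 / q2 + k * z =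
    (p1 / q1 - p2 / q2 + k * z) + ((b1 - p1) / q1 - (b2 - p2) / q2) by ring.
  exact: alg.
have jm0 J : 0 <= jump_mass mfun J := jump_mass_ge0 left_half right_half J m0.
have h1 := carleson_testing sa ba wnu wmu test' d K.
have [h2 _] := ler_parseval d K m0 (additive_mass imu) aP.
have h3 : leafsum d (fun J => P J ^+ 2 / m J) K <= 4 * C * n K.
  rewrite -(leafsum_additive d K (additive_mass inu)) -leafsumZ.
  by apply: ler_leafsum => J; rewrite ler_pdivrMr// -mulrA (mulrC (n J)); exact: P2.
have h4 : nodesum d (fun J => form_coef beta (cross a) nfun mfun J ^+ 2 * jump_mass mfun J) K <=
    nodesum d (fun J => 2 * (form_coef (pairing a nu mu) (cross a) nfun mfun J ^+ 2 * jump_mass mfun J)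
      + 2 * (jump mfun P J ^+ 2 * jump_mass mfun J)) K.
  have alg (x y w : R) : 0 <= w -> (x + y) ^+ 2 * w <= 2 * (x ^+ 2 * w) + 2 * (y ^+ 2 * w).
    by move=> w0; have := mulr_ge0 w0 (sqr_ge0 (x - y)); lra.
  by apply: ler_nodesum => J; rewrite e; apply: alg.
apply: le_trans h4 _; rewrite nodesumD !nodesumZ.
move: h1 h2 h3; set X := nodesum _ _ _; set Y := nodesum _ _ _; set Z := leafsum _ _ _.
by rewrite -!mulrA; move: (C * n K) => V; lra.
Qed.

Lemma two_weight_form d (F G : dyadic -> R) K : tree_additive F -> tree_additive G ->
  `|form mfun nfun beta (cross a) d F G K| <= (1 + 50 * C) *
    (leafsum d (fun J => F J ^+ 2 / m J) K + leafsum d (fun J => G J ^+ 2 / n J) K).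
Proof.
move=> aF aG; have -> : 1 + 50 * C = 1 + 5 * (10 * C) by ring.
have C10 : 0 < 10 * C by rewrite mulr_gt0.
apply: form_bound => //.
- exact: additive_mass.
- exact: additive_mass.
- by move=> J; exact: (pairing_split sa ba wmu wnu test).
- move=> J; apply: le_trans (pairing_le wnu test J) _.
  by rewrite ler_wpM2r// ?mulr_ge0 ?ltW//; have := C1; nra.
- by move=> J; apply: le_trans (kap J) _; have := C1; nra.
- move=> k J; apply: le_trans (carleson_testing sa ba wmu wnu test k J) _.
  by rewrite ler_wpM2r ?ltW//; have := C0; lra.
- exact: carleson_dual.
Qed.

(** [f] is [mu] times a step function, constant on the intervals [d] generations below
    [K]. *)
Fixpoint multiple_below d f K : Prop :=
  if d is d'.+1 then multiple_below d' f (left_half K) /\ multiple_below d' f (right_half K)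
  else exists c, forall x, ditv K x -> f x = c * mu x.

Section step_function.
Variable f : R -> R.
Hypotheses (mf : measurable_fun setT f) (hf : dintegrable f).
Local Notation S K := (op_val A (cut (ditv K) f)).

Lemma op_multiple c K : (forall x, ditv K x -> f x = c * mu x) ->
  {ae leb, forall x, ditv K x -> S K x = c * op_val A (cut (ditv K) mu) x}.
Proof.
move=> fE; have -> : cut (ditv K) f = (fun x => c * cut (ditv K) mu x).
  apply/funext => x; have [Kx|Kx] := pselect (ditv K x); first by rewrite !cut_in// fE.
  by rewrite !cut_out// mulr0.
have := ae_op_cvg sa ba (mcut mmu K) (dcut mmu imu K) (@supported_cut _ _ _).
move=> H; apply: aeW H _ => x hx Kx; have [p hp] := hx Kx.
by rewrite (op_valE hp); apply: op_valE; apply: op_cvgZ => //; exact: dcut.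
Qed.

Let mS2 K D : measurable_fun D (EFin \o (fun x => S K x ^+ 2 * nu x)).
Proof.
apply/measurable_EFinP; apply: measurable_funTS; apply: measurable_funM => //.
by apply: measurable_funX; exact: mT.
Qed.

Lemma step_integrable d K : multiple_below d f K ->
  leb.-integrable (ditv K) (EFin \o (fun x => S K x ^+ 2 * nu x)).
Proof.
elim: d K => [|d IH] K /=.
  move=> [c fE]; have mK := measurable_ditv K : measurable (ditv K : set R).
  have i1 := integrableRZ (c ^+ 2) mK (tested_integrable wnu test K).
  apply: (@ae_eq_integrable _ (ditv K) _ _ mK) i1; first exact: mS2.
  by apply: aeW (op_multiple fE) _ => x h /h /= ->; rewrite exprMn mulrA.
move=> [/IH hl /IH hr]; apply: integrable_from_halves.
- by apply/measurable_EFinP; exact: mS2.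
- exact: (sqr_shift_integrable (mT _) (mT _) wnu hl (op_left sa ba mf hf K)).
- exact: (sqr_shift_integrable (mT _) (mT _) wnu hr (op_right sa ba mf hf K)).
Qed.

Lemma step_integrable1 d K : multiple_below d f K ->
  leb.-integrable (ditv K) (EFin \o (fun x => S K x * nu x)).
Proof. by move=> /step_integrable h; exact: (weighted_cs wnu (mT _) h).1. Qed.

Lemma multiple_below0 K : multiple_below 0 f K ->
  multiple_below 0 f (left_half K) /\ multiple_below 0 f (right_half K).
Proof.
move=> [c fE]; split; exists c => x hx; apply: fE; first exact: ditv_left.
exact: ditv_right.
Qed.

(** The abstract form on the tree is the integral of the operator against a step
    function. The cross terms come from passing from an interval to one of its halves,
    which changes the operator by a constant. *)
Lemma step_form d N (G : dyadic -> R) K : (d <= N)%N -> multiple_below d f K -> tree_additive G ->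
  leafsum N (fun L => G L / n L * mass (fun x => S K x * nu x) (ditv L)) K =
  form mfun nfun beta (cross a) N (fun L => mass f (ditv L)) G K.
Proof.
move=> dN sf aG; elim: N d K dN sf => [|N IH] d K dN sf.
  move: dN; rewrite leqn0 => /eqP d0; move: sf; rewrite d0 => -[c fE] /=.
  have -> : mass (fun x => S K x * nu x) (ditv K) = c * beta K.
    rewrite /pairing massZ_on; last exact: (pairing_integrable wnu test).
    congr fine; apply: ae_eq_int.
    - exact: measurable_ditv.
    - apply/measurable_EFinP; apply: measurable_funTS.
      by apply: measurable_funM => //; exact: mT.
    - apply/measurable_EFinP; apply: measurable_funTS; apply: measurable_funM => //.
      by apply: measurable_funM => //; exact: mT.
    - by apply: aeW (op_multiple fE) _ => x h /h ->; rewrite mulrA.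
  have -> : mass f (ditv K) = c * m K by rewrite (mass_eq fE) -massZ_on.
  have := m0 K; have := n0 K; move: (m K) (n K) (beta K) (G K) => p q b g q0 p0.
  by field; rewrite !gt_eqF.
have [d' [dN' [sl sr]]] : exists d', (d' <= N)%N /\
    multiple_below d' f (left_half K) /\ multiple_below d' f (right_half K).
  case: d dN sf => [|d] dN sf; last by exists d.
  by exists 0%N; split => //; exact: multiple_below0.
have half K' k : (K' = left_half K \/ K' = right_half K) -> multiple_below d' f K' ->
    {ae leb, forall x, ditv K' x -> S K x = S K' x + k} ->
    leafsum N (fun L => G L / n L * mass (fun x => S K x * nu x) (ditv L)) K' =
    form mfun nfun beta (cross a) N (fun L => mass f (ditv L)) G K' + k * G K'.
  move=> _ sK' hk; rewrite -(IH _ _ dN' sK') -[in k * G K'](leafsum_additive N K' aG) -leafsumZ -leafsumD.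
  apply: (@leafsum_eq_in _ _ _ _ (fun L => ditv L `<=` (ditv K' : set R))) => //.
    by move=> L LK; split => x; [move/ditv_left|move/ditv_right]; exact: LK.
  move=> L LK; have mL := measurable_ditv L : measurable (ditv L : set R).
  have iL : leb.-integrable (ditv L) (EFin \o (fun x => S K' x * nu x)).
    apply: (@integrableS _ _ _ leb (ditv K')) (step_integrable1 sK') => //.
    exact: measurable_ditv.
  have hL : {ae leb, forall x, ditv L x -> S K x = S K' x + k} by apply: aeW hk _ => x h /LK.
  apply: etrans (congr1 (fun z => G L / n L * z) (mass_shift (mT _) (mT _) wnu iL hL).2) _.
  rewrite mulrDr; congr (_ + _).
  by have := n0 L; move: (n L) (G L) => q g q0; field; rewrite gt_eqF.
rewrite [leafsum _ _ _]/= [form _ _ _ _ _ _ _ _]/=.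
rewrite (half _ _ (or_introl erefl) sl (op_left sa ba mf hf K)).
rewrite (half _ _ (or_intror erefl) sr (op_right sa ba mf hf K)).
move: (form _ _ _ _ _ _ _ (left_half K)) (form _ _ _ _ _ _ _ (right_half K)) (cross a K) (G (left_half K)) (G (right_half K)).
by move: (mass f (ditv (left_half K))) (mass f (ditv (right_half K))) => *; ring.
Qed.

End step_function.

End two_sided.
End form_to_bound.

Section cell_bound.
Context {R : realType}.
Local Notation leb := (@lebesgue_measure R).
Implicit Types (x y : R) (J K L : dyadic) (f g G : R -> R).
Local Notation leafsum := (leafsum left_half right_half).
Local Notation tree_additive := (tree_additive left_half right_half).
Local Notation form := (form left_half right_half).

Lemma cut_supported (D : set R) f : supported f D -> cut D f = f.
Proof.
move=> sf; apply/funext => x; have [Dx|Dx] := pselect (D x); first by rewrite cut_in.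
by rewrite cut_out// sf.
Qed.

Lemma halves_sub K L : ditv L `<=` (ditv K : set R) ->
  ditv (left_half L) `<=` (ditv K : set R) /\ ditv (right_half L) `<=` (ditv K : set R).
Proof. by move=> LK; split=> x; [move/ditv_left|move/ditv_right]; exact: LK. Qed.

Variables (a : dyadic -> R) (mu nu : R -> R) (C : R).
Hypotheses (sa : summable_tails a) (ba : locally_bounded (R := R) a).
Hypotheses (wmu : pos_weight mu) (wnu : pos_weight nu) (C1 : 1 <= C).
Hypotheses (test : tested a mu nu C) (test' : tested a nu mu C).
Local Notation A := (haar_mult (R := R) a).
Local Notation m K := (mass mu (ditv K)).
Local Notation n K := (mass nu (ditv K)).
Hypothesis kap : forall K, cross a K ^+ 2 * (m (left_half K) * n (right_half K)) <= C ^+ 2.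

Let mmu : measurable_fun setT mu. Proof. by case: wmu. Qed.
Let imu : dintegrable mu. Proof. by case: wmu. Qed.
Let mnu : measurable_fun setT nu. Proof. by case: wnu. Qed.
Let inu : dintegrable nu. Proof. by case: wnu. Qed.
Let mu0 x : 0 < mu x. Proof. by case: wmu. Qed.
Let nu0 x : 0 < nu x. Proof. by case: wnu. Qed.
Let mT f : measurable_fun setT (op_val A f). Proof. exact: measurable_haar_mult. Qed.
Let m0 K : 0 < m K. Proof. exact: mass_gt0. Qed.
Let n0 K : 0 < n K. Proof. exact: mass_gt0. Qed.

(** The density of the squared norm of [L^2(mu^-1)], the space that multiplication by
    [mu] identifies with [L^2(mu)]. *)
Definition energy f x := f x ^+ 2 * (mu x)^-1.

Lemma measurable_inv_weight : measurable_fun setT (fun x => (mu x)^-1).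
Proof.
have -> : (fun x => (mu x)^-1) = (fun x => mu x `^ (-1)).
  by apply/funext => x; rewrite powR_inv1// ltW.
exact: (measurableT_comp (measurable_powR _) mmu).
Qed.

Lemma measurable_energy f : measurable_fun setT f -> measurable_fun setT (energy f).
Proof.
move=> mf; apply: measurable_funM; first exact: measurable_funX.
exact: measurable_inv_weight.
Qed.

Lemma energy_cs f K : measurable_fun setT f -> leb.-integrable (ditv K) (EFin \o energy f) ->
  leb.-integrable (ditv K) (EFin \o f) /\
  mass f (ditv K) ^+ 2 / m K <= mass (energy f) (ditv K).
Proof.
move=> mf ie; have mK := measurable_ditv K : measurable (ditv K : set R).
have [|i h] := cauchy_schwarz mK (measurable_funTS mf) ie (imu K).
  move=> x _; rewrite /energy; split; [|exact: ltW|].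
    by rewrite mulr_ge0 ?sqr_ge0// invr_ge0 ltW.
  by rewrite mulfVK ?gt_eqF.
by split => //; rewrite ler_pdivrMr.
Qed.

Lemma leaf_energy f d K : measurable_fun setT f ->
  leb.-integrable (ditv K) (EFin \o energy f) ->
  leafsum d (fun L => mass f (ditv L) ^+ 2 / m L) K <= mass (energy f) (ditv K).
Proof.
move=> mf ie; have mK := measurable_ditv K : measurable (ditv K : set R).
pose E := cut (ditv K) (energy f).
have iE : dintegrable E by apply: dintegrable_cut => //; exact: measurable_energy.
rewrite -(@mass_cut_in _ (energy f) K (ditv K))// -(leafsum_additive d K (additive_mass iE)).
apply: (@ler_leafsum_in _ _ _ _ (fun L => ditv L `<=` (ditv K : set R)) d _ _ K (@halves_sub K)) => //.
move=> L LK; rewrite (@mass_cut_in _ _ L)//; apply: (energy_cs mf _).2.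
by apply: (@integrableS _ _ _ leb (ditv K)) ie => //; exact: measurable_ditv.
Qed.

Lemma multiple_belowP c g d K :
  (forall x, ditv K x -> g x = c (cell (K.1 + d%:Z) x) * mu x) -> multiple_below mu d g K.
Proof.
elim: d K => [|d IH] K gE /=.
  by exists (c K) => x Kx; rewrite gE// addr0 -(cellE Kx).
split; apply: IH => x hx.
  by rewrite gE; [congr (c (cell _ x) * _) => /=; lia|exact: ditv_left].
by rewrite gE; [congr (c (cell _ x) * _) => /=; lia|exact: ditv_right].
Qed.

Let c2 : R := 4 * (1 + 50 * C) ^+ 2.

(** The bound for step functions: testing the form against the averages of the
    function [G] itself bounds the energy of these averages, hence of [G]. *)
Lemma step_bound g d K (Q : R) : measurable_fun setT g -> dintegrable g ->
  supported g (ditv K) -> multiple_below mu d g K ->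
  leb.-integrable (ditv K) (EFin \o energy g) -> mass (energy g) (ditv K) <= Q ->
  (\int[leb]_(x in ditv K) (op_val A g x ^+ 2 * nu x)%:E <= (c2 * Q)%:E)%E.
Proof.
move=> mg hg sg stg ieg gQ; have mK := measurable_ditv K : measurable (ditv K : set R).
pose G := op_val A g.
have mG : measurable_fun setT G by exact: mT.
have eG : G = op_val A (cut (ditv K) g) by rewrite cut_supported.
have iGn : leb.-integrable (ditv K) (EFin \o (fun x => G x * nu x)).
  by rewrite eG; exact: (step_integrable1 sa ba wmu wnu test mg hg stg).
have mGn : measurable_fun setT (fun x => G x * nu x) by exact: measurable_funM.
pose Gn := cut (ditv K) (fun x => G x * nu x).
have dGn : dintegrable Gn by exact: dintegrable_cut.
pose Psi L := mass Gn (ditv L).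
have aPsi : tree_additive Psi by exact: additive_mass.
pose E N := leafsum N (fun L => Psi L ^+ 2 / n L) K.
have E0 N : 0 <= E N.
  by apply: le_trans (ler_parseval N K n0 (additive_mass inu) aPsi).2; rewrite divr_ge0 ?sqr_ge0 ?ltW.
have EQ N : (d <= N)%N -> E N <= c2 * Q.
  move=> dN; pose c := 1 + 50 * C; have c0 : 0 < c by rewrite ltr_wpDr// mulr_ge0// (le_trans ler01).
  (* The form is linear in the test function and its bound is quadratic: scaling it
     by [s] lets the energy of the averages be absorbed. *)
  pose s := (2 * c)^-1.
  have s0 : 0 < s by rewrite invr_gt0 mulr_gt0.
  pose sPsi L := s * Psi L.
  have asPsi : tree_additive sPsi by move=> L; rewrite /sPsi aPsi mulrDr.
  have := two_weight_form sa ba wmu wnu C1 test test' kap N K (additive_mass hg) asPsi.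
  have := step_form sa ba wmu wnu test mg hg dN stg asPsi => <-.
  have -> : leafsum N (fun L => sPsi L / n L *
      mass (fun x => op_val A (cut (ditv K) g) x * nu x) (ditv L)) K = s * E N.
    rewrite -leafsumZ.
    apply: (@leafsum_eq_in _ _ _ _ (fun L => ditv L `<=` (ditv K : set R)) N _ _ K (@halves_sub K)) => //.
    move=> L LK; rewrite /sPsi -eG -(@mass_cut_in _ (fun x => G x * nu x) L (ditv K))// -/Gn -/(Psi L).
    by rewrite expr2; ring.
  have -> : leafsum N (fun J => sPsi J ^+ 2 / n J) K = s ^+ 2 * E N.
    by rewrite -leafsumZ; apply: leafsum_eq => L; rewrite /sPsi exprMn -mulrA.
  have EF := le_trans (leaf_energy N mg ieg) gQ.
  rewrite (ger0_norm (mulr_ge0 (ltW s0) (E0 N))) -/c; move: EF; set e1 := leafsum _ _ _ => EF h.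
  have {}h : s * E N <= c * (Q + s ^+ 2 * E N).
    by apply: le_trans h _; rewrite ler_pM2l// lerD2r.
  have sc : s * c = 2^-1 by rewrite /s; field; rewrite gt_eqF.
  have h1 : c * (s ^+ 2 * E N) = 2^-1 * (s * E N).
    by rewrite (_ : c * _ = (s * c) * (s * E N)); [rewrite sc|ring].
  have h2 : 2^-1 * (s * E N) <= c * Q by move: h; rewrite mulrDr h1; lra.
  have h3 : E N = 4 * c * (2^-1 * (s * E N)).
    by rewrite (_ : 4 * c * _ = 2 * (s * c) * E N); [rewrite sc; field|field].
  rewrite h3 /c2 -/c; apply: le_trans (ler_wpM2l _ h2) _; first by rewrite mulr_ge0// ltW.
  by rewrite le_eqVlt; apply/orP; left; apply/eqP; ring.
pose W := weight_step nu (fun L => (Psi L / n L) ^+ 2) K.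
apply: (@fatou_le _ _ (fun N => W (N + d)%N)) => //.
- by move=> N; apply: measurable_funTS; exact: measurable_weight_step.
- by apply: measurable_funTS; apply: measurable_funM => //; exact: measurable_funX.
- by move=> N x _; rewrite /W /weight_step mulr_ge0 ?sqr_ge0 ?ltW.
- have mcG : measurable_fun setT Gn by exact: measurable_cut.
  apply: aeW (aeI (dyadic_lebesgue_from K.1 mcG dGn) (dyadic_lebesgue_from K.1 mnu inu)) _.
  move=> x [h1 h2] Kx; rewrite /W /weight_step.
  apply: cvgM; last exact: cvg_cst.
  have h : Psi (cell (K.1 + N%:Z) x) / n (cell (K.1 + N%:Z) x) @[N --> \oo] --> G x.
    have : (mass Gn (ditv (cell (K.1 + N%:Z) x)) / len (cell (K.1 + N%:Z) x)) *
        (n (cell (K.1 + N%:Z) x) / len (cell (K.1 + N%:Z) x))^-1 @[N --> \oo] --> Gn x * (nu x)^-1.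
      by apply: cvgM => //; apply: cvgV => //; rewrite gt_eqF.
    have -> : Gn x * (nu x)^-1 = G x by rewrite /Gn cut_in// mulfK ?gt_eqF.
    apply: cvg_trans; apply: near_eq_cvg; apply: nearW => N.
    have := n0 (cell (K.1 + N%:Z) x); have := len_gt0 (cell (K.1 + N%:Z) x) : 0 < _ :> R.
    rewrite /Psi; move: (mass Gn _) (n _) (len _) => p q z z0 q0.
    by field; rewrite !gt_eqF.
  rewrite expr2; apply: (@cvgM _ _ _ _ (fun N => Psi (cell (K.1 + (N + d)%:Z) x) / n (cell (K.1 + (N + d)%:Z) x))
    (fun N => Psi (cell (K.1 + (N + d)%:Z) x) / n (cell (K.1 + (N + d)%:Z) x)));
    exact: (cvg_comp (fun N => (N + d)%N) (fun N : nat => Psi (cell (K.1 + N%:Z) x) / n (cell (K.1 + N%:Z) x)) (cvg_addnr d) h).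
- move=> N; have [iW hW] := mass_weight_step wnu (fun L => (Psi L / n L) ^+ 2) K (N + d).
  rewrite (integral_EFinE mK iW) lee_fin -/(mass _ _) hW.
  apply: le_trans (EQ (N + d)%N (leq_addl _ _)); rewrite le_eqVlt; apply/orP; left; apply/eqP.
  apply: leafsum_eq => L; have := n0 L; move: (n L) (Psi L) => q p q0.
  by field; rewrite gt_eqF.
Qed.

(** A function bounded by a multiple of the weight is approximated by the step
    functions with the same integrals on small dyadic intervals. *)
Lemma bounded_ratio_bound f K (M : R) : measurable_fun setT f -> supported f (ditv K) ->
  (forall x, `|f x| <= M * mu x) ->
  (\int[leb]_(x in ditv K) (op_val A f x ^+ 2 * nu x)%:E <=
    (c2 * mass (energy f) (ditv K))%:E)%E.
Proof.
move=> mf sf fM; have mK := measurable_ditv K : measurable (ditv K : set R).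
have M0 : 0 <= M.
  by have := le_trans (normr_ge0 _) (fM 0); rewrite pmulr_lge0.
have dom g : measurable_fun setT g -> (forall x, `|g x| <= M * mu x) -> dintegrable g.
  move=> mg gM J; have mJ := measurable_ditv J : measurable (ditv J : set R).
  apply: (@le_integrable _ _ _ leb _ mJ) (integrableRZ M mJ (imu J)).
    by apply/measurable_EFinP; exact: measurable_funTS.
  by move=> x _ /=; rewrite lee_fin (le_trans (gM x))// ler_norm.
have ie g : measurable_fun setT g -> (forall x, `|g x| <= M * mu x) ->
    leb.-integrable (ditv K) (EFin \o energy g).
  move=> mg gM; apply: (@le_integrable _ _ _ leb _ mK) (integrableRZ (M ^+ 2) mK (imu K)).
    by apply/measurable_EFinP; apply: measurable_funTS; exact: measurable_energy.
  move=> x _ /=; rewrite lee_fin; apply: le_trans (ler_norm _).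
  rewrite ger0_norm /energy; last by rewrite mulr_ge0 ?sqr_ge0// invr_ge0 ltW.
  rewrite ler_pdivrMr// -mulrA -expr2 -exprMn -real_normK ?num_real//.
  by apply: lerXn2r; rewrite ?nnegrE// mulr_ge0// ltW.
have hf := dom f mf fM.
pose c L := mass f (ditv L) / m L.
have cM L : `|c L| <= M.
  rewrite /c normrM normfV (gtr0_norm (m0 L)) ler_pdivrMr//.
  apply: le_trans (le_norm_mass (hf L)) _; rewrite -massZ//.
  by apply: le_mass; [exact: integrable_norm|exact: dintegrableZ|move=> x _; exact: fM].
pose g N := cut (ditv K) (weight_step mu c K N).
have mg N : measurable_fun setT (g N).
  by apply: measurable_cut => //; exact: measurable_weight_step.
have gM N x : `|g N x| <= M * mu x.
  have [Kx|Kx] := pselect (ditv K x); last by rewrite /g cut_out// normr0 mulr_ge0// ltW.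
  by rewrite /g cut_in// /weight_step normrM (gtr0_norm (mu0 x)) ler_pM2r.
apply: (@op_bound_closed _ a K sa ba g f (fun x => M * mu x)).
- exact: measurable_funM.
- exact: dintegrableZ.
- by move=> x; rewrite mulr_ge0// ltW.
- exact: mg.
- exact: mf.
- by move=> N; exact: supported_cut.
- exact: sf.
- exact: gM.
- exact: fM.
- apply: (@dominated_L1 _ _ _ _ (fun x => M * mu x)) => //.
  + by move=> N; exact: measurable_funTS.
  + exact: measurable_funTS.
  + exact: integrableRZ.
  + apply: aeW (aeI (dyadic_lebesgue_from K.1 mf hf) (dyadic_lebesgue_from K.1 mmu imu)) _.
    move=> x [h1 h2] Kx; rewrite /g; under eq_cvg do rewrite cut_in// /weight_step.
    have -> : f x = f x * (mu x)^-1 * mu x by rewrite mulfVK ?gt_eqF.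
    apply: cvgM; last exact: cvg_cst.
    have : (mass f (ditv (cell (K.1 + N%:Z) x)) / len (cell (K.1 + N%:Z) x)) *
        (m (cell (K.1 + N%:Z) x) / len (cell (K.1 + N%:Z) x))^-1 @[N --> \oo] --> f x * (mu x)^-1.
      by apply: cvgM => //; apply: cvgV => //; rewrite gt_eqF.
    apply: cvg_trans; apply: near_eq_cvg; apply: nearW => N.
    have := m0 (cell (K.1 + N%:Z) x); have := len_gt0 (cell (K.1 + N%:Z) x) : 0 < _ :> R.
    rewrite /c; move: (mass f _) (m _) (len _) => p q z z0 q0.
    by field; rewrite !gt_eqF.
- exact: mnu.
- by move=> x; rewrite ltW.
- move=> N; apply: (@step_bound (g N) N K) => //.
  + exact: dom.
  + exact: supported_cut.
  + by apply: (@multiple_belowP c) => x Kx; rewrite /g cut_in.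
  + exact: ie.
  + have [iW hW] := mass_weight_step wmu (fun L => c L ^+ 2) K N.
    have -> : mass (energy (g N)) (ditv K) = mass (weight_step mu (fun L => c L ^+ 2) K N) (ditv K).
      apply: mass_eq => x Kx; rewrite /energy /g cut_in// /weight_step exprMn.
      by have := mu0 x; move: (mu x) => z z0; field; rewrite gt_eqF.
    rewrite hW; apply: le_trans (leaf_energy N mf (ie f mf fM)).
    rewrite le_eqVlt; apply/orP; left; apply/eqP; apply: leafsum_eq => L.
    by rewrite /c; have := m0 L; move: (m L) (mass f _) => q p q0; field; rewrite gt_eqF.
Qed.

(** Truncation where [f] is bounded by a multiple of the weight. *)
Lemma cell_bound f K : measurable_fun setT f -> supported f (ditv K) ->
  leb.-integrable (ditv K) (EFin \o energy f) ->
  (\int[leb]_(x in ditv K) (op_val A f x ^+ 2 * nu x)%:E <=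
    (c2 * mass (energy f) (ditv K))%:E)%E.
Proof.
move=> mf sf ief; have mK := measurable_ditv K : measurable (ditv K : set R).
have [iK _] := energy_cs mf ief.
have hf : dintegrable f by rewrite -(cut_supported sf); exact: dintegrable_cut.
pose D N := [set x | `|f x| <= N%:R * mu x].
have mD N : measurable (D N).
  rewrite -[X in measurable X]setTI.
  apply: (measurable_fun_le measurableT); first exact: measurableT_comp.
  exact: measurable_funM.
pose g N := cut (D N) f.
have mg N : measurable_fun setT (g N) by exact: measurable_cut.
have gf N x : `|g N x| <= `|f x|.
  by have [Dx|Dx] := pselect (D N x); [rewrite /g cut_in|rewrite /g cut_out// normr0].
apply: (@op_bound_closed _ a K sa ba g f (fun x => `|f x|)).
- exact: measurableT_comp.
- by move=> J; exact: integrable_norm.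
- by [].
- exact: mg.
- exact: mf.
- by move=> N x Kx; rewrite /g /cut sf// mulr0.
- exact: sf.
- exact: gf.
- by [].
- apply: (@dominated_L1 _ _ _ _ (fun x => `|f x|)) => //.
  + by move=> N; exact: measurable_funTS.
  + exact: measurable_funTS.
  + exact: integrable_norm.
  + apply: ae_all => x Kx; apply: cvg_near_cst.
    exists (Num.truncn (`|f x| / mu x)).+1 => // N /= hN; rewrite /g cut_in// /D /=.
    by rewrite -ler_pdivrMr// (le_trans (ltW (truncnS_gt _)))// ler_nat.
- exact: mnu.
- by move=> x; rewrite ltW.
- move=> N; apply: le_trans (@bounded_ratio_bound (g N) K N%:R _ _ _) _ => //.
  + by move=> x Kx; rewrite /g /cut sf// mulr0.
  + move=> x; have [Dx|Dx] := pselect (D N x); first by rewrite /g cut_in.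
    by rewrite /g cut_out// normr0 mulr_ge0// ltW.
  rewrite lee_fin ler_wpM2l//; first by rewrite /c2 mulr_ge0// sqr_ge0.
  have eg x : 0 <= energy (g N) x <= energy f x.
    rewrite /energy mulr_ge0 ?sqr_ge0 ?invr_ge0 ?(ltW (mu0 x))//= ler_wpM2r ?invr_ge0 ?(ltW (mu0 x))//.
    by rewrite -real_normK ?num_real// -[leRHS]real_normK ?num_real//; apply: lerXn2r; rewrite ?nnegrE.
  apply: le_mass => //; last by move=> x _; case/andP: (eg x).
  apply: (@le_integrable _ _ _ leb _ mK) ief.
    by apply/measurable_EFinP; apply: measurable_funTS; exact: measurable_energy.
  move=> x _ /=; rewrite lee_fin; case/andP: (eg x) => h1 h2.
  by rewrite (ger0_norm h1); apply: le_trans h2 (ler_norm _).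
Qed.

End cell_bound.

(** * Weighted norms *)

Section weighted_L2.
Context {R : realType}.
Local Notation leb := (@lebesgue_measure R).
Implicit Types (x : R) (f g F G rho : R -> R).

Definition wsq rho f x : R := f x ^+ 2 * rho x.

Lemma measurable_wsq rho f : measurable_fun setT rho -> measurable_fun setT f ->
  measurable_fun setT (wsq rho f).
Proof. by move=> mr mf; apply: measurable_funM => //; exact: measurable_funX. Qed.

Lemma normr_wsq rho f x : `|f x| ^+ 2 * rho x = wsq rho f x.
Proof. by rewrite real_normK ?num_real. Qed.

(** A weight, being positive almost everywhere, has a version that is positive
    everywhere; norms and Haar multipliers do not see the difference. *)
Definition positive_version f x : R := if 0 < f x then f x else 1.

Lemma positive_version_gt0 f x : 0 < positive_version f x.
Proof. by rewrite /positive_version; case: ifP. Qed.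

Lemma measurable_positive_version f : measurable_fun setT f ->
  measurable_fun setT (positive_version f).
Proof.
by move=> mf; apply: measurable_fun_ifT => //; apply: measurable_fun_ltr.
Qed.

Lemma weight_version f : weight f ->
  pos_weight (positive_version f) /\ {ae leb, forall x, positive_version f x = f x}.
Proof.
move=> [lf f0]; have [mf _ _] := lf.
have e : {ae leb, forall x, positive_version f x = f x}.
  by apply: aeW f0 _ => x hx; rewrite /positive_version hx.
split => //; split; [exact: measurable_positive_version| |exact: positive_version_gt0].
move=> K; apply: (@ae_eq_integrable _ _ (EFin \o f) _ (measurable_ditv K)).
- apply/measurable_EFinP; apply: measurable_funTS; exact: measurable_positive_version.
- by apply: aeW e _ => x /= -> _.
- exact: local_dintegrable.
Qed.

Lemma L2_ae rho rho' f : measurable_fun setT rho -> measurable_fun setT rho' ->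
  {ae leb, forall x, rho x = rho' x} -> L2 rho f -> L2 rho' f.
Proof.
move=> mr mr' e [mf h]; split => //.
rewrite -(@ae_eq_int _ setT (fun x => (`|f x| ^+ 2 * rho x)%:E)) //.
- apply/measurable_EFinP; apply: measurable_funM => //; apply: measurable_funX.
  exact: measurableT_comp.
- apply/measurable_EFinP; apply: measurable_funM => //; apply: measurable_funX.
  exact: measurableT_comp.
- by apply: aeW e _ => x ->.
Qed.

Lemma norm2_ae rho rho' f f' : measurable_fun setT rho -> measurable_fun setT rho' ->
  measurable_fun setT f -> measurable_fun setT f' ->
  {ae leb, forall x, f x ^+ 2 * rho x = f' x ^+ 2 * rho' x} -> norm2 rho f = norm2 rho' f'.
Proof.
move=> mr mr' mf mf' e; congr (Num.sqrt _); apply: (@mass_ae_eq _ _ _ setT) => //.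
- by apply: measurable_funM => //; apply: measurable_funX; exact: measurableT_comp.
- by apply: measurable_funM => //; apply: measurable_funX; exact: measurableT_comp.
- by apply: aeW e _ => x; rewrite !real_normK ?num_real.
Qed.

Section nonnegative_density.
Variable rho : R -> R.
Hypotheses (mr : measurable_fun setT rho) (r0 : forall x, 0 <= rho x).

Lemma wsq_ge0 f x : 0 <= wsq rho f x.
Proof. by rewrite mulr_ge0 ?sqr_ge0. Qed.

Lemma L2P f : L2 rho f <->
  measurable_fun setT f /\ leb.-integrable setT (EFin \o wsq rho f).
Proof.
have e : (\int[leb]_x (`|f x| ^+ 2 * rho x)%:E = \int[leb]_x `|(wsq rho f x)%:E|)%E.
  by apply: eq_integral => x _; rewrite normr_wsq gee0_abs// lee_fin wsq_ge0.
split=> -[mf h]; split => //; last by rewrite e; case/integrableP: h.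
apply/integrableP; split; last by rewrite -e.
by apply/measurable_EFinP; exact: measurable_wsq.
Qed.

Lemma norm2_ge0 f : 0 <= norm2 rho f. Proof. exact: sqrtr_ge0. Qed.

Lemma norm2_sqr f : norm2 rho f ^+ 2 = mass (wsq rho f) setT.
Proof.
rewrite /norm2 sqr_sqrtr; last first.
  by apply: Rintegral_ge0 => x _; rewrite normr_wsq wsq_ge0.
by congr Rintegral; apply/funext => x; rewrite normr_wsq.
Qed.

Lemma L2_le f (c : R) : measurable_fun setT f ->
  (\int[leb]_x (wsq rho f x)%:E <= c%:E)%E -> L2 rho f /\ norm2 rho f ^+ 2 <= c.
Proof.
move=> mf h; have i : leb.-integrable setT (EFin \o wsq rho f).
  by apply: (@integrable_ge0 _ _ _ c) => //; [exact: measurable_wsq|move=> x _; exact: wsq_ge0].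
split; first exact/L2P.
by rewrite norm2_sqr -lee_fin -(integral_EFinE measurableT i).
Qed.

Lemma L2D f g : L2 rho f -> L2 rho g -> L2 rho (fun x => f x + g x) /\
  norm2 rho (fun x => f x + g x) <= norm2 rho f + norm2 rho g.
Proof.
move=> hf hg; have [mf jf] := (L2P f).1 hf; have [mg jg] := (L2P g).1 hg.
have mp : measurable_fun setT (fun x => f x * g x * rho x).
  by apply: measurable_funM => //; exact: measurable_funM.
have [|ip hp] := cauchy_schwarz measurableT mp jf jg.
  move=> x _; rewrite !wsq_ge0; split => //; rewrite /wsq.
  by rewrite le_eqVlt; apply/orP; left; apply/eqP; ring.
have [nf ng] := (norm2_ge0 f, norm2_ge0 g).
rewrite -!/(mass _ _) -!norm2_sqr in hp.
have pfg : mass (fun x => f x * g x * rho x) setT <= norm2 rho f * norm2 rho g.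
  apply: le_trans (ler_norm _) _; rewrite -(@ler_pXn2r _ 2)// ?nnegrE ?mulr_ge0//.
  by rewrite real_normK ?num_real// exprMn.
have e : (fun x => wsq rho (fun y => f y + g y) x) =
    (fun x => wsq rho f x + (2 * (f x * g x * rho x) + wsq rho g x)).
  by apply/funext => x; rewrite /wsq; ring.
have i2 := integrableRZ 2 measurableT ip.
have i3 := integrableRD measurableT i2 jg.
have i4 := integrableRD measurableT jf i3.
split; first by apply/L2P; split; [exact: measurable_funD|rewrite /wsq e].
rewrite -(@ler_pXn2r _ 2)// ?nnegrE ?norm2_ge0 ?addr_ge0//.
rewrite norm2_sqr /mass e RintegralD// RintegralD// RintegralZl// -!/(mass _ _) -!norm2_sqr.
by rewrite sqrrD; move: pfg; move: (mass _ _) => p; lra.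
Qed.

Lemma L2N f : L2 rho f -> L2 rho (fun x => - f x) /\
  norm2 rho (fun x => - f x) = norm2 rho f.
Proof.
move=> [mf h]; split; last by congr (Num.sqrt _); congr Rintegral; apply/funext => x; rewrite normrN.
split; first exact: measurableT_comp.
by under eq_integral do rewrite normrN.
Qed.

Lemma L2B f g : L2 rho f -> L2 rho g -> L2 rho (fun x => f x - g x) /\
  norm2 rho (fun x => f x - g x) <= norm2 rho f + norm2 rho g.
Proof. by move=> hf /L2N[hg <-]; exact: L2D. Qed.

Lemma norm2_limit (G : nat -> R -> R) F (c : R) : (forall n, L2 rho (G n)) -> L2 rho F ->
  norm2 rho (fun x => G n x - F x) @[n --> \oo] --> 0 ->
  (forall n, norm2 rho (G n) <= c) -> norm2 rho F <= c.
Proof.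
move=> hG hF h hc.
have hb n : norm2 rho F <= c + norm2 rho (fun x => G n x - F x).
  have [h1 _] := L2B (hG n) hF; have [_ h2] := L2B (hG n) h1.
  have e : (fun x => G n x - (G n x - F x)) = F by apply/funext => x; ring.
  by move: h2; rewrite e => /le_trans; apply; rewrite lerD2r.
have lim : c + norm2 rho (fun x => G n x - F x) @[n --> \oo] --> c + 0.
  by apply: cvgD => //; exact: cvg_cst.
rewrite -[leRHS]addr0 -(cvg_lim (@Rhausdorff R) lim); apply: limr_ge; first exact: cvgP lim.
by apply: nearW => n; exact: hb.
Qed.

End nonnegative_density.
End weighted_L2.

(** * The two-weight inequality on the line *)

Section half_lines.
Context {R : realType}.
Local Notation leb := (@lebesgue_measure R).
Implicit Types (x y : R) (I K L : dyadic) (f g : R -> R).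

(** Dyadic intervals do not cross the origin. This is why the operators are studied
    separately on the two half-lines. *)
Lemma ditv_sign L x y : ditv L x -> ditv L y -> (0 <= x) = (0 <= y).
Proof.
have key (z : R) : ditv L z -> (0 <= z) = (0 <= L.2).
  rewrite ditvE => /andP[h1 h2]; have l0 := len_gt0 L : 0 < len L :> R.
  have [L2|L2] := leP 0 L.2; first by apply: le_trans h1; apply: (mulr_ge0 (ltW l0)); rewrite ler0z.
  apply/negbTE; rewrite -ltNge; apply: lt_le_trans h2 _.
  by rewrite pmulr_rle0// lerz0 lezD1.
by move=> /key -> /key ->.
Qed.

(** The dyadic interval of length [2 ^ n] that touches the origin, on its right if [b]
    is true. *)
Definition big_cell (n : nat) (b : bool) : dyadic := (- n%:Z, if b then 0 else -1).

Lemma big_cell_sign n b x : ditv (big_cell n b) x -> (0 <= x) = b.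
Proof.
rewrite ditvE /big_cell /= => /andP[h1 h2].
have l0 : 0 < len (big_cell n b) :> R by exact: len_gt0.
case: b h1 h2 l0; rewrite /big_cell /= => h1 h2 l0; first by rewrite mulr0 in h1.
by apply/negbTE; rewrite -ltNge; rewrite addNr mulr0 in h2.
Qed.

Lemma in_big_cell (M : R) : exists m : nat, forall n, (m <= n)%N -> forall x, `|x| <= M ->
  ditv (big_cell n (0 <= x)) x.
Proof.
have [m h] := bounded_in_cells M; exists m => n mn x xM.
have [|] := h n mn x xM; rewrite -/(big_cell n true) -/(big_cell n false) => hx.
  by rewrite (big_cell_sign (b := true) hx).
by rewrite (big_cell_sign (b := false) hx).
Qed.

Lemma half_lines_bound (F : R -> R) (c0 c1 : R) (m : nat) : measurable_fun setT F ->
  (forall x, 0 <= F x) ->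
  (forall n, (m <= n)%N -> (\int[leb]_(x in ditv (big_cell n true)) (F x)%:E <= c0%:E)%E) ->
  (forall n, (m <= n)%N -> (\int[leb]_(x in ditv (big_cell n false)) (F x)%:E <= c1%:E)%E) ->
  (\int[leb]_x (F x)%:E <= (c0 + c1)%:E)%E.
Proof.
move=> mF F0 h0 h1.
pose E n : set R := ditv (big_cell (m + n) true) `|` ditv (big_cell (m + n) false).
apply: (@exhaust_le _ setT E) => //.
- by move=> n; apply: measurableU; exact: measurable_ditv.
- apply: ae_all => x _; have [k hk] := in_big_cell `|x|; exists k => n kn.
  have := hk (m + n)%N (leq_trans kn (leq_addl _ _)) x (lexx _).
  by case: (0 <= x) => hx; [left|right].
move=> n; rewrite setTI ge0_integral_setU; last 1 first.
- apply/disj_setPRL => x hx hy.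
  by have := big_cell_sign hx; rewrite (big_cell_sign hy).
- by rewrite EFinD; apply: leeD; [exact: h0 (leq_addr _ _)|exact: h1 (leq_addr _ _)].
- exact: measurable_ditv.
- exact: measurable_ditv.
- by apply/measurable_EFinP; exact: measurable_funTS.
- by move=> x _; rewrite lee_fin.
Qed.

Definition half_line (b : bool) : set R := [set x | (0 <= x) = b].

Lemma measurable_half_line b : measurable (half_line b).
Proof.
have -> : half_line b = if b then `[0, +oo[%classic else `]-oo, 0[%classic.
  apply/seteqP; split => x; rewrite /half_line /=; case: b => /=; rewrite in_itv/= ?andbT//.
    by move/negbT; rewrite -ltNge.
  by move=> h; apply/negbTE; rewrite -ltNge.
by case: b; exact: measurable_itv.
Qed.

Lemma ditv_in_big_cell I : exists b, exists m : nat, ditv I `<=` half_line b /\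
  forall n, (m <= n)%N -> ditv I `<=` (ditv (big_cell n b) : set R).
Proof.
have [y hy] : exists y : R, ditv I y.
  exists (len I * I.2%:~R); rewrite ditvE lexx /= ltr_pM2l ?len_gt0//.
  by rewrite ltr_int ltzD1.
have [m hm] := in_big_cell `|y|; exists (0 <= y); exists (maxn m (absz I.1)).
split=> [x hx|n]; first by rewrite /half_line /= (ditv_sign hx hy).
rewrite geq_max => /andP[mn In]; apply: (@ditv_nested _ _ _ y) => //.
  by rewrite /=; lia.
exact: hm.
Qed.

End half_lines.

Section compact_bound.
Context {R : realType}.
Local Notation leb := (@lebesgue_measure R).
Implicit Types (x y : R) (I K L : dyadic) (f g mu nu : R -> R).

(** The two-weight inequality on the functions with bounded support: the common
    core of all the conditions. *)
Definition compact_bound (a : dyadic -> R) mu nu (c : R) := forall f (M : R),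
  measurable_fun setT f -> (forall x, M < `|x| -> f x = 0) ->
  leb.-integrable setT (EFin \o energy mu f) ->
  op_defined (haar_mult a) f /\
  (\int[leb]_x (op_val (haar_mult a) f x ^+ 2 * nu x)%:E <= (c * mass (energy mu f) setT)%:E)%E.

Lemma ditv_bounded I : exists M : R, forall x, ditv I x -> `|x| <= M.
Proof.
exists (`|len I * I.2%:~R| + `|len I * (I.2 + 1)%:~R|) => x; rewrite ditvE => /andP[h1 h2].
move: h1 h2; set p := _ * I.2%:~R; set q := _ * (I.2 + 1)%:~R => h1 h2.
have := ler_norm (- p); have := ler_norm q; rewrite normrN => h3 h4.
have := normr_ge0 p; have := normr_ge0 q => h5 h6.
by rewrite ler_norml; apply/andP; split; lra.
Qed.

Lemma energy_finite_integrable mu f (M : R) : pos_weight mu -> measurable_fun setT f ->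
  (forall x, M < `|x| -> f x = 0) ->
  leb.-integrable setT (EFin \o energy mu f) -> dintegrable f.
Proof.
move=> wmu mf _ ie K; apply: (energy_cs wmu mf _).1.
by apply: (@integrableS _ _ _ leb setT) ie => //; exact: measurable_ditv.
Qed.

Section weights.
Variables (a : dyadic -> R) (mu nu : R -> R).
Hypotheses (wmu : pos_weight mu) (wnu : pos_weight nu).
Local Notation A := (haar_mult (R := R) a).
Let mnu : measurable_fun setT nu. Proof. by case: wnu. Qed.
Let mu0 x : 0 < mu x. Proof. by case: wmu. Qed.
Let nu0 x : 0 < nu x. Proof. by case: wnu. Qed.
Let mT f : measurable_fun setT (op_val A f). Proof. exact: measurable_haar_mult. Qed.

Lemma op_cvg_half_line f b x : dintegrable f -> supported f (half_line b) -> (0 <= x) = ~~ b ->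
  op_cvg A f x 0.
Proof.
move=> hf sf xb; apply: op_cvg0 => // j y hy; apply: sf; rewrite /half_line /=.
by rewrite (ditv_sign hy (ditv_cell j x)) xb; case: (b).
Qed.

Lemma energy_cut D f x : energy mu (cut D f) x = cut D (energy mu f) x.
Proof.
by have [h|h] := pselect (D x); rewrite /energy ?(cut_in _ h)// !(cut_out _ h) expr0n mul0r.
Qed.

Lemma energy_dual_weight D : energy mu (cut D mu) = cut D mu.
Proof.
apply/funext => x; rewrite energy_cut /cut /energy; congr (_ * _).
by rewrite expr2 mulfK// gt_eqF.
Qed.

Lemma sqr_nu_measurable f : measurable_fun setT (fun x => op_val A f x ^+ 2 * nu x).
Proof. by apply: measurable_funM => //; exact: measurable_funX. Qed.

(** On each half-line, [cell_bound] on the dyadic interval of length [2 ^ n] that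
    touches the origin. *)
Lemma testing_compact_bound C : locally_bounded (R := R) a -> summable_tails a -> 1 <= C ->
  tested a mu nu C -> tested a nu mu C ->
  (forall K, cross a K ^+ 2 * (mass mu (ditv (left_half K)) * mass nu (ditv (right_half K))) <= C ^+ 2) ->
  compact_bound a mu nu (4 * (1 + 50 * C) ^+ 2).
Proof.
move=> ba sa C1 test test' kap f M mf fM ie; set c := 4 * _.
have c0 : 0 <= c by rewrite /c pmulr_rge0// sqr_ge0.
have hf := energy_finite_integrable wmu mf fM ie.
have [m hm] := in_big_cell M.
pose fb b := cut (half_line b) f.
have mfb b : measurable_fun setT (fb b) by apply: measurable_cut => //; exact: measurable_half_line.
have efb b : energy mu (fb b) = cut (half_line b) (energy mu f).
  by apply/funext => x; exact: energy_cut.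
have mE : measurable_fun setT (energy mu f) by exact: measurable_energy.
have ifb b : leb.-integrable setT (EFin \o energy mu (fb b)).
  rewrite efb; apply: integrable_cut => //; first exact: measurable_half_line.
  by apply: (@integrableS _ _ _ leb setT) ie => //; exact: measurable_half_line.
have fbM b x : M < `|x| -> fb b x = 0 by move=> h; rewrite /fb /cut fM// mulr0.
have dfb b : dintegrable (fb b).
  exact: (@energy_finite_integrable _ _ M wmu (mfb b) (fbM b) (ifb b)).
have sfb b : supported (fb b) (half_line b) by exact: supported_cut.
have Sfb b n : (m <= n)%N -> supported (fb b) (ditv (big_cell n b)).
  move=> mn x hx; have [xM|xM] := leP `|x| M; last exact: fbM.
  have := hm n mn x xM; have [hb|hb] := pselect (half_line b x); first by rewrite hb.
  by move=> _; exact: sfb.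
have fE b : f = (fun x => fb b x + fb (~~ b) x).
  apply/funext => x; have [h|h] := pselect (half_line b x); rewrite /fb.
    by rewrite (cut_in _ h) cut_out ?addr0// /half_line /= h; case: (b).
  rewrite (cut_out _ h) cut_in ?add0r//; move: h; rewrite /half_line /=.
  by case: (b); case: (0 <= x).
have opE b x y : half_line b x -> op_cvg A (fb b) x y -> op_cvg A f x y.
  move=> hx hy; rewrite (fE b) -[y]addr0; apply: op_cvgD => //.
  by apply: (op_cvg_half_line (dfb (~~ b)) (sfb (~~ b))); rewrite negbK.
have aeb b n : (m <= n)%N -> {ae leb, forall x, ditv (big_cell n b) x ->
    exists y, op_cvg A (fb b) x y /\ op_cvg A f x y}.
  move=> mn; apply: aeW (ae_op_cvg sa ba (mfb b) (dfb b) (Sfb b n mn)) _ => x h hx.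
  by have [y hy] := h hx; exists y; split => //; apply: opE hy; exact: big_cell_sign hx.
split.
  apply: aeW (ae_forall_nat (fun n => aeI (aeb true (m + n)%N (leq_addr _ _))
    (aeb false (m + n)%N (leq_addr _ _)))) _ => x hx; apply/op_cvgP.
  have [k hk] := in_big_cell `|x|.
  have hxk := hk (m + k)%N (leq_addl _ _) x (lexx _).
  have [ht hf'] := hx k; move: hxk; case: (0 <= x) => hxk.
    by have [y [_ hy]] := ht hxk; exists y.
  by have [y [_ hy]] := hf' hxk; exists y.
have bd b n : (m <= n)%N -> (\int[leb]_(x in ditv (big_cell n b)) (op_val A f x ^+ 2 * nu x)%:E <=
    (c * mass (energy mu (fb b)) setT)%:E)%E.
  move=> mn; have mK := measurable_ditv (big_cell n b) : measurable (ditv _ : set R).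
  rewrite (@ae_eq_int _ _ _ (fun x => (op_val A (fb b) x ^+ 2 * nu x)%:E) mK).
  - apply: le_trans (cell_bound sa ba wmu wnu C1 test test' kap (mfb b) (Sfb b n mn) _) _.
      by apply: (@integrableS _ _ _ leb setT) => //.
    rewrite lee_fin -/c (ler_wpM2l c0)//.
    have i1 : leb.-integrable (ditv (big_cell n b)) (EFin \o energy mu (fb b)).
      by apply: (@integrableS _ _ _ leb setT).
    rewrite /mass -lee_fin -(integral_EFinE mK i1) -(integral_EFinE measurableT (ifb b)).
    apply: ge0_subset_integral => //.
    - by apply/measurable_EFinP; exact: measurable_energy.
    - by move=> x _; rewrite lee_fin /energy mulr_ge0 ?sqr_ge0// invr_ge0 ltW.
  - by apply/measurable_EFinP; apply: measurable_funTS; exact: sqr_nu_measurable.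
  - by apply/measurable_EFinP; apply: measurable_funTS; exact: sqr_nu_measurable.
  apply: aeW (aeb b n mn) _ => x h hx; have [y [h1 h2]] := h hx.
  by rewrite (op_valE h1) (op_valE h2).
have -> : mass (energy mu f) setT = mass (energy mu (fb true)) setT + mass (energy mu (fb false)) setT.
  rewrite /mass -RintegralD//; congr Rintegral; apply/funext => x.
  rewrite !efb; have [h|h] := pselect (half_line true x).
    by rewrite (cut_in _ h) cut_out ?addr0// /half_line /= h.
  by rewrite (cut_out _ h) cut_in ?add0r//; move: h; rewrite /half_line /=; case: (0 <= x).
rewrite mulrDr; apply: (half_lines_bound (m := m) (sqr_nu_measurable f) _ (bd true) (bd false)).
by move=> x; rewrite mulr_ge0 ?sqr_ge0// ltW.
Qed.

End weights.
End compact_bound.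

Section compact_bound_testing.
Context {R : realType}.
Local Notation leb := (@lebesgue_measure R).
Implicit Types (x y : R) (I K L : dyadic) (f g mu nu : R -> R).
Variables (a : dyadic -> R) (mu nu : R -> R).
Hypotheses (wmu : pos_weight mu) (wnu : pos_weight nu).
Local Notation A := (haar_mult (R := R) a).
Let mmu : measurable_fun setT mu. Proof. by case: wmu. Qed.
Let imu : dintegrable mu. Proof. by case: wmu. Qed.
Let mnu : measurable_fun setT nu. Proof. by case: wnu. Qed.
Let inu : dintegrable nu. Proof. by case: wnu. Qed.
Let mu0 x : 0 < mu x. Proof. by case: wmu. Qed.
Let nu0 x : 0 < nu x. Proof. by case: wnu. Qed.
Let mT f : measurable_fun setT (op_val A f). Proof. exact: measurable_haar_mult. Qed.

(** The testing function of [K] has a nonzero integral, so the convergence of the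
    series at one point forces that of the tail. *)
Lemma testing_tails : (forall K, {ae leb, forall x, ditv K x ->
    cvg (partial_sum A (cut (ditv K) mu) x @ filter_prod \oo \oo)}) -> summable_tails a.
Proof.
move=> h K; have [x Kx hx] := ae_not_empty (h K).
apply: (@op_cvg_tail _ a (cut (ditv K) mu) K x) => //.
- exact: dcut.
- exact: supported_cut.
- by rewrite (mass_cut_in _ (K := K))// gt_eqF// mass_gt0.
Qed.

Lemma cut_ditv_bounded I f : exists M : R, forall x, M < `|x| -> cut (ditv I) f x = 0.
Proof.
have [M hM] := @ditv_bounded R I; exists M => x Mx; rewrite cut_out// => /hM.
by rewrite leNgt Mx.
Qed.

Lemma integrable_cut_weight I : leb.-integrable setT (EFin \o cut (ditv I) mu).
Proof. by apply: integrable_cut => //; exact: measurable_ditv. Qed.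

Lemma compact_bound_testing c : compact_bound a mu nu c -> forall I,
  op_defined A (cut (ditv I) mu) /\
  (\int[leb]_x (op_val A (cut (ditv I) mu) x ^+ 2 * nu x)%:E <= (c * mass mu (ditv I))%:E)%E.
Proof.
move=> h I; have [M hM] := cut_ditv_bounded I mu.
have eI := energy_dual_weight wmu (ditv I).
have [|h1 h2] := h _ M (mcut mmu I) hM; first by rewrite eI; exact: integrable_cut_weight.
by split => //; move: h2; rewrite eI mass_cut.
Qed.

Lemma compact_bound_tails c : compact_bound a mu nu c -> summable_tails a.
Proof.
by move=> h; apply: testing_tails => K; have [h1 _] := compact_bound_testing h K; rewrite /op_defined in h1; apply: aeW h1 _.
Qed.

Hypothesis ba : locally_bounded (R := R) a.

Lemma op_defined_cut I : summable_tails a -> op_defined A (cut (ditv I) nu).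
Proof.
move=> sa; have [b [m [Ib Im]]] := @ditv_in_big_cell R I.
have sI K : ditv I `<=` (ditv K : set R) -> supported (cut (ditv I) nu) (ditv K).
  by move=> IK x Kx; rewrite cut_out// => /IK.
apply: aeW (ae_forall_nat (fun n => ae_op_cvg sa ba (mcut mnu I) (dcut mnu inu I)
   (sI _ (Im (m + n)%N (leq_addr _ _))))) _ => x hx; apply/op_cvgP.
have [hb|hb] := pselect (half_line b x).
  have [k hk] := in_big_cell `|x|; apply: (hx k).
  by rewrite -hb; apply: hk; rewrite ?leq_addl.
exists 0; apply: (@op_cvg_half_line _ a _ b) => //; first exact: dcut.
  by move=> y hy; rewrite cut_out// => /Ib.
by move: hb; rewrite /half_line /=; case: (b); case: (0 <= x).
Qed.

(** Duality: the testing function of the adjoint is paired with itself, after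
    cutting everything down to a good set, where the operator is symmetric. *)
Lemma compact_bound_dual_local c I K0 : 0 <= c -> compact_bound a mu nu c ->
  ditv I `<=` (ditv K0 : set R) ->
  (\int[leb]_(x in ditv K0) (op_val A (cut (ditv I) nu) x ^+ 2 * mu x)%:E <=
    (c * mass nu (ditv I))%:E)%E.
Proof.
move=> c0 cb IK; have sa := compact_bound_tails cb.
have mK0 := measurable_ditv K0 : measurable (ditv K0 : set R).
pose h x := mu x + nu x.
have mh : measurable_fun setT h by exact: measurable_funD.
have ih : dintegrable h by exact: dintegrableD.
have h0 x : 0 <= h x by rewrite addr_ge0 ?(ltW (mu0 x)) ?(ltW (nu0 x)).
pose g := cut (ditv I) nu.
have mg : measurable_fun setT g by exact: mcut.
have g0 x : 0 <= g x <= nu x.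
  by rewrite /g /cut indicE; case: (_ \in _); rewrite ?mul0r ?mul1r ?lexx ?ltW.
pose D N := good_set a h K0 N%:R.
have mD N : measurable (D N) by exact: measurable_good_set.
have DK N : D N `<=` ditv K0 by exact: good_set_sub.
pose gk k := cut (D k) g.
have gkP k x : 0 <= gk k x <= g x.
  have [g1 g2] := andP (g0 x).
  by have [d|d] := pselect (D k x); rewrite /gk ?(cut_in _ d) ?(cut_out _ d) ?g1 lexx.
have mgk k : measurable_fun setT (gk k) by exact: measurable_cut.
apply: (@op_bound_closed _ a K0 sa ba gk g nu) => //.
- by move=> x; rewrite ltW.
- by move=> k x Kx; rewrite /gk cut_out// => /DK.
- by move=> x Kx; rewrite /g cut_out// => /IK.
- move=> k x; have [g1 g2] := andP (g0 x); have [g3 g4] := andP (gkP k x).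
  by rewrite ger0_norm// (le_trans g4).
- by move=> x; have [g1 g2] := andP (g0 x); rewrite ger0_norm.
- apply: (@dominated_L1 _ _ _ _ nu) => //.
  + by move=> k; exact: measurable_funTS.
  + exact: measurable_funTS.
  + move=> k x _; have [g1 g2] := andP (g0 x); have [g3 g4] := andP (gkP k x).
    by rewrite ger0_norm// (le_trans g4).
  + apply: aeW (good_set_exhaust K0 mh ih h0 ba) _ => x hx Kx; apply: cvg_near_cst.
    have [N hN] := hx Kx; exists N => // n /= Nn.
    by rewrite /gk cut_in//; exact: hN.
- by move=> x; rewrite ltW.
move=> k; pose G := op_val A (gk k).
pose E N := D N `&` [set x | `|G x| <= N%:R].
have mE N : measurable (E N).
  apply: measurableI => //; rewrite -[X in measurable X]setTI.
  apply: (measurable_fun_le measurableT); last exact: measurable_cst.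
  by apply: measurableT_comp => //; exact: mT.
apply: (@exhaust_le _ _ E) => //.
- by apply: measurable_funTS; apply: measurable_funM => //; exact: measurable_funX.
- by move=> x _; rewrite mulr_ge0 ?sqr_ge0// ltW.
- apply: aeW (good_set_exhaust K0 mh ih h0 ba) _ => x hx Kx.
  have [N hN] := hx Kx; exists (N + (Num.truncn `|G x|).+1)%N => n Nn; split.
    by apply: hN; apply: leq_trans Nn; exact: leq_addr.
  rewrite /= (le_trans (ltW (truncnS_gt _)))// ler_nat.
  by apply: leq_trans Nn; exact: leq_addl.
(* The operator is applied to [f], which is [mu] times [G] cut to [E N0]: its energy
   is the quantity [X] to be bounded, and symmetry makes [X] its pairing with [gk k]. *)
move=> N0; pose N := maxn N0 k.
have -> : (\int[leb]_(x in ditv K0 `&` E N0) (G x ^+ 2 * mu x)%:E =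
    \int[leb]_(x in ditv K0) (cut (E N0) (fun x => G x ^+ 2 * mu x) x)%:E)%E.
  rewrite -(int_cut (ditv K0 `&` E N0)) -(int_cut (ditv K0) (cut _ _)); apply: eq_integral => x _; congr EFin.
  by rewrite /cut indicI mulrA.
pose f := cut (E N0) (fun x => G x * mu x).
have mG : measurable_fun setT G by exact: mT.
have mf : measurable_fun setT f.
  by apply: (measurable_cut (mE N0)); exact: measurable_funM.
have Gf x : G x * f x = cut (E N0) (fun x => G x ^+ 2 * mu x) x.
  by rewrite /f /cut expr2; ring.
have Ef : energy mu f = cut (E N0) (fun x => G x ^+ 2 * mu x).
  apply/funext => x; rewrite energy_cut /cut /energy; congr (_ * _).
  by have := mu0 x; move: (mu x) => z z0; field; rewrite gt_eqF.
pose B : R := N0%:R + 1.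
have B0 : 0 <= B by rewrite addr_ge0.
have fB x : `|f x| <= B * h x.
  have hm : mu x <= h x by rewrite lerDl ltW.
  have [e|e] := pselect (E N0 x); last by rewrite /f (cut_out _ e) normr0 mulr_ge0.
  rewrite /f (cut_in _ e) normrM (gtr0_norm (mu0 x)) ler_pM ?(ltW (mu0 x))//.
  by case: e => _ /= /le_trans; apply; rewrite lerDl.
have gB x : `|gk k x| <= B * h x.
  have [g1 g2] := andP (g0 x); have [g3 g4] := andP (gkP k x).
  rewrite (ger0_norm g3) (le_trans g4)// (le_trans g2)//.
  rewrite -[leLHS]mul1r ler_pM ?(ltW (nu0 x))//; first by rewrite lerDr.
  by rewrite lerDr ltW.
have DN n : (n <= N)%N -> D n `<=` D N.
  move=> nN x [h1 h2 h3]; have nR : n%:R <= N%:R :> R by rewrite ler_nat.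
  split => //; first exact: le_trans nR.
  move=> i; have [h4 h5] := h3 i; split; last exact: le_trans nR.
  by apply: le_trans h4 _; rewrite ler_wpM2r// ltW// len_gt0.
have sf : supported f (D N).
  by move=> x Dx; rewrite /f cut_out// => -[/(DN N0 (leq_maxl _ _))].
have sg : supported (gk k) (D N).
  by move=> x Dx; rewrite /gk cut_out// => /(DN k (leq_maxr _ _)).
have [i1 e1] := op_symmetric sa mh ih h0 B0 (ler0n R N) mf (mgk k) sf sg fB gB.
pose X := mass (cut (E N0) (fun x => G x ^+ 2 * mu x)) (ditv K0).
have eX : mass (fun x => G x * f x) (ditv K0) = X by apply: mass_eq => x _; exact: Gf.
have df : dintegrable f.
  move=> J; have mJ := measurable_ditv J : measurable (ditv J : set R).
  apply: (@le_integrable _ _ _ leb _ mJ) (integrableRZ B mJ (ih J)).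
    by apply/measurable_EFinP; exact: measurable_funTS.
  by move=> x _ /=; rewrite lee_fin (le_trans (fB x))// ler_norm.
have mX : measurable_fun setT (cut (E N0) (fun x => G x ^+ 2 * mu x)).
  by apply: measurable_cut => //; apply: measurable_funM => //; exact: measurable_funX.
have iX : leb.-integrable (ditv K0) (EFin \o cut (E N0) (fun x => G x ^+ 2 * mu x)).
  apply: (@le_integrable _ _ _ leb _ mK0) (integrableRZ (N0%:R ^+ 2) mK0 (imu K0)).
    by apply/measurable_EFinP; exact: measurable_funTS.
  move=> x _ /=; rewrite lee_fin.
  have [e|e] := pselect (E N0 x); last by rewrite (cut_out _ e) normr0.
  rewrite (cut_in _ e); apply: le_trans (ler_norm _).
  rewrite ger0_norm ?(mulr_ge0 (sqr_ge0 _) (ltW (mu0 x)))//.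
  rewrite ler_wpM2r ?(ltW (mu0 x))// -[leLHS]real_normK ?num_real//.
  by apply: lerXn2r; rewrite ?nnegrE//; case: e.
have X0 : 0 <= X.
  apply: Rintegral_ge0 => x _; rewrite /cut; apply: mulr_ge0 => //.
  exact: mulr_ge0 (sqr_ge0 _) (ltW (mu0 x)).
rewrite (integral_EFinE mK0 iX) lee_fin -/(mass _ _) -/X.
have sfK : supported f (ditv K0) by move=> x Kx; apply: sf => /DK.
have [M hM] := @ditv_bounded R K0.
have iE : leb.-integrable setT (EFin \o energy mu f).
  have -> : energy mu f = cut (ditv K0) (energy mu f).
    by rewrite cut_supported// => x Kx; rewrite /energy sfK// expr0n mul0r.
  by apply: integrable_cut => //; [exact: measurable_energy|rewrite Ef].
have [|_ hT] := cb f M mf _ iE.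
  by move=> x Mx; apply: sfK => /hM; rewrite leNgt Mx.
have XT : mass (energy mu f) setT = X.
  rewrite Ef /X -(mass_cut (ditv K0)); rewrite (@cut_supported _ (ditv K0))// => x Kx.
  by rewrite cut_out// => -[/DK].
rewrite XT in hT.
have iF : leb.-integrable setT (EFin \o (fun x => op_val A f x ^+ 2 * nu x)).
  apply: (integrable_ge0 _ _ hT); first exact: sqr_nu_measurable.
  by move=> x _; rewrite mulr_ge0 ?sqr_ge0// ltW.
have iFK : leb.-integrable (ditv K0) (EFin \o (fun x => op_val A f x ^+ 2 * nu x)).
  by apply: (@integrableS _ _ _ leb setT).
have hF : mass (fun x => op_val A f x ^+ 2 * nu x) (ditv K0) <= c * X.
  rewrite /mass -lee_fin -(integral_EFinE mK0 iFK); apply: le_trans hT.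
  apply: ge0_subset_integral => //.
  - by apply/measurable_EFinP; exact: sqr_nu_measurable.
  - by move=> x _; rewrite lee_fin mulr_ge0 ?sqr_ge0// ltW.
have mfg : measurable_fun setT (fun x => op_val A f x * gk k x).
  exact: measurable_funM (mT f) (mgk k).
have [|_ cs] := cauchy_schwarz mK0 (measurable_funTS mfg) iFK (dcut mnu inu I K0).
  move=> x _; have [g1 g2] := andP (g0 x); have [g3 g4] := andP (gkP k x).
  split; [by rewrite mulr_ge0 ?sqr_ge0// ltW|exact: g1|].
  rewrite exprMn -mulrA ler_wpM2l ?sqr_ge0// expr2.
  by apply: ler_pM => //; exact: le_trans g4 g2.
have : X ^+ 2 <= (c * X) * mass nu (ditv I).
  rewrite -{1}eX -e1; apply: le_trans cs _; rewrite -!/(mass _ _).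
  have -> : mass g (ditv K0) = mass nu (ditv I).
    by rewrite (mass_supported (D := ditv I))// ?mass_cut_in//; exact: supported_cut.
  by apply: ler_wpM2r hF; rewrite ltW// mass_gt0.
have [->|Xn] := eqVneq X 0; first by rewrite mulr_ge0// ltW// mass_gt0.
have Xp : 0 < X by rewrite lt_def Xn.
by rewrite expr2 mulrAC ler_pM2r.
Qed.

End compact_bound_testing.

Section compact_bound_consequences.
Context {R : realType}.
Local Notation leb := (@lebesgue_measure R).
Implicit Types (x y : R) (I K L : dyadic) (f g mu nu : R -> R).
Variables (a : dyadic -> R) (mu nu : R -> R).
Hypotheses (wmu : pos_weight mu) (wnu : pos_weight nu).
Local Notation A := (haar_mult (R := R) a).
Let mmu : measurable_fun setT mu. Proof. by case: wmu. Qed.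
Let mnu : measurable_fun setT nu. Proof. by case: wnu. Qed.
Let inu : dintegrable nu. Proof. by case: wnu. Qed.
Let mu0 x : 0 < mu x. Proof. by case: wmu. Qed.
Let nu0 x : 0 < nu x. Proof. by case: wnu. Qed.
Let mT f : measurable_fun setT (op_val A f). Proof. exact: measurable_haar_mult. Qed.

Lemma compact_bound_dual c I : locally_bounded (R := R) a -> 0 <= c -> compact_bound a mu nu c ->
  (\int[leb]_x (op_val A (cut (ditv I) nu) x ^+ 2 * mu x)%:E <= (c * mass nu (ditv I))%:E)%E.
Proof.
move=> ba c0 cb; have [b [m [Ib Im]]] := @ditv_in_big_cell R I.
have mF : measurable_fun setT (fun x => op_val A (cut (ditv I) nu) x ^+ 2 * mu x).
  by apply: measurable_funM => //; exact: measurable_funX.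
have near_ n : (m <= n)%N ->
    (\int[leb]_(x in ditv (big_cell n b)) (op_val A (cut (ditv I) nu) x ^+ 2 * mu x)%:E <=
      (c * mass nu (ditv I))%:E)%E.
  by move=> mn; apply: (compact_bound_dual_local wmu wnu ba c0 cb); exact: Im.
have far n : (\int[leb]_(x in ditv (big_cell n (~~ b))) (op_val A (cut (ditv I) nu) x ^+ 2 * mu x)%:E <=
      0%:E)%E.
  rewrite integral0_eq// => x /big_cell_sign xb.
  rewrite (@op_valE _ _ _ _ 0) ?expr0n ?mul0r//.
  apply: (@op_cvg_half_line _ a _ b) => //; first exact: dcut.
  by move=> y hy; rewrite cut_out// => /Ib.
have F0 x : 0 <= op_val A (cut (ditv I) nu) x ^+ 2 * mu x by rewrite mulr_ge0 ?sqr_ge0// ltW.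
case: b Ib Im near_ far => /= Ib Im near_ far.
  by rewrite -[_ * _]addr0; apply: (@half_lines_bound _ _ _ _ m).
by rewrite -[c * _]add0r; apply: (@half_lines_bound _ _ _ _ m).
Qed.

Lemma measurable_trunc n f : measurable_fun setT f -> measurable_fun setT (trunc n f).
Proof.
by move=> mf; apply: measurable_funM.
Qed.

Lemma trunc_in n f x : `|x| <= n%:R -> trunc n f x = f x.
Proof. by rewrite ler_norml => h; rewrite /trunc indicE mem_set ?mulr1// in_itv. Qed.

Lemma trunc_out n f x : n%:R < `|x| -> trunc n f x = 0.
Proof.
move=> h; rewrite /trunc indicE memNset ?mulr0//= in_itv/= -ler_norml.
by apply/negP; rewrite -ltNge.
Qed.

Local Notation rho := (fun x => (mu x)^-1).
Let mrho : measurable_fun setT rho. Proof. exact: measurable_inv_weight. Qed.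
Let rho0 x : 0 <= rho x. Proof. by rewrite invr_ge0 ltW. Qed.

Lemma trunc_energy n f x : 0 <= energy mu (trunc n f) x <= energy mu f x.
Proof.
have e0 y : 0 <= energy mu f y by rewrite /energy mulr_ge0 ?sqr_ge0 ?rho0.
have [h|h] := leP `|x| n%:R; rewrite /energy ?(trunc_in _ h) ?(trunc_out _ h).
  by rewrite lexx andbT; exact: e0.
by rewrite expr0n mul0r lexx; exact: e0.
Qed.

Lemma integrable_trunc_energy n f : L2 rho f ->
  leb.-integrable setT (EFin \o energy mu (trunc n f)).
Proof.
move=> /(L2P mrho rho0)[mf jf]; apply: (@le_integrable _ _ _ leb _ measurableT) jf.
  by apply/measurable_EFinP; apply: measurable_energy => //; exact: measurable_trunc.
move=> x _ /=; have /andP[h1 h2] := trunc_energy n f x.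
by rewrite lee_fin (ger0_norm h1); apply: le_trans h2 (ler_norm _).
Qed.

Lemma trunc_diff_energy N n m f x : (N <= n)%N -> (N <= m)%N ->
  0 <= energy mu (fun y => trunc n f y - trunc m f y) x <=
    `|energy mu (trunc N f) x - energy mu f x|.
Proof.
move=> Nn Nm; have e0 : 0 <= energy mu f x by rewrite /energy mulr_ge0 ?sqr_ge0 ?rho0.
rewrite {1}/energy (mulr_ge0 (sqr_ge0 _) (rho0 x)) /=.
have [h|h] := leP `|x| N%:R.
  have nh k : (N <= k)%N -> `|x| <= k%:R by move=> Nk; rewrite (le_trans h)// ler_nat.
  by rewrite /energy !trunc_in ?nh// subrr expr0n mul0r.
rewrite {2}/energy (trunc_out _ h) expr0n mul0r sub0r normrN ger0_norm//.
by rewrite /energy /trunc !indicE; case: (_ \in _); case: (_ \in _);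
  rewrite ?mulr1 ?mulr0 ?subrr ?subr0 ?sub0r ?sqrrN ?expr0n ?mul0r.
Qed.

(** The bound extends from the functions with bounded support by density. *)
Lemma compact_bound_bounded c : 0 < c -> compact_bound a mu nu c ->
  bounded_op A rho nu.
Proof.
move=> c0 cb; exists (Num.sqrt c); first by rewrite sqrtr_gt0.
move=> f Lf; have [mf jf] := (L2P mrho rho0 f).1 Lf.
have nu0' x : 0 <= nu x by exact: ltW.
pose fn n := trunc n f.
have mfn n : measurable_fun setT (fn n) by exact: measurable_trunc.
have ifn n := integrable_trunc_energy n Lf.
have fnM n x : n%:R < `|x| -> fn n x = 0 by exact: trunc_out.
have dfn n : dintegrable (fn n).
  exact: (energy_finite_integrable wmu (mfn n) (fnM n) (ifn n)).
have opn n := cb _ _ (mfn n) (fnM n) (ifn n).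
pose G n := op_val A (fn n).
have mG n : measurable_fun setT (G n) by exact: mT.
have GL n : L2 nu (G n) /\ norm2 nu (G n) <= Num.sqrt c * norm2 rho f.
  have [_ h] := opn n; have [h1 h2] := L2_le mnu nu0' (mG n) h; split => //.
  have p0 : 0 <= Num.sqrt c * norm2 rho f := mulr_ge0 (sqrtr_ge0 c) (norm2_ge0 _ _).
  rewrite -(@ler_pXn2r _ 2)// ?nnegrE ?norm2_ge0//.
  rewrite exprMn (sqr_sqrtr (ltW c0)); apply: le_trans h2 _; rewrite ler_pM2l//.
  rewrite (norm2_sqr rho0); apply: (le_Rintegral measurableT (ifn n) jf) => x _.
  by have /andP[] := trunc_energy n f x.
pose e N := \int[leb]_(x in setT) `|energy mu (fn N) x - energy mu f x|.
have e_lim : e N @[N --> \oo] --> 0.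
  apply: (@dominated_L1 _ _ _ _ (energy mu f)) => //.
  - by move=> N; exact: measurable_energy.
  - exact: measurable_energy.
  - by move=> N x _; have /andP[h1 h2] := trunc_energy N f x; rewrite ger0_norm.
  - apply: ae_all => x _; apply: cvg_near_cst.
    exists (Num.truncn `|x|).+1 => // n /= hn; rewrite /energy /fn trunc_in//.
    by rewrite (le_trans (ltW (truncnS_gt _)))// ler_nat.
have diff N n m : (N <= n)%N -> (N <= m)%N ->
    (\int[leb]_x ((G n x - G m x) ^+ 2 * nu x)%:E <= (c * e N)%:E)%E.
  move=> Nn Nm; pose d x := fn n x - fn m x.
  have md : measurable_fun setT d by exact: measurable_funB.
  have ie : leb.-integrable setT (EFin \o (fun x => `|energy mu (fn N) x - energy mu f x|)).
    exact: integrable_norm (integrableRB measurableT (ifn N) jf).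
  have jd : leb.-integrable setT (EFin \o energy mu d).
    apply: (@le_integrable _ _ _ leb _ measurableT) ie.
      by apply/measurable_EFinP; exact: measurable_energy.
    move=> x _ /=; have /andP[h1 h2] := trunc_diff_energy f x Nn Nm.
    by rewrite lee_fin (ger0_norm h1); apply: le_trans h2 (ler_norm _).
  have dM x : (maxn n m)%:R < `|x| -> d x = 0.
    by move=> h; rewrite /d !fnM ?subrr//; apply: le_lt_trans h; rewrite ler_nat ?leq_maxl ?leq_maxr.
  have [_ h] := cb d _ md dM jd.
  rewrite (@ae_eq_int _ setT _ (fun x => (op_val A d x ^+ 2 * nu x)%:E))//.
  - apply: le_trans h _; rewrite lee_fin ler_pM2l//; apply: (le_Rintegral measurableT jd ie) => x _.
    by have /andP[] := trunc_diff_energy f x Nn Nm.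
  - by apply: measurable_sqr_mul => //; exact: measurable_funB.
  - exact: measurable_sqr_mul.
  have [d1 _] := opn n; have [d2 _] := opn m; rewrite /op_defined in d1 d2.
  apply: aeW (aeI d1 d2) _ => x [/op_cvgP[y1 h1] /op_cvgP[y2 h2]] _.
  rewrite /G (op_valE h1) (op_valE h2) (@op_valE _ _ _ _ (y1 - y2))//.
  have := op_cvgD (dfn n) (@dintegrableZ _ (-1) _ (dfn m)) h1 (op_cvgZ (c := -1) (dfn m) h2).
  by rewrite mulN1r; congr (op_cvg A _ x _); apply/funext => z; rewrite mulN1r.
have e0 N : 0 <= e N by exact: Rintegral_ge0.
have small (d : R) : 0 < d -> exists N, c * e N <= d.
  move=> d0; have /cvgrPdist_le/(_ (d / c))[|N _ /(_ N (leqnn N))] := e_lim.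
    by rewrite divr_gt0.
  by rewrite sub0r normrN ger0_norm// ler_pdivlMr// mulrC => h; exists N.
have [|F mF hF] := L2_complete mG mnu nu0'.
  move=> d d0; have [N hN] := small d d0; exists N => n m Nn Nm.
  by apply: le_trans (diff N n m Nn Nm) _; rewrite lee_fin.
have mGF n : measurable_fun setT (fun x => G n x - F x) by exact: measurable_funB.
have LF : L2 nu F.
  have [N /(_ N (leqnn N)) h] := hF 1 ltr01.
  have [h1 _] := L2_le mnu nu0' (mGF N) h.
  have [h2 _] := L2B mnu nu0' (GL N).1 h1.
  by have -> : F = (fun x => G N x - (G N x - F x)) by apply/funext => x; ring.
have lim : norm2 nu (fun x => G n x - F x) @[n --> \oo] --> 0.
  apply/cvgrPdist_le => d d0; have [N hN] := hF (d ^+ 2) (exprn_gt0 2 d0).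
  exists N => // n /= Nn; have [_ h] := L2_le mnu nu0' (mGF n) (hN n Nn).
  rewrite sub0r normrN ger0_norm ?norm2_ge0//.
  by rewrite -(@ler_pXn2r _ 2)// ?nnegrE ?norm2_ge0// ltW.
exists F.
  by split => // n; split; [exact: (opn n).1|exact: (GL n).1].
by apply: (norm2_limit mnu nu0' (fun n => (GL n).1) LF lim) => n; exact: (GL n).2.
Qed.

End compact_bound_consequences.

(** * The equivalent forms of boundedness *)

Section scaling.
Context {R : realType}.
Local Notation leb := (@lebesgue_measure R).
Implicit Types (x y l : R) (K : dyadic) (f g b c e u v rho : R -> R).

Lemma L2_transfer rho rho' f f' : measurable_fun setT rho -> measurable_fun setT rho' ->
  measurable_fun setT f' -> {ae leb, forall x, f x ^+ 2 * rho x = f' x ^+ 2 * rho' x} ->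
  L2 rho f -> L2 rho' f'.
Proof.
move=> mr mr' mf' e [mf h]; split => //.
rewrite -(@ae_eq_int _ setT (fun x => (`|f x| ^+ 2 * rho x)%:E)) //.
- apply/measurable_EFinP; apply: measurable_funM => //; apply: measurable_funX.
  exact: measurableT_comp.
- apply/measurable_EFinP; apply: measurable_funM => //; apply: measurable_funX.
  exact: measurableT_comp.
- by apply: aeW e _ => x; rewrite !real_normK ?num_real// => ->.
Qed.

Lemma L2_inner f g : L2 (cst 1) f -> L2 (cst 1) g -> inner_defined f g /\
  `|inner f g| <= norm2 (cst 1) f * norm2 (cst 1) g.
Proof.
have m1 : measurable_fun setT (cst 1 : R -> R) by exact: measurable_cst.
have p1 x : 0 <= (cst 1 : R -> R) x by [].
move=> /(L2P m1 p1)[mf jf] /(L2P m1 p1)[mg jg].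
have [|i h] := cauchy_schwarz measurableT (measurable_funM mf mg) jf jg.
  by move=> x _; split; rewrite ?wsq_ge0// /wsq /= !mulr1 exprMn.
split => //; rewrite -(@ler_pXn2r _ 2)// ?nnegrE ?mulr_ge0 ?norm2_ge0//.
by rewrite exprMn !norm2_sqr// real_normK ?num_real.
Qed.

Section two_operators.
Variables (A B : @formal_op R) (c : R -> R).
Hypotheses (lA : forall f x, local_op A f x) (lB : forall f x, local_op B f x).
Hypotheses (mA : forall f, measurable_fun setT (op_val A f))
  (mB : forall f, measurable_fun setT (op_val B f)) (mc : measurable_fun setT c).
Hypothesis AB : {ae leb, forall x f K, B f K x = c x * A f K x}.

Lemma op_defined_scale f : op_defined A f -> op_defined B f /\
  {ae leb, forall x, op_val B f x = c x * op_val A f x}.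
Proof.
rewrite /op_defined => h.
have H : {ae leb, forall x, exists2 y, op_cvg A f x y & op_cvg B f x (c x * y)}.
  apply: aeW (aeI AB h) _ => x [hx /op_cvgP[y hy]]; exists y => //.
  have e : partial_sum B f x = fun mn => c x * partial_sum A f x mn.
    apply/funext => -[m n]; rewrite !partial_sumE//.
    by rewrite mulr_sumr; apply: eq_bigr => i _.
  by rewrite /op_cvg e; apply: cvgM => //; exact: cvg_cst.
split; apply: aeW H _ => x [y h1 h2]; first by apply/op_cvgP; exists (c x * y).
by rewrite (op_valE h1) (op_valE h2).
Qed.

(** Multiplication by [c] is an isometry of [L^2(v)] into [L^2(v')]. *)
Lemma bounded_op_scale u v v' : measurable_fun setT v -> measurable_fun setT v' ->
  {ae leb, forall x, v x = c x ^+ 2 * v' x} -> bounded_op A u v -> bounded_op B u v'.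
Proof.
move=> mv mv' e [C C0 H]; exists C => // f /H[F [LF hop lim] hF].
have mF : measurable_fun setT F by case: LF.
have mcF : measurable_fun setT (fun x => c x * F x) by exact: measurable_funM.
exists (fun x => c x * F x); last first.
  rewrite -(@norm2_ae _ v v' F) //.
  by apply: aeW e _ => x ->; rewrite exprMn; ring.
split.
- apply: (L2_transfer mv mv' mcF) LF.
  by apply: aeW e _ => x ->; rewrite exprMn; ring.
- move=> n; have [d L] := hop n; have [d' ev] := op_defined_scale d; split => //.
  apply: (L2_transfer mv mv' (mB _)) L.
  by apply: aeW (aeI e ev) _ => x [-> ->]; rewrite exprMn; ring.
- apply: cvg_trans lim; apply: near_eq_cvg; apply: nearW => n.
  have [d L] := hop n; have [_ ev] := op_defined_scale d.
  apply: norm2_ae => //; [exact: measurable_funB|exact: measurable_funB|].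
  by apply: aeW (aeI e ev) _ => x [-> ->]; ring.
Qed.

Lemma inner_value_scale b b' f g l : measurable_fun setT b -> measurable_fun setT b' ->
  measurable_fun setT g ->
  {ae leb, forall x, b x = b' x * c x} -> inner_value A b f g l -> inner_value B b' f g l.
Proof.
move=> mb mb' mg e [hop lim].
have H n : [/\ op_defined B (trunc n f), inner_defined (fun x => b' x * op_val B (trunc n f) x) g &
    inner (fun x => b x * op_val A (trunc n f) x) g =
    inner (fun x => b' x * op_val B (trunc n f) x) g].
  have [d i] := hop n; have [d' ev] := op_defined_scale d.
  have m1 : measurable_fun setT (fun x => b x * op_val A (trunc n f) x * g x).
    by apply: measurable_funM => //; exact: measurable_funM.
  have m2 : measurable_fun setT (fun x => b' x * op_val B (trunc n f) x * g x).
    by apply: measurable_funM => //; exact: measurable_funM.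
  have E : {ae leb, forall x, b x * op_val A (trunc n f) x * g x =
      b' x * op_val B (trunc n f) x * g x}.
    by apply: aeW (aeI e ev) _ => x [-> ->]; ring.
  split => //; last exact: (@mass_ae_eq _ _ _ setT).
  apply: ae_eq_integrable i => //; first exact/measurable_EFinP.
  by apply: aeW E _ => x -> _.
split; first by move=> n; have [] := H n.
apply: cvg_trans lim; apply: near_eq_cvg; apply: nearW => n.
by have [_ _ ->] := H n.
Qed.

End two_operators.

(** Duality. The operator is reached through the truncations, along which the inner
    products converge by the Cauchy-Schwarz inequality. *)
Lemma bounded_form (A : @formal_op R) u v b e :
  (forall f, measurable_fun setT (op_val A f)) ->
  measurable_fun setT u -> measurable_fun setT v -> measurable_fun setT b ->
  measurable_fun setT e -> {ae leb, forall x, b x ^+ 2 = v x} ->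
  {ae leb, forall x, e x ^+ 2 * u x = 1} -> bounded_op A u v ->
  exists2 C : R, 0 < C & forall f g, L2 (cst 1) f -> L2 (cst 1) g ->
    exists2 l, inner_value A b (fun x => e x * f x) g l &
      l <= C * norm2 (cst 1) f * norm2 (cst 1) g.
Proof.
move=> mA mu mv mb me bv eu [C C0 H]; exists C => // f g Lf Lg.
have m1 : measurable_fun setT (cst 1 : R -> R) by exact: measurable_cst.
have mf : measurable_fun setT f by case: Lf.
have mef : measurable_fun setT (fun x => e x * f x) by exact: measurable_funM.
have eE : {ae leb, forall x, f x ^+ 2 * (cst 1 : R -> R) x = (e x * f x) ^+ 2 * u x}.
  by apply: aeW eu _ => x h; rewrite /= exprMn [RHS]mulrAC h mul1r mulr1.
have Lef : L2 u (fun x => e x * f x) by exact: L2_transfer eE Lf.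
have [F [LF hop lim] hF] := H _ Lef.
have bE G : {ae leb, forall x, G x ^+ 2 * v x = (b x * G x) ^+ 2 * (cst 1 : R -> R) x}.
  by apply: aeW bv _ => x <-; rewrite /= exprMn mulr1 mulrC.
have mbG G : measurable_fun setT G -> measurable_fun setT (fun x => b x * G x).
  by move=> mG; exact: measurable_funM.
have bL G : L2 v G -> L2 (cst 1) (fun x => b x * G x).
  by move=> LG; apply: (L2_transfer mv m1 _ (bE G) LG); apply: mbG; case: LG.
have bN G : measurable_fun setT G -> norm2 (cst 1) (fun x => b x * G x) = norm2 v G.
  by move=> mG; apply: esym; apply: norm2_ae (bE G) => //; exact: mbG.
have mF : measurable_fun setT F by case: LF.
pose Gn n := op_val A (trunc n (fun x => e x * f x)).
have mG n : measurable_fun setT (Gn n) by exact: mA.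
have [iF bF] := L2_inner (bL _ LF) Lg.
exists (inner (fun x => b x * F x) g); last first.
  apply: le_trans (ler_norm _) _; apply: le_trans bF _.
  apply: ler_wpM2r; first exact: norm2_ge0.
  rewrite bN//; apply: le_trans hF _; rewrite le_eqVlt; apply/orP; left; apply/eqP.
  by congr (_ * _); apply: esym; exact: norm2_ae eE.
split.
  move=> n; split; first exact: (hop n).1.
  exact: (L2_inner (bL _ (hop n).2) Lg).1.
apply/cvgrPdist_le => d d0.
have [d1 d10 hd] : exists2 d1 : R, 0 < d1 & d1 * norm2 (cst 1) g <= d.
  have n1 : 0 < norm2 (cst 1) g + 1 by rewrite ltr_wpDl// norm2_ge0.
  exists (d / (norm2 (cst 1) g + 1)); first by rewrite divr_gt0.
  by rewrite mulrAC ler_pdivrMr// ler_pM2l// lerDl.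
have /cvgrPdist_le/(_ d1 d10)[N _ hN] := lim; exists N => // n /= Nn.
have := hN n Nn; rewrite sub0r normrN ger0_norm ?norm2_ge0// => hn.
have [iG _] := L2_inner (bL _ (hop n).2) Lg.
have LGF : L2 (cst 1) (fun x => b x * Gn n x - b x * F x).
  exact: (L2B m1 _ (bL _ (hop n).2) (bL _ LF)).1.
have [_ hi] := L2_inner LGF Lg.
have eI : inner (fun x => b x * Gn n x - b x * F x) g =
    inner (fun x => b x * Gn n x) g - inner (fun x => b x * F x) g.
  rewrite /inner -RintegralB//; congr Rintegral; apply/funext => x; ring.
rewrite distrC -eI; apply: le_trans hi _; apply: le_trans hd.
apply: ler_wpM2r; first exact: norm2_ge0.
have -> : (fun x => b x * Gn n x - b x * F x) = (fun x => b x * (Gn n x - F x)).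
  by apply/funext => x; ring.
by rewrite bN//; exact: measurable_funB.
Qed.

End scaling.

Section from_form.
Context {R : realType}.
Local Notation leb := (@lebesgue_measure R).
Implicit Types (x y l : R) (K : dyadic) (f g b c e u v rho w : R -> R).
Variables (a : dyadic -> R) (mu nu : R -> R).
Hypotheses (wmu : pos_weight mu) (wnu : pos_weight nu).
Local Notation A := (haar_mult (R := R) a).
Let mnu : measurable_fun setT nu. Proof. by case: wnu. Qed.
Let mu0 x : 0 < mu x. Proof. by case: wmu. Qed.
Let mT f : measurable_fun setT (op_val A f). Proof. exact: measurable_haar_mult. Qed.

(** Duality again: the form is tested against the function [b * A f] itself, cut
    to the bounded sets where it is bounded. *)
Lemma form_compact_bound b e (C : R) : measurable_fun setT b -> measurable_fun setT e ->
  {ae leb, forall x, b x ^+ 2 = nu x} -> {ae leb, forall x, e x ^+ 2 = mu x} ->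
  0 < C -> (forall f g, L2 (cst 1) f -> L2 (cst 1) g ->
    exists2 l, inner_value A b (fun x => e x * f x) g l &
      l <= C * norm2 (cst 1) f * norm2 (cst 1) g) ->
  compact_bound a mu nu (C ^+ 2).
Proof.
move=> mb me bnu emu C0 H f M mf fM ie.
have m1 : measurable_fun setT (cst 1 : R -> R) by exact: measurable_cst.
have p1 x : 0 <= (cst 1 : R -> R) x by [].
pose f0 x := f x * e x * (mu x)^-1.
have mi : measurable_fun setT (fun x => (mu x)^-1) by exact: measurable_inv_weight.
have mf0 : measurable_fun setT f0.
  by apply: measurable_funM => //; exact: measurable_funM.
have ef0 : {ae leb, forall x, e x * f0 x = f x}.
  apply: aeW emu _ => x h; rewrite /f0.
  have -> : e x * (f x * e x * (mu x)^-1) = f x * (e x ^+ 2 / mu x) by ring.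
  by rewrite h divff ?mulr1// gt_eqF.
have sf0 : {ae leb, forall x, f x ^+ 2 * (mu x)^-1 = f0 x ^+ 2 * (cst 1 : R -> R) x}.
  apply: aeW emu _ => x h; rewrite /f0 /= mulr1 !exprMn h; have := mu0 x.
  by move: (mu x) => z z0; field; rewrite gt_eqF.
have i0 x : 0 <= (mu x)^-1 by rewrite invr_ge0 ltW.
have Lf : L2 (fun x => (mu x)^-1) f by apply/(L2P mi i0).
have Lf0 : L2 (cst 1) f0 by exact: L2_transfer sf0 Lf.
have nf0 : norm2 (cst 1) f0 ^+ 2 = mass (energy mu f) setT.
  by rewrite -(norm2_ae mi m1 mf mf0 sf0) (norm2_sqr i0).
have tr : exists N, forall n, (N <= n)%N -> A (trunc n (fun x => e x * f0 x)) = A f.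
  exists (Num.truncn M).+1 => n Nn; apply: haar_mult_ae => //.
    by apply: measurable_trunc; exact: measurable_funM.
  apply: aeW ef0 _ => x h; have [xn|xn] := leP `|x| n%:R.
    by rewrite trunc_in.
  rewrite trunc_out// fM//; apply: lt_trans xn; apply: lt_le_trans (truncnS_gt _) _.
  by rewrite ler_nat.
have [N hN] := tr.
have eA n : (N <= n)%N -> op_val A (trunc n (fun x => e x * f0 x)) = op_val A f.
  by move=> Nn; apply/funext => x; rewrite /op_val /partial_sum hN.
pose G x := b x * op_val A f x.
have mG : measurable_fun setT G by exact: measurable_funM.
split.
  have L0 : L2 (cst 1) (cst 0 : R -> R).
    split; first exact: measurable_cst.
    rewrite (_ : (fun x => _) = cst 0%E) ?integral0//.
    by apply/funext => x; rewrite /= normr0 expr0n mul0r.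
  have [l [hop _] _] := H _ _ Lf0 L0.
  by have := (hop N).1; rewrite /op_defined /partial_sum hN.
pose E n : set R := [set x | `|G x| <= n%:R] `&` [set x | `|x| <= n%:R].
have mE n : measurable (E n).
  apply: measurableI; rewrite -[X in measurable X]setTI.
    apply: (measurable_fun_le measurableT); last exact: measurable_cst.
    exact: measurableT_comp mG.
  by apply: (measurable_fun_le measurableT) => //; exact: measurable_cst.
rewrite (@ae_eq_int _ setT _ (fun x => (G x ^+ 2)%:E))//; last first.
- by apply: aeW bnu _ => x h _; rewrite /G exprMn h mulrC.
- by apply/measurable_EFinP; exact: measurable_funX.
- exact: measurable_sqr_mul.
apply: (@exhaust_le _ setT E) => //.
- exact: measurable_funX.
- by move=> x _; exact: sqr_ge0.
- apply: ae_all => x _.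
  exists (maxn (Num.truncn `|G x|).+1 (Num.truncn `|x|).+1) => n.
  rewrite geq_max => /andP[h1 h2].
  by split; rewrite /= (le_trans (ltW (truncnS_gt _)))// ler_nat.
move=> n; rewrite setTI.
pose g := cut (E n) G.
have mg : measurable_fun setT g by exact: measurable_cut.
have gg x : g x ^+ 2 = cut (E n) (fun x => G x ^+ 2) x.
  by have [h|h] := pselect (E n x); rewrite /g ?(cut_in _ h)// !(cut_out _ h) expr0n.
have Gg x : G x * g x = g x ^+ 2.
  by have [h|h] := pselect (E n x); rewrite /g ?(cut_in _ h)// !(cut_out _ h) expr0n mulr0.
have iE : leb.-integrable setT (EFin \o cut (E n) (fun x => (n%:R : R) ^+ 2)).
  apply: integrable_cut => //; apply: (@integrableS _ _ _ leb `[- n%:R, n%:R]%classic) => //; first exact: mE.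
    by move=> x [_ h]; move: h; rewrite /= in_itv/= ler_norml.
  apply: (@integrable_ge0 _ _ _ (n%:R ^+ 2 * (n%:R + n%:R))) => //.
  rewrite integral_cst//= lebesgue_measure_itv/= lte_fin.
  case: ifP => _; last by rewrite mule0 lee_fin mulr_ge0 ?sqr_ge0// addr_ge0.
  by rewrite -EFinB -EFinM opprK.
have ig : leb.-integrable setT (EFin \o (fun x => g x ^+ 2)).
  apply: (@le_integrable _ _ _ leb _ measurableT) iE.
    by apply/measurable_EFinP; exact: measurable_funX.
  move=> x _ /=; rewrite lee_fin; apply: le_trans (ler_norm _).
  rewrite gg ger0_norm; last by rewrite -gg sqr_ge0.
  have [h|h] := pselect (E n x); last by rewrite !(cut_out _ h).
  rewrite !(cut_in _ h) -[leLHS]real_normK ?num_real//.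
  by apply: lerXn2r; rewrite ?nnegrE//; case: h.
have eg1 : wsq (cst 1) g = (fun x => g x ^+ 2) by apply/funext => x; rewrite /wsq /= mulr1.
have Lg : L2 (cst 1) g by apply/(L2P m1 p1); rewrite eg1.
have ng : norm2 (cst 1) g ^+ 2 = mass (fun x => g x ^+ 2) setT.
  by rewrite (norm2_sqr p1) eg1.
have [l [hop lim] hl] := H _ _ Lf0 Lg.
have el : norm2 (cst 1) g ^+ 2 = l.
  rewrite ng; apply/esym; apply: (cvg_unique (@Rhausdorff R) lim).
  apply: cvg_near_cst; exists N => // k /= Nk; rewrite eA// /inner /mass.
  by congr Rintegral; apply/funext => x; exact: Gg.
have -> : (\int[leb]_(x in E n) (G x ^+ 2)%:E = (norm2 (cst 1) g ^+ 2)%:E)%E.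
  rewrite ng /mass -(integral_EFinE measurableT ig) -(int_cut (E n) (fun x => G x ^+ 2)).
  by apply: eq_integral => x _; rewrite -gg.
rewrite lee_fin -nf0 -exprMn.
have p0 : 0 <= C * norm2 (cst 1) f0 := mulr_ge0 (ltW C0) (norm2_ge0 _ _).
apply: lerXn2r; rewrite ?nnegrE ?norm2_ge0//.
have [->//|gn] := eqVneq (norm2 (cst 1) g) 0.
have gp : 0 < norm2 (cst 1) g by rewrite lt_def gn norm2_ge0.
by move: hl; rewrite -el expr2 ler_pM2r.
Qed.

End from_form.

Section haar_averages.
Context {R : realType}.
Local Notation leb := (@lebesgue_measure R).
Implicit Types (x y : R) (K : dyadic) (f g w : R -> R).
Variables (w : R -> R) (sigma : dyadic -> R) (t : R).
Hypotheses (hw : weight w) (hsigma : forall I, sigma I = 1 \/ sigma I = -1).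

Let mw : measurable_fun setT w. Proof. by case: hw => -[]. Qed.

Lemma average_gt0 K : 0 < average w K.
Proof.
have [ww ew] := weight_version hw; have [mpw _ _] := ww.
rewrite /average mulr_gt0 ?invr_gt0 ?len_gt0//.
rewrite -/(mass w _) -(mass_ae_eq (measurable_ditv K) _ _ ew) ?mass_gt0//.
  exact: measurable_funTS.
exact: measurable_funTS.
Qed.

Lemma cvg_powR (p y : R) : 0 < y -> z `^ p @[z --> y] --> y `^ p.
Proof.
move=> y0; have : expR (p * ln z) @[z --> y] --> expR (p * ln y).
  apply: (@continuous_cvg _ R R _ _ (fun z => p * ln z) expR); first exact: continuous_expR.
  by apply: cvgM; [exact: cvg_cst|exact: continuous_ln].
have <- : y `^ p = expR (p * ln y) by rewrite /powR gt_eqF.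
apply: cvg_trans; apply: near_eq_cvg.
near=> z; rewrite /powR gt_eqF//; near: z; exact: lt_nbhsr.
Unshelve. all: end_near. Qed.

(** Along almost every branch the averages of [w] converge to [w x > 0]. *)
Lemma coefficients_bounded : locally_bounded (R := R) (fun K => sigma K / average w K `^ t).
Proof.
have [lw w0] := hw.
have iw : dintegrable w by exact: local_dintegrable.
have H (j : nat) : {ae leb, forall x, forall s : bool,
    mass w (ditv (cell ((if s then j%:Z else - j%:Z) + n%:Z) x)) /
    len (cell ((if s then j%:Z else - j%:Z) + n%:Z) x) @[n --> \oo] --> w x}.
  apply: aeW (aeI (dyadic_lebesgue_from j%:Z mw iw) (dyadic_lebesgue_from (- j%:Z) mw iw)) _.
  by move=> x [h1 h2] [].
apply: aeW (aeI w0 (ae_forall_nat H)) _ => x [wx hx] j.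
have {hx} h : mass w (ditv (cell (j + n%:Z) x)) / len (cell (j + n%:Z) x) @[n --> \oo] --> w x.
  have e : (if 0 <= j then (absz j)%:Z else - (absz j)%:Z) = j by case: ifP; lia.
  by have := hx (absz j) (0 <= j); rewrite e.
have {}h : (average w (cell (j + n%:Z) x) `^ t)^-1 @[n --> \oo] --> (w x `^ t)^-1.
  apply: cvgV; first by rewrite gt_eqF// powR_gt0.
  apply: (@continuous_cvg _ R R _ _ _ (fun z => z `^ t)); first exact: cvg_powR.
  by under eq_cvg do rewrite /average mulrC.
have [B hB] := cvgn_bounded h; exists B => n; rewrite normrM.
by have [->|->] := hsigma (cell (j + n%:Z) x); rewrite ?normrN normr1 mul1r.
Qed.

Lemma T_haarE x : 0 < w x -> forall f K,
  T_haar w sigma t f K x = w x `^ t * T_sigma_T_w w sigma t f K x.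
Proof.
move=> wx f K; rewrite /T_haar /T_sigma_T_w powRM ?(ltW wx)//; last first.
  by rewrite invr_ge0 ltW// average_gt0.
have -> : (average w K)^-1 `^ t = (average w K `^ t)^-1.
  by rewrite -powR_inv1 ?(ltW (average_gt0 _))// -powRrM mulN1r powRN.
by ring.
Qed.

Lemma T_haar_local f x : local_op (T_haar w sigma t) f x.
Proof. by move=> K Kx; rewrite /T_haar -/(haar K x); have := Kx; rewrite /haar => hx;
  rewrite -/(haar_sign K x) haar_sign_out// !mulr0. Qed.

Lemma measurable_T_haar f : measurable_fun setT (op_val (T_haar w sigma t) f).
Proof.
apply: measurable_op_val => [x|K]; first exact: T_haar_local.
apply: measurable_funM; last exact: measurable_haar.
apply: measurable_funM; last exact: measurable_cst.
apply: measurable_funM; first exact: measurable_cst.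
apply: (measurableT_comp (measurable_powR _)).
by apply: measurable_funM => //; exact: measurable_cst.
Qed.

End haar_averages.

Section testing_conditions.
Context {R : realType}.
Local Notation leb := (@lebesgue_measure R).
Implicit Types (x y : R) (I J K : dyadic) (f g mu nu : R -> R) (D : dyadic -> set R).
Variables (a : dyadic -> R).
Local Notation A := (haar_mult (R := R) a).
Let mT f : measurable_fun setT (op_val A f). Proof. exact: measurable_haar_mult. Qed.

Lemma partial_sum_ae f g : measurable_fun setT f -> measurable_fun setT g ->
  {ae leb, forall x, f x = g x} -> partial_sum A f = partial_sum A g.
Proof. by move=> mf mg e; rewrite /partial_sum (haar_mult_ae _ mf mg e). Qed.

Lemma cut_ae (E : set R) f g : {ae leb, forall x, f x = g x} ->
  {ae leb, forall x, cut E f x = cut E g x}.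
Proof. by move=> e; apply: aeW e _ => x h; rewrite /cut h. Qed.

Lemma bounded_op_ae u u' v v' : measurable_fun setT u -> measurable_fun setT u' ->
  measurable_fun setT v -> measurable_fun setT v' ->
  {ae leb, forall x, u x = u' x} -> {ae leb, forall x, v x = v' x} ->
  bounded_op A u v -> bounded_op A u' v'.
Proof.
move=> mu mu' mv mv' eu ev [C C0 H].
have : bounded_op A u' v.
  exists C => // f Lf; have mf : measurable_fun setT f by case: Lf.
  have eu' : {ae leb, forall x, u' x = u x} by apply: aeW eu _ => x ->.
  have [F h1 h2] := H _ (L2_ae mu' mu eu' Lf); exists F => //.
  rewrite (@norm2_ae _ u' u f f)//.
  by apply: aeW eu _ => x ->.
apply: (@bounded_op_scale _ A A (cst 1)) => //.
- by move=> f x; exact: haar_mult_local.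
- by move=> f x; exact: haar_mult_local.
- by apply: ae_all => x f K; rewrite mul1r.
- by apply: aeW ev _ => x ->; rewrite expr1n mul1r.
Qed.

Lemma int_normr nu f (E : set R) : (\int[leb]_(x in E) (`|f x| ^+ 2 * nu x)%:E =
  \int[leb]_(x in E) (f x ^+ 2 * nu x)%:E)%E.
Proof. by apply: eq_integral => x _; rewrite real_normK ?num_real. Qed.

Lemma testingE mu nu D C : testing A mu nu D C <-> forall I,
  {ae leb, forall x, D I x -> cvg (partial_sum A (cut (ditv I) mu) x @ filter_prod \oo \oo)} /\
  (\int[leb]_(x in D I) (op_val A (cut (ditv I) mu) x ^+ 2 * nu x)%:E <=
    (C * mass mu (ditv I))%:E)%E.
Proof.
by split=> H I; have := H I; rewrite -int_normr.
Qed.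

Lemma weak_testingE mu nu C : weak_testing A mu nu C <-> forall I J, @len R I = len J ->
  [/\ op_defined A (cut (ditv I) mu), inner_defined (op_val A (cut (ditv I) mu)) (cut (ditv J) nu) &
    `|inner (op_val A (cut (ditv I) mu)) (cut (ditv J) nu)| <=
      C * Num.sqrt (mass mu (ditv I) * mass nu (ditv J))].
Proof. by []. Qed.

Lemma testing_ae mu mu' nu nu' D C : (forall I, measurable (D I)) ->
  measurable_fun setT mu -> measurable_fun setT mu' ->
  measurable_fun setT nu -> measurable_fun setT nu' ->
  {ae leb, forall x, mu x = mu' x} -> {ae leb, forall x, nu x = nu' x} ->
  testing A mu nu D C -> testing A mu' nu' D C.
Proof.
move=> mD mm mm' mn mn' em en /testingE H; apply/testingE => I; have [h1 h2] := H I.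
have mI := measurable_ditv I : measurable (ditv I : set R).
have e := partial_sum_ae (measurable_cut mI mm') (measurable_cut mI mm)
  (cut_ae _ (aeW em (fun x h => esym h))).
have eo : op_val A (cut (ditv I) mu') = op_val A (cut (ditv I) mu).
  by rewrite /op_val e.
rewrite e eo; split => //.
rewrite -(mass_ae_eq mI (measurable_funTS mm) (measurable_funTS mm') em).
rewrite (@ae_eq_int _ (D I) _ (fun x => (op_val A (cut (ditv I) mu) x ^+ 2 * nu x)%:E))//.
- by apply: measurable_sqr_mul; exact: measurable_funTS.
- by apply: measurable_sqr_mul; exact: measurable_funTS.
- by apply: aeW en _ => x ->.
Qed.

Lemma weak_testing_ae mu mu' nu nu' C :
  measurable_fun setT mu -> measurable_fun setT mu' ->
  measurable_fun setT nu -> measurable_fun setT nu' ->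
  {ae leb, forall x, mu x = mu' x} -> {ae leb, forall x, nu x = nu' x} ->
  weak_testing A mu nu C -> weak_testing A mu' nu' C.
Proof.
move=> mm mm' mn mn' em en /weak_testingE H; apply/weak_testingE => I J IJ.
have [h1 h2 h3] := H I J IJ.
have mI := measurable_ditv I : measurable (ditv I : set R).
have mJ := measurable_ditv J : measurable (ditv J : set R).
have e := partial_sum_ae (measurable_cut mI mm') (measurable_cut mI mm)
  (cut_ae _ (aeW em (fun x h => esym h))).
have eo : op_val A (cut (ditv I) mu') = op_val A (cut (ditv I) mu).
  by rewrite /op_val e.
have E : {ae leb, forall x, op_val A (cut (ditv I) mu) x * cut (ditv J) nu x =
    op_val A (cut (ditv I) mu) x * cut (ditv J) nu' x}.
  by apply: aeW (cut_ae (ditv J) en) _ => x ->.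
have m1 : measurable_fun setT (fun x => op_val A (cut (ditv I) mu) x * cut (ditv J) nu x).
  by apply: measurable_funM => //; exact: measurable_cut.
have m2 : measurable_fun setT (fun x => op_val A (cut (ditv I) mu) x * cut (ditv J) nu' x).
  by apply: measurable_funM => //; exact: measurable_cut.
rewrite eo; split.
- by rewrite /op_defined e.
- apply: ae_eq_integrable h2 => //; first exact/measurable_EFinP.
  by apply: aeW E _ => x -> _.
- rewrite -(mass_ae_eq mI (measurable_funTS mm) (measurable_funTS mm') em).
  rewrite -(mass_ae_eq mJ (measurable_funTS mn) (measurable_funTS mn') en).
  have <- : inner (op_val A (cut (ditv I) mu)) (cut (ditv J) nu) =
    inner (op_val A (cut (ditv I) mu)) (cut (ditv J) nu').
    exact: (mass_ae_eq measurableT m1 m2 E).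
  exact: h3.
Qed.

Lemma testing_mono mu nu D C C' : (forall K, 0 <= mass mu (ditv K)) -> C <= C' ->
  testing A mu nu D C -> testing A mu nu D C'.
Proof.
move=> m0 CC /testingE H; apply/testingE => I; have [h1 h2] := H I.
split => //; apply: le_trans h2 _.
by rewrite lee_fin ler_wpM2r.
Qed.

Variables (mu nu : R -> R).
Hypotheses (wmu : pos_weight mu) (wnu : pos_weight nu).
Let mmu : measurable_fun setT mu. Proof. by case: wmu. Qed.
Let imu : dintegrable mu. Proof. by case: wmu. Qed.
Let mnu : measurable_fun setT nu. Proof. by case: wnu. Qed.
Let inu : dintegrable nu. Proof. by case: wnu. Qed.
Let nu0 x : 0 < nu x. Proof. by case: wnu. Qed.
Let m0 K : 0 < mass mu (ditv K). Proof. exact: mass_gt0. Qed.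
Let n0 K : 0 < mass nu (ditv K). Proof. exact: mass_gt0. Qed.

Lemma compact_bound_global c : locally_bounded (R := R) a -> 0 <= c -> compact_bound a mu nu c ->
  testing A mu nu (fun _ => setT) c /\ testing A nu mu (fun _ => setT) c.
Proof.
move=> ba c0 cb; split; apply/testingE => I.
  have [h1 h2] := compact_bound_testing wmu cb I; rewrite /op_defined in h1.
  by split => //; apply: aeW h1 _.
have h1 := op_defined_cut wnu ba I (compact_bound_tails wmu cb); rewrite /op_defined in h1.
split; first exact: aeW h1 _.
exact: (compact_bound_dual wmu wnu I ba c0 cb).
Qed.

Lemma global_local_testing f g C : measurable_fun setT g -> (forall x, 0 <= g x) ->
  testing A f g (fun _ => setT) C -> testing A f g (fun I => ditv I) C.
Proof.
move=> mg g0 /testingE H; apply/testingE => I; have [h1 h2] := H I; split.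
  by apply: aeW h1 _ => x h _; exact: h.
apply: le_trans h2.
apply: ge0_subset_integral => //; first exact: measurable_ditv.
  exact: measurable_sqr_mul.
by move=> x _; rewrite lee_fin mulr_ge0 ?sqr_ge0.
Qed.

Lemma global_weak_testing C : 0 < C -> testing A mu nu (fun _ => setT) C ->
  weak_testing A mu nu (C + 1).
Proof.
move=> C0 /testingE H; apply/weak_testingE => I J _; have [h1 h2] := H I.
have nu0' x : 0 <= nu x by exact: ltW.
have iG : leb.-integrable setT (EFin \o (fun x => op_val A (cut (ditv I) mu) x ^+ 2 * nu x)).
  apply: (integrable_ge0 _ _ h2); last by move=> x _; rewrite mulr_ge0 ?sqr_ge0.
  by apply: measurable_funM => //; exact: measurable_funX.
have mJ := measurable_ditv J : measurable (ditv J : set R).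
have mg : measurable_fun setT (fun x => op_val A (cut (ditv I) mu) x * cut (ditv J) nu x).
  by apply: measurable_funM => //; exact: measurable_cut.
have [|i cs] := cauchy_schwarz measurableT mg iG (integrable_cut mJ mnu (inu J)).
  move=> x _; split; first by rewrite mulr_ge0 ?sqr_ge0.
    by rewrite /cut mulr_ge0.
  rewrite exprMn -mulrA ler_wpM2l ?sqr_ge0//.
  by have [h|h] := pselect (ditv J x); rewrite ?(cut_in _ h) ?(cut_out _ h) ?expr2 ?mulr0.
rewrite -!/(mass _ _) mass_cut in cs.
have hm : mass (fun x => op_val A (cut (ditv I) mu) x ^+ 2 * nu x) setT <= C * mass mu (ditv I).
  by rewrite /mass -lee_fin -(integral_EFinE measurableT iG).
split => //; first by rewrite /op_defined; apply: aeW h1 _ => x; exact.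
have p0 : 0 <= (C + 1) * Num.sqrt (mass mu (ditv I) * mass nu (ditv J)).
  by apply: mulr_ge0; [lra|exact: sqrtr_ge0].
rewrite -(@ler_pXn2r _ 2)// ?nnegrE// real_normK ?num_real// exprMn sqr_sqrtr; last first.
  by apply: mulr_ge0; exact: ltW.
apply: le_trans cs _; apply: le_trans (ler_wpM2r (ltW (n0 J)) hm) _.
rewrite -mulrA; apply: ler_wpM2r; first by apply: mulr_ge0; exact: ltW.
by rewrite expr2; nra.
Qed.

(** The weak testing condition, for the two halves of [K], bounds [cross a K]: on one
    half, the testing function of the other half is constant. *)
Lemma local_compact_bound C : locally_bounded (R := R) a -> 0 < C ->
  weak_testing A mu nu C -> testing A mu nu (fun I => ditv I) C ->
  testing A nu mu (fun I => ditv I) C ->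
  exists2 c, 0 < c & compact_bound a mu nu c.
Proof.
move=> ba C0 W T1 T2.
have sa : summable_tails a.
  by apply: (testing_tails wmu) => K; have [] := (testingE _ _ _ _).1 T1 K.
pose C' := C + 1.
have CC' : C <= C' by rewrite lerDl.
have C1 : 1 <= C' by rewrite lerDr ltW.
have t1 : tested a mu nu C'.
  by move=> K; have [] := (testingE _ _ _ _).1 (testing_mono (fun K => ltW (m0 K)) CC' T1) K.
have t2 : tested a nu mu C'.
  by move=> K; have [] := (testingE _ _ _ _).1 (testing_mono (fun K => ltW (n0 K)) CC' T2) K.
exists (4 * (1 + 50 * C') ^+ 2); first by rewrite mulr_gt0// exprn_gt0//; lra.
apply: testing_compact_bound => // K.
have [l1 l2] := @len_half R K.
have [_ _] := (weak_testingE _ _ _).1 W (left_half K) (right_half K) (etrans l1 (esym l2)).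
set p := mass mu (ditv (left_half K)); set q := mass nu (ditv (right_half K)).
have p0 : 0 < p by exact: m0.
have q0 : 0 < q by exact: n0.
have -> : inner (op_val A (cut (ditv (left_half K)) mu)) (cut (ditv (right_half K)) nu) =
    cross a K * p * q.
  have -> : inner (op_val A (cut (ditv (left_half K)) mu)) (cut (ditv (right_half K)) nu) =
      mass (fun x => cross a K * p * cut (ditv (right_half K)) nu x) setT.
    congr Rintegral; apply/funext => x.
    have [h|h] := pselect (ditv (right_half K) x); last by rewrite !(cut_out _ h) !mulr0.
    congr (_ * _); apply: op_valE.
    have -> : p = mass (cut (ditv (left_half K)) mu) (ditv K).
      rewrite (mass_supported (D := ditv (left_half K))) ?mass_cut_in//; first exact: supported_cut.
      by move=> y /ditv_left.
    apply: op_cvg_sibling => //; first exact: dcut.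
    by left; split => //; exact: supported_cut.
  rewrite /mass RintegralZl//; last first.
    by apply: integrable_cut => //; exact: measurable_ditv.
  by rewrite -/(mass _ _) mass_cut.
move=> h.
have pq0 : 0 < p * q by exact: mulr_gt0.
have : (cross a K * p * q) ^+ 2 <= C ^+ 2 * (p * q).
  rewrite -real_normK ?num_real// -[X in _ <= _ * X](sqr_sqrtr (ltW pq0)) -exprMn.
  by apply: lerXn2r h; rewrite nnegrE// mulr_ge0 ?sqrtr_ge0// ltW.
have -> : (cross a K * p * q) ^+ 2 = cross a K ^+ 2 * (p * q) * (p * q) by ring.
rewrite ler_pM2r// => /le_trans; apply.
by apply: lerXn2r; rewrite ?nnegrE ?(ltW C0)// (le_trans ler01).
Qed.

End testing_conditions.

(** * The equivalence *)

Theorem proposition3 (R : realType) (u v w : R -> R) (t : R)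
    (sigma : dyadic -> R)
    (hu : weight u) (hv : weight v) (hw : weight w)
    (hui : weight (fun x => (u x)^-1))
    (hvw : weight (fun x => v x * w x `^ (2 * t)))
    (hsigma : forall I, sigma I = 1 \/ sigma I = -1) :
  let ui := fun x => (u x)^-1 in
  let vw := fun x => v x * w x `^ (2 * t) in
  let T := T_haar w sigma t in
  let S := T_sigma_T_w w sigma t in
  [<->
    (* 1 *)
    bounded_op T u v;
    (* 2 *)
    bounded_op S u vw;
    (* 3 *)
    exists2 C : R, 0 < C & forall f g : R -> R, L2 (cst 1) f -> L2 (cst 1) g ->
      exists2 l : R,
        inner_value T (fun x => v x `^ 2^-1) (fun x => u x `^ (- 2^-1) * f x)
          g l &
        l <= C * norm2 (cst 1) f * norm2 (cst 1) g;
    (* 4 *)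
    exists2 C : R, 0 < C & forall f g : R -> R, L2 (cst 1) f -> L2 (cst 1) g ->
      exists2 l : R,
        inner_value S (fun x => v x `^ 2^-1 * w x `^ t)
          (fun x => u x `^ (- 2^-1) * f x) g l &
        l <= C * norm2 (cst 1) f * norm2 (cst 1) g;
    (* 5 *)
    exists2 C : R, 0 < C &
      testing S ui vw (fun _ => [set: R]) C /\
      testing S vw ui (fun _ => [set: R]) C;
    (* 6 *)
    exists2 C : R, 0 < C &
      [/\ weak_testing S ui vw C,
          testing S ui vw (fun I => ditv I) C &
          testing S vw ui (fun I => ditv I) C]].
Proof.
move=> ui vw T S.
pose a K : R := sigma K / average w K `^ t.
pose mu := positive_version ui; pose nu := positive_version vw.
have [wmu emu] := weight_version hui; have [wnu enu] := weight_version hvw.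
rewrite -/ui -/mu in wmu emu; rewrite -/vw -/nu in wnu enu.
have [mmu imu mu0] := wmu; have [mnu inu nu0] := wnu.
have mu_ : measurable_fun setT u by case: hu => -[].
have mv : measurable_fun setT v by case: hv => -[].
have mw : measurable_fun setT w by case: hw => -[].
have mui : measurable_fun setT ui by case: hui => -[].
have mvw : measurable_fun setT vw by case: hvw => -[].
have [[[_ u0] [_ v0]] [_ w0]] := (hu, hv, hw).
have ba : locally_bounded (R := R) a by exact: coefficients_bounded.
have mi : measurable_fun setT (fun x => (mu x)^-1) by exact: measurable_inv_weight.
have eu : {ae lebesgue_measure, forall x, (mu x)^-1 = u x}.
  by apply: aeW emu _ => x ->; rewrite /ui invrK.
have mp (f : R -> R) p : measurable_fun setT f -> measurable_fun setT (fun x => f x `^ p).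
  by move=> mf; exact: (measurableT_comp (measurable_powR _) mf).
have lT f x : local_op T f x by exact: T_haar_local.
have lS f x : local_op S f x by exact: haar_mult_local.
have mT f : measurable_fun setT (op_val T f) by exact: measurable_T_haar.
have mS f : measurable_fun setT (op_val S f) by exact: measurable_haar_mult.
have wt x : 0 < w x -> w x `^ (2 * t) = (w x `^ t) ^+ 2.
  by move=> wx; rewrite mulrC powRrM powR_mulrn// powR_ge0.
have wN x : 0 < w x -> w x `^ (- t) * w x `^ t = 1.
  by move=> wx; rewrite powRN mulVf// gt_eqF// powR_gt0.
have TS : {ae lebesgue_measure, forall x f K, S f K x = w x `^ (- t) * T f K x}.
  by apply: aeW w0 _ => x wx f K; rewrite /T T_haarE// mulrA wN// mul1r.
have ST : {ae lebesgue_measure, forall x f K, T f K x = w x `^ t * S f K x}.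
  by apply: aeW w0 _ => x wx f K; exact: T_haarE.
have P12 : bounded_op T u v -> bounded_op S u vw.
  apply: (bounded_op_scale lT lS mT mS (mp w (- t) mw) TS mv mvw).
  apply: aeW w0 _ => x wx; rewrite /vw wt// mulrCA -exprMn wN//.
  by rewrite expr1n mulr1.
have P21 : bounded_op S u vw -> bounded_op T u v.
  apply: (bounded_op_scale lS lT mS mT (mp w t mw) ST mvw mv).
  by apply: aeW w0 _ => x wx; rewrite /vw wt// mulrC.
have core2 c : 0 < c -> compact_bound a mu nu c -> bounded_op S u vw.
  move=> c0 /(compact_bound_bounded wmu wnu c0).
  exact: bounded_op_ae.
have mhalf (f : R -> R) : measurable_fun setT f -> measurable_fun setT (fun x => f x `^ 2^-1).
  exact: mp.
have sq_half (y : R) : 0 < y -> (y `^ 2^-1) ^+ 2 = y.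
  by move=> y0; rewrite -powR_mulrn ?powR_ge0// -powRrM mulVf// powRr1// ltW.
have sq_nhalf (y : R) : 0 < y -> (y `^ (- 2^-1)) ^+ 2 = y^-1.
  by move=> y0; rewrite powRN exprVn sq_half.
have P4core : (exists2 C : R, 0 < C & forall f g : R -> R, L2 (cst 1) f -> L2 (cst 1) g ->
      exists2 l : R,
        inner_value S (fun x => v x `^ 2^-1 * w x `^ t)
          (fun x => u x `^ (- 2^-1) * f x) g l &
        l <= C * norm2 (cst 1) f * norm2 (cst 1) g) ->
    exists2 c, 0 < c & compact_bound a mu nu c.
  move=> [C C0 H]; exists (C ^+ 2); first by rewrite exprn_gt0.
  apply: (form_compact_bound wmu wnu _ (mp u (- 2^-1) mu_) _ _ C0 H).
  - by apply: measurable_funM; exact: mp.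
  - apply: aeW (aeI (aeI v0 w0) enu) _ => x [[vx wx] ->].
    by rewrite exprMn sq_half// /vw wt.
  - by apply: aeW (aeI u0 emu) _ => x [ux ->]; rewrite sq_nhalf.
tfae.
- exact: P12.
- move=> /P21; apply: bounded_form => //.
  + exact: mp.
  + exact: mp.
  + by apply: aeW v0 _ => x; exact: sq_half.
  + by apply: aeW u0 _ => x ux; rewrite sq_nhalf// mulVf// gt_eqF.
- move=> [C C0 H]; exists C; first exact: C0.
  move=> f g Lf Lg; have [l hl le] := H f g Lf Lg; exists l; last exact: le.
  apply: (inner_value_scale lT lS mT mS TS _ _ _ _ hl).
  + exact: mp.
  + by apply: measurable_funM; exact: mp.
  + by case: Lg.
  + by apply: aeW w0 _ => x wx; rewrite -mulrA [w x `^ t * _]mulrC wN// mulr1.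
- move=> /P4core[c c0 cb]; exists c => //.
  have [t1 t2] := compact_bound_global wmu wnu ba (ltW c0) cb.
  by split; [apply: testing_ae t1|apply: testing_ae t2].
- move=> [C C0 [t1 t2]].
  have ui_mu : {ae lebesgue_measure, forall x, ui x = mu x} by apply: aeW emu _ => x ->.
  have vw_nu : {ae lebesgue_measure, forall x, vw x = nu x} by apply: aeW enu _ => x ->.
  have t1' : testing S mu nu (fun _ => setT) C by apply: testing_ae t1.
  have t2' : testing S nu mu (fun _ => setT) C by apply: testing_ae t2.
  have CC : C <= C + 1 by rewrite lerDl.
  have l1 := testing_mono (fun K => ltW (mass_gt0 K wmu)) CC
    (global_local_testing mnu (fun x => ltW (nu0 x)) t1').
  have l2 := testing_mono (fun K => ltW (mass_gt0 K wnu)) CC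
    (global_local_testing mmu (fun x => ltW (mu0 x)) t2').
  have W := global_weak_testing wmu wnu C0 t1'.
  exists (C + 1); first by rewrite addr_gt0.
  split; [exact: weak_testing_ae W| |].
  + by apply: testing_ae l1 => // I; exact: measurable_ditv.
  + by apply: testing_ae l2 => // I; exact: measurable_ditv.
- move=> [C C0 [W t1 t2]].
  have ui_mu : {ae lebesgue_measure, forall x, ui x = mu x} by apply: aeW emu _ => x ->.
  have vw_nu : {ae lebesgue_measure, forall x, vw x = nu x} by apply: aeW enu _ => x ->.
  have mD I : measurable (ditv I : set R) by exact: measurable_ditv.
  have W' : weak_testing S mu nu C by apply: weak_testing_ae W.
  have t1' : testing S mu nu (fun I => ditv I) C by apply: testing_ae t1.
  have t2' : testing S nu mu (fun I => ditv I) C by apply: testing_ae t2.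
  have [c c0 cb] := local_compact_bound wmu wnu ba C0 W' t1' t2'.
  exact: P21 (core2 c c0 cb).
Qed.
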